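(* For all partitions $\lambda$ and $\nu$, $$ b_\lambda^\nu=\sum_{\mu:\ \nu/\mu\ \text{is a vertical strip}} (-1)^{|\nu|-|\lambda|}\,\bigl\langle s_{\mu^T},\, s_{\lambda^T}[L_1+L_2+L_3+\cdots]\bigr\rangle ,$$ where $L_m=\frac1m\sum_{d\mid m}\mu(d)\,p_d^{m/d}$ is the Lyndon symmetric function ($\mu(d)$ here being the number-theoretic M\''obius function). In particular, $(-1)^{|\nu|-|\lambda|}b_\lambda^\nu$ is a nonnegative integer.
   Context: All representations are over $\mathbb{C}$. For a partition $\lambda$, $|\lambda|$ is the sum of its parts, $\ell(\lambda)$ its number of nonzero parts, $\lambda^T$ its transpose. $\mathbb{S}_\lambda$ is the Schur functor, and $\mathrm{Sp}_\nu$ is the Specht module of $\mathfrak{S}_t$ for $\nu$ a partition of $t$. The group $\mathfrak{S}_t$ is embedded in $\mathrm{GL}_t$ as permutation matrices. For $\nu=(\nu_1,\ldots,\nu_r)$ and $t\ge\nu_1+|\nu|$, let $\nu^{(t)}=(t-|\nu|,\nu_1,\ldots,\nu_r)$. Define $a_\lambda^\nu(t)\ge 0$ by $\mathrm{Res}^{\mathrm{GL}_t}_{\mathfrak{S}_t}\mathbb{S}_\lambda(\mathbb{C}^t)\cong\bigoplus_\nu \mathrm{Sp}_{\nu^{(t)}}^{\oplus a_\lambda^\nu(t)}$. By Littlewood, $a_\lambda^\nu(t)$ is independent of $t$ for $t$ large; set $a_\lambda^\nu=\lim_{t\to\infty}a_\lambda^\nu(t)$. Moreover $a_\lambda^\nu=\delta_{\lambda,\nu}$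 whenever $|\lambda|\le|\nu|$. The matrix $[b_\lambda^\nu]$ is the inverse of the uni-triangular matrix $[a_\lambda^\nu]$, indexed as follows: the $b_\lambda^\nu$ are the unique integers with $b_\lambda^\nu=0$ unless $|\lambda|\le|\nu|$ and $\sum_\lambda b_\lambda^\nu a_\lambda^\kappa=\delta_{\nu,\kappa}$ for all partitions $\nu,\kappa$. Symmetric functions: $s_\lambda$ are Schur functions, $p_d$ power sums, and $\langle\cdot,\cdot\rangle$ is the Hall inner product, $\langle s_\lambda,s_\mu\rangle=\delta_{\lambda,\mu}$, extended so that $\langle s_\lambda,F\rangle$ is the coefficient of $s_\lambda$ in $F$ when $F$ is an infinite sum of homogeneous symmetric functions of distinct degrees. A skew shape $\nu/\mu$ (with $\mu\subseteq\nu$) is a vertical strip if it has at most one box in each row (the empty skew shape is allowed). Plethysm: if $g=\sum_\alpha g_\alpha x^\alpha$ with integers $g_\alpha$, then $f[g]=f(y_1,y_2,\ldots)$ where the $y_i$ are defined by $\prod_i(1+y_iq)=\prod_\alpha(1+x^\alpha q)^{g_\alpha}$; equivalently $f\mapsto f[g]$ is the ring homomorphism with $p_k\mapsto\sum_\alpha g_\alpha x^{k\alpha}$. *)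

(* Defs.v *)
From HB Require Import structures.
From mathcomp Require Import all_boot all_order all_fingroup all_algebra.
From mathcomp Require Import mxrepresentation character.
From mathcomp Require Import finmap boolp classical_sets functions cardinality.
From mathcomp Require Import fsbigop.
From mathcomp Require Import monalg.

Set Implicit Arguments.
Unset Strict Implicit.
Unset Printing Implicit Defensive.

Import Order.TTheory GRing.Theory Num.Theory.

Local Open Scope classical_set_scope.
Local Open Scope ring_scope.

Definition is_intpart (s : seq nat) := sorted geq s && (0%N \notin s).

Record intpart := IntPart { parts :> seq nat; _ : is_intpart parts }.

HB.instance Definition _ := [isSub for parts].
HB.instance Definition _ := [Choice of intpart by <:].

Definition transpose_seq (s : seq nat) : seq nat :=
  [seq count (fun x => i < x)%N s | i <- iota 0 (head 0%N s)].

Lemma transpose_seq_is_intpart (lam : intpart) :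
  is_intpart (transpose_seq lam).
Proof.
rewrite /is_intpart; apply/andP; split.
  have mono : {homo (fun i => count (fun x => i < x)%N lam) :
      i j / (i < j)%N >-> geq i j}.
    by move=> i j ij; apply: sub_count => x /=; apply: ltn_trans.
  by apply: (homo_sorted mono); rewrite iota_ltn_sorted.
apply/mapP => -[i]; rewrite mem_iota add0n /= => ilt /esym/eqP.
case: (parts lam) ilt => [|x s] //= ->.
by rewrite add1n.
Qed.

Definition transpose (lam : intpart) : intpart :=
  IntPart (transpose_seq_is_intpart lam).

Definition vertical_strip (nu mu : seq nat) : Prop :=
  forall i, (nth 0 mu i <= nth 0 nu i <= (nth 0 mu i).+1)%N.

(* The boxes of a diagram with n boxes are numbered 0, ..., n - 1 in reading  *)
(* order, so that a tableau of shape s is a function on 'I_(sumn s).          *)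
Definition box_row (s : seq nat) (k : nat) := reshape_index s k.
Definition box_col (s : seq nat) (k : nat) := reshape_offset s k.

Definition row_group n (s : seq nat) : {set 'S_n} :=
  [set p : 'S_n | [forall k, box_row s (p k) == box_row s k]].
Definition col_group n (s : seq nat) : {set 'S_n} :=
  [set p : 'S_n | [forall k, box_col s (p k) == box_col s k]].

Section Representations.
Variable C : fieldType.

Local Notation Sym n := [set: 'S_n]%G.

(* In 'S_n the product (q * p)%g is the composite p \o q.  For the product    *)
(* given by \o, this is the sum of (-1)^q p q over p in the row group and q   *)
(* in the column group, and right translation in regular_repr is left         *)
(* translation: the cyclic module it generates is the left ideal usually      *)
(* taken as the definition of the Specht module.                              *)
Definition young_symmetrizer n (s : seq nat) : 'rV[C]_(gcard (Sym n)) :=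
  \sum_(p in row_group n s) \sum_(q in col_group n s)
     (-1) ^+ q *: delta_mx 0 (gring_index (Sym n) (q * p)%g).

(* Meaningful when sumn s = n. *)
Definition specht n (s : seq nat) : representation C (Sym n) :=
  Representation (submod_repr
    (cyclic_mx_module (regular_repr C (Sym n)) (young_symmetrizer n s))).

(* The n-th tensor power of C^t has its basis indexed by the finite functions *)
(* f : 'I_n -> 'I_t, f standing for the tensor product of the e_(f k);        *)
(* matrices act on row vectors.                                               *)
Definition tbasis n t := {ffun 'I_n -> 'I_t}.

Definition tindex n t (i : 'I_#|{: tbasis n t}|) : tbasis n t := enum_val i.

Definition tensor_mx n t (g : 'M[C]_t) : 'M[C]_#|{: tbasis n t}| :=
  \matrix_(i, j) \prod_(k < n) g (tindex i k) (tindex j k).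

Definition place_mx n t (w : 'S_n) : 'M[C]_#|{: tbasis n t}| :=
  \matrix_(i, j) (tindex j == [ffun k => tindex i (w k)])%:R.

(* Right multiplication by the Young symmetrizer: symmetrize along the rows,  *)
(* then antisymmetrize along the columns.                                     *)
Definition young_mx t (s : seq nat) : 'M[C]_#|{: tbasis (sumn s) t}| :=
  (\sum_(p in row_group (sumn s) s) place_mx t p) *m
  (\sum_(q in col_group (sumn s) s) (-1) ^+ q *: place_mx t q).

(* The matrix of S_s(g) on S_s(C^t), the row space of young_mx t s. *)
Definition schur_functor_mx t (s : seq nat) (g : 'M[C]_t) :
    'M[C]_(\rank (young_mx t s)) :=
  in_submod (young_mx t s)
    (val_submod (U := young_mx t s) 1%:M *m tensor_mx (sumn s) g).

Lemma tensor_mx1 n t : tensor_mx n (1%:M : 'M[C]_t) = 1%:M.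
Proof.
apply/matrixP => i j; rewrite !mxE.
have [->|ij] := eqVneq i j.
  by rewrite big1 // => k _; rewrite !mxE eqxx.
have /existsP[k kP] : [exists k, tindex i k != tindex j k].
  apply: contraNT ij => /existsPn h; apply/eqP/enum_val_inj/ffunP => k.
  by apply/eqP; move: (h k); rewrite negbK.
by rewrite (bigD1 k) //= mxE (negPf kP) mul0r.
Qed.

Lemma tensor_mxM n t (g h : 'M[C]_t) :
  tensor_mx n (g *m h) = tensor_mx n g *m tensor_mx n h.
Proof.
apply/matrixP => i j; rewrite !mxE.
under eq_bigr do rewrite mxE.
rewrite bigA_distr_bigA /= (reindex (@tindex n t)) /=; last first.
  by exists enum_rank => x _; [exact: enum_valK | exact: enum_rankK].
by apply: eq_bigr => u _; rewrite !mxE big_split.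
Qed.

Lemma place_tensorC n t (w : 'S_n) (g : 'M[C]_t) :
  place_mx t w *m tensor_mx n g = tensor_mx n g *m place_mx t w.
Proof.
apply/matrixP => i j; rewrite !mxE.
rewrite (bigD1 (enum_rank ([ffun k => tindex i (w k)] : tbasis n t))) //=.
rewrite mxE /tindex enum_rankK eqxx mul1r big1 ?addr0; last first.
  move=> u /eqP ui; rewrite mxE; case: eqP; rewrite ?mul0r // => e.
  by case: ui; rewrite -e enum_valK.
rewrite (bigD1 (enum_rank ([ffun k => tindex j (w^-1 k)%g] : tbasis n t))) //=.
rewrite !mxE /tindex enum_rankK (_ : enum_val j == _); last first.
  by apply/eqP/ffunP => k; rewrite !ffunE /tindex ?enum_rankK ?ffunE permK.
rewrite mulr1 [X in _ = _ + X]big1 ?addr0; last first.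
  move=> u /eqP uj; rewrite !mxE; case: eqP; rewrite ?mulr0 // => e.
  case: uj; apply: enum_val_inj; rewrite enum_rankK; apply/ffunP => k.
  by rewrite ffunE -/(tindex j) e ffunE permKV.
rewrite [RHS](reindex_inj (@perm_inj _ w)) /=.
by apply: eq_bigr => k _; rewrite !ffunE ?enum_rankK ?ffunE /tindex ?permK.
Qed.

Lemma young_tensorC t s (g : 'M[C]_t) :
  young_mx t s *m tensor_mx (sumn s) g = tensor_mx (sumn s) g *m young_mx t s.
Proof.
rewrite /young_mx -mulmxA mulmxA [RHS]mulmxA.
have -> : tensor_mx (sumn s) g *m \sum_(p in row_group (sumn s) s) place_mx t p
    = (\sum_(p in row_group (sumn s) s) place_mx t p) *m tensor_mx (sumn s) g.
  rewrite mulmx_sumr mulmx_suml; apply: eq_bigr => p _.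
  by rewrite place_tensorC.
rewrite -!mulmxA; congr (_ *m _).
rewrite mulmx_sumr mulmx_suml; apply: eq_bigr => q _.
by rewrite -scalemxAl place_tensorC scalemxAr.
Qed.

Lemma young_tensor_stable t s (g : 'M[C]_t) m
    (W : 'M[C]_(m, #|{: tbasis (sumn s) t}|)) :
  (W <= young_mx t s)%MS -> (W *m tensor_mx (sumn s) g <= young_mx t s)%MS.
Proof.
by case/submxP => D ->; rewrite -mulmxA young_tensorC mulmxA submxMl.
Qed.

Lemma schur_functor_mx1 t s : schur_functor_mx s (1%:M : 'M[C]_t) = 1%:M.
Proof. by rewrite /schur_functor_mx tensor_mx1 mulmx1 val_submodK. Qed.

Lemma schur_functor_mxM t s (g h : 'M[C]_t) :
  schur_functor_mx s (g *m h) = schur_functor_mx s g *m schur_functor_mx s h.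
Proof.
rewrite /schur_functor_mx tensor_mxM mulmxA.
set W := val_submod 1%:M *m tensor_mx _ g.
have sW : (W <= young_mx t s)%MS.
  by apply: young_tensor_stable; exact: val_submodP.
rewrite -{1}(in_submodK sW) val_submodE.
by rewrite -mulmxA in_submodE -mulmxA -in_submodE.
Qed.

Lemma schur_functor_Res_repr t s :
  mx_repr (Sym t) (fun w : 'S_t => schur_functor_mx s (perm_mx w : 'M[C]_t)).
Proof.
split=> [|w w' _ _] /=; first by rewrite perm_mx1 schur_functor_mx1.
by rewrite perm_mxM schur_functor_mxM.
Qed.

Definition schur_functor_Res t (s : seq nat) : representation C (Sym t) :=
  Representation (MxRepresentation (schur_functor_Res_repr t s)).

(* nu^(t), for t >= nu_1 + |nu|. *)
Definition padded t (nu : seq nat) : seq nat := (t - sumn nu)%N :: nu.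

Definition padded_shapes t : {fset intpart} :=
  fset_set [set nu : intpart | (head 0 nu + sumn nu <= t)%N].

Definition is_multiplicity t (lam : intpart) (m : intpart -> nat) : Prop :=
  mx_rsim (schur_functor_Res t lam)
    (\big[dadd_grepr/grepr0]_(nu <- padded_shapes t)
        muln_grepr (specht t (padded t nu)) (m nu)).

Definition acoef_at t (lam nu : intpart) : nat :=
  xget (fun=> 0%N) [set m | is_multiplicity t lam m] nu.

(* The limit as t goes to infinity: an integer sequence converges when it is  *)
(* eventually constant.                                                       *)
Definition acoef (lam nu : intpart) : nat :=
  xget 0%N [set a | exists t0, forall t, (t0 <= t)%N -> acoef_at t lam nu = a].

Definition is_inverse_acoef (b : intpart -> intpart -> int) : Prop :=
  (forall lam nu : intpart, ~~ (sumn lam <= sumn nu)%N -> b lam nu = 0) /\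
  (forall nu kappa : intpart,
     \sum_(lam \in [set: intpart]) b lam nu * (acoef lam kappa)%:Z
       = (nu == kappa)%:Z).

Definition bcoef : intpart -> intpart -> int :=
  xget (fun _ _ => 0) [set b | is_inverse_acoef b].

End Representations.

(* Formal power series over rat, of possibly unbounded degree, in the         *)
(* variables x_0, x_1, x_2, ...                                               *)
Definition mseries := {cmonom nat} -> rat.

HB.instance Definition _ := GRing.Lmodule.copy mseries ({cmonom nat} -> rat^o).

Definition mseries_mul (F G : mseries) : mseries :=
  fun m => \sum_(u \in [set u : {cmonom nat} * {cmonom nat} | (mmul u.1 u.2) = m])
             F u.1 * G u.2.

Definition mseries_one : mseries := fun m => (m == mone)%:R.

Section MSeriesRing.
Implicit Types (F G H : mseries) (m a b c : {cmonom nat}).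

Lemma finite_cm_divisors m :
  finite_set [set a : {cmonom nat} | (forall i, a i <= m i)%N].
Proof.
pose f (h : {ffun finsupp m -> 'I_(mdeg m).+1}) : {cmonom nat} :=
  [cmonom (h i : nat) | i : finsupp m]%M.
apply: (@sub_finite_set _ _ (f @` [set: {ffun finsupp m -> 'I_(mdeg m).+1}])).
  move=> a am; exists [ffun i => inord (a (val i))] => //.
  apply/eqP/cmP => i; rewrite cmE fsfun_ffun.
  case: insubP => [u im ui|im] /=.
    rewrite ffunE inordK ?ui // ltnS (leq_trans (am i)) //.
    by rewrite mdegE (big_fsetD1 i) //= leq_addr.
  by apply/esym/eqP; rewrite -leqn0 (leq_trans (am i)) // leqn0 cmE_eq0.
by apply: finite_image; exact: finite_finset.
Qed.

Definition cm_divisors m : {fset {cmonom nat}} :=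
  fset_set [set a : {cmonom nat} | (forall i, a i <= m i)%N].

Lemma mem_cm_divisors m a :
  reflect (forall i, a i <= m i)%N (a \in cm_divisors m).
Proof.
rewrite in_fset_set; last exact: finite_cm_divisors.
by apply: (iffP idP) => [/set_mem|am] //; apply/mem_set.
Qed.

Lemma mseries_mulE (D : {fset {cmonom nat}}) F G m :
    {subset cm_divisors m <= D} ->
  mseries_mul F G m =
  \sum_(a <- D) \sum_(b <- D) (if mmul a b == m then F a * G b else 0).
Proof.
move=> mD; rewrite /mseries_mul.
rewrite (fsbigE [seq u <- [seq (a, b) | a <- D, b <- D] | mmul u.1 u.2 == m]).
- rewrite big_filter_cond big_mkcond big_allpairs /=.
  apply: eq_bigr => a _; apply: eq_bigr => b _; case: eqP => //= e.
  by rewrite mem_set.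
- apply/filter_uniq/allpairs_uniq; rewrite ?fset_uniq //.
  by move=> [? ?] [? ?] _ _ [-> ->].
- by move=> u /=; rewrite mem_filter => /andP[/eqP].
move=> [a b] /= ab; rewrite mem_filter /= ab eqxx /= => /negP[].
have ha : a \in D.
  by apply: mD; apply/mem_cm_divisors => i; rewrite -ab cmM leq_addr.
have hb : b \in D.
  by apply: mD; apply/mem_cm_divisors => i; rewrite -ab cmM leq_addl.
by apply/allpairsP; exists (a, b).
Qed.

Lemma cm_divisors_sub m a :
  a \in cm_divisors m -> {subset cm_divisors a <= cm_divisors m}.
Proof.
move=> /mem_cm_divisors am b /mem_cm_divisors ba.
by apply/mem_cm_divisors => i; apply: leq_trans (ba i) (am i).
Qed.

Lemma cm_divisorsMl m a b : mmul a b = m -> a \in cm_divisors m.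
Proof. by move=> <-; apply/mem_cm_divisors => i; rewrite cmM leq_addr. Qed.

Lemma cm_divisorsMr m a b : mmul a b = m -> b \in cm_divisors m.
Proof. by rewrite mulmC; exact: cm_divisorsMl. Qed.

Lemma mseries_mulC : commutative mseries_mul.
Proof.
move=> F G; apply: funext => m; rewrite !(@mseries_mulE (cm_divisors m)) //.
rewrite exchange_big /=; apply: eq_bigr => a _; apply: eq_bigr => b _.
by rewrite mulmC mulrC.
Qed.

Lemma mseries_mul1 : left_id mseries_one mseries_mul.
Proof.
move=> F; apply: funext => m; rewrite (@mseries_mulE (cm_divisors m)) //.
have m1 : mone \in cm_divisors m.
  by apply/mem_cm_divisors => i; rewrite cm1.
rewrite (big_fsetD1 _ m1) /= [X in _ + X]big1_seq ?addr0; last first.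
  move=> a /andP[_]; rewrite in_fsetD1 => /andP[a1 _]; apply: big1 => b _.
  by rewrite /mseries_one (negPf a1) mul0r if_same.
have mm : m \in cm_divisors m by apply/mem_cm_divisors.
rewrite (big_fsetD1 _ mm) /= mul1m eqxx big1_seq ?addr0; last first.
  by move=> b /andP[_]; rewrite in_fsetD1 => /andP[bm _]; rewrite mul1m (negPf bm).
by rewrite /mseries_one eqxx mul1r.
Qed.

Lemma mseries_mulDl : left_distributive mseries_mul +%R.
Proof.
move=> F G H; apply: funext => m.
rewrite -[RHS]/(mseries_mul F H m + mseries_mul G H m).
rewrite !(@mseries_mulE (cm_divisors m)) // -big_split /=.
apply: eq_bigr => a _; rewrite -big_split /=; apply: eq_bigr => b _.
by case: eqP; rewrite ?addr0 // -mulrDl.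
Qed.

Lemma mseries_mul3E F G H m (D := cm_divisors m) :
  mseries_mul (mseries_mul F G) H m =
  \sum_(a <- D) \sum_(b <- D) \sum_(c <- D)
    (if mmul (mmul a b) c == m then F a * G b * H c else 0).
Proof.
rewrite (@mseries_mulE D) //.
transitivity (\sum_(e <- D) \sum_(c <- D) \sum_(a <- D) \sum_(b <- D)
    (if (mmul a b == e) && (mmul e c == m) then F a * G b * H c else 0)).
  apply: eq_big_seq => e eD; apply: eq_bigr => c _; case: eqP => [ecm|_].
    rewrite (@mseries_mulE D); last exact: cm_divisors_sub.
    rewrite mulr_suml; apply: eq_bigr => a _; rewrite mulr_suml.
    by apply: eq_bigr => b _; rewrite andbT; case: eqP; rewrite ?mul0r.
  by rewrite big1 // => a _; rewrite big1 // => b _; rewrite andbF.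
under eq_bigr do rewrite exchange_big /=.
rewrite exchange_big /=; apply: eq_bigr => a _.
under eq_bigr do rewrite exchange_big /=.
rewrite exchange_big /=; apply: eq_bigr => b _.
rewrite exchange_big /=; apply: eq_bigr => c _.
have [abcm|abcm] := eqVneq (mmul (mmul a b) c) m; last first.
  by rewrite big1 // => e _; case: eqP => //= <-; rewrite (negPf abcm).
have abD : mmul a b \in D by exact: cm_divisorsMl abcm.
rewrite (big_fsetD1 _ abD) /= eqxx abcm eqxx big1_seq ?addr0 //.
by move=> e /andP[_]; rewrite in_fsetD1 eq_sym => /andP[/negPf -> _].
Qed.

Lemma mseries_mulA : associative mseries_mul.
Proof.
move=> F G H; rewrite [LHS]mseries_mulC; apply: funext => m.
rewrite !mseries_mul3E.
under eq_bigr do rewrite exchange_big /=.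
rewrite exchange_big /=; apply: eq_bigr => a _.
apply: eq_bigr => b _; apply: eq_bigr => c _.
by rewrite (mulmC _ a) -[mmul (mmul a b) c]mulmA mulrC mulrA.
Qed.

Lemma mseries_one_neq0 : mseries_one != 0.
Proof.
apply/eqP => /(congr1 (fun F => F mone)); rewrite /mseries_one eqxx.
exact/eqP/oner_neq0.
Qed.

HB.instance Definition _ := GRing.Zmodule_isComNzRing.Build mseries
  mseries_mulA mseries_mulC mseries_mul1 mseries_mulDl mseries_one_neq0.

End MSeriesRing.

Definition semistandard (s : seq nat) (T : {ffun 'I_(sumn s) -> nat}) : Prop :=
  (forall k l : 'I_(sumn s),
     box_row s k = box_row s l -> (box_col s k < box_col s l)%N ->
     (T k <= T l)%N) /\
  (forall k l : 'I_(sumn s),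
     box_col s k = box_col s l -> (box_row s k < box_row s l)%N ->
     (T k < T l)%N).

Definition tableau_weight n (T : {ffun 'I_n -> nat}) : {cmonom nat} :=
  \big[mmul/mone]_(k < n) ucm (T k).

(* s_lam is the sum of x^T over the semistandard tableaux T of shape lam. *)
Definition schur (lam : intpart) : mseries := fun m =>
  \sum_(T \in [set T | @semistandard lam T /\ tableau_weight T = m]) (1 : rat).

(* p_k = x_0^k + x_1^k + ..., for k > 0. *)
Definition psum (k : nat) : mseries := fun m =>
  \sum_(i \in [set i : nat | expcmn (ucm i) k = m]) (1 : rat).

Definition is_schur_expansion (F : mseries) (c : intpart -> rat) : Prop :=
  forall m, F m = \sum_(lam \in [set: intpart]) c lam * schur lam m.

(* <s_mu, F>, the coefficient of s_mu in F.  F may have unbounded degree: the *)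
(* sum above is finite because s_lam is homogeneous of degree |lam|.          *)
Definition hall_schur (mu : intpart) (F : mseries) : rat :=
  xget (fun=> 0) [set c | is_schur_expansion F c] mu.

Definition is_psum_expansion (f : mseries) (c : intpart -> rat) : Prop :=
  finite_set [set rho | c rho != 0] /\
  forall m, f m = \sum_(rho \in [set: intpart])
                     c rho * (\prod_(k <- parts rho) psum k) m.

(* p_k[g], the sum of g_a x^(k a) over the exponents a, for k > 0. *)
Definition psum_plethysm (k : nat) (g : mseries) : mseries := fun m =>
  \sum_(a \in [set a | expcmn a k = m]) g a.

(* f[g], the image of f under the algebra morphism p_k |-> p_k[g]. *)
Definition plethysm (f g : mseries) : mseries := fun m =>
  \sum_(rho \in [set: intpart])
     xget (fun=> 0) [set c | is_psum_expansion f c] rho *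
       (\prod_(k <- parts rho) psum_plethysm k g) m.

Definition mobius (d : nat) : int :=
  if all (fun p => logn p d == 1%N) (primes d) then (-1) ^+ size (primes d)
  else 0.

Definition lyndon (m : nat) : mseries :=
  (m%:R^-1 : rat) *:
    \sum_(d <- divisors m) ((mobius d)%:~R : rat) *: psum d ^+ (m %/ d).

(* L_1 + L_2 + L_3 + ...; coefficientwise a finite sum, as L_m is homogeneous *)
(* of degree m.                                                               *)
Definition lyndon_series : mseries := fun a =>
  \sum_(m \in [set m : nat | (0 < m)%N]) lyndon m a.

(* Main.v *)
(* A permutation with cycle type sigma acts on S_lam(C^t) with a trace that is a
   polynomial in the numbers of cycles of each length.  Writing p_d for the
   variables, its expansion in Specht characters is the complete series
   1 + h_1 + h_2 + ... times a symmetric function Q_lam.  For large t,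
   kappa^(t)/th is a horizontal strip exactly when th/kappa is, so Pieri's rule
   gives a_lam^kappa as the sum of <s_th, Q_lam> over horizontal strips th/kappa.
   For power sums, Q is built by iterating F |-> D_k F + sum_(d | k) p_d F, where
   D_k is a derivation, and the adjoint of this operator for the Hall product is
   the derivation E_k = sum_(d | k) d (1 + p_d) d/dp_d.  By Moebius inversion E_k
   sends sum_d mu(d)/d log(1 + p_(jd)), the Lyndon series with signs, to k when
   j = k and to 0 otherwise.  Hence plethysms with the Lyndon series are dual to
   the Q_lam, and since signed vertical strips invert horizontal strips, the
   inverse matrix is the claimed one.

   For nonnegativity, <s_kappa, s_mu[L_1 + L_2 + ...]> is the trace, hence the
   rank, of an idempotent on the k-tuples of words in n letters that use each
   letter once: Klyachko's idempotent acts on every word, and the Young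
   idempotents of mu and kappa on the k positions and the n letters. *)

Require Import Defs.
From HB Require Import structures.
From mathcomp Require Import all_boot all_order all_fingroup all_algebra.
From mathcomp Require Import mxrepresentation character.
From mathcomp Require Import finmap boolp classical_sets functions cardinality.
From mathcomp Require Import fsbigop monalg algC cyclotomic reals complex.
From mathcomp Require Import zify ring lra.

Set Implicit Arguments.
Unset Strict Implicit.
Unset Printing Implicit Defensive.

Import Order.TTheory GRing.Theory Num.Theory.

Local Open Scope ring_scope.

(** * Partitions *)

Section Partitions.
Implicit Types (lam mu nu : intpart) (s : seq nat).

Lemma intpart_sorted lam : sorted geq lam.
Proof. by case: lam => s /= /andP[]. Qed.

Lemma intpart_gt0 lam k : k \in parts lam -> (0 < k)%N.
Proof.
by case: lam => s /= /andP[_ s0] ks; rewrite lt0n; apply: contraNneq s0 => <-.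
Qed.

Lemma geq_trans : transitive geq.
Proof. by move=> x y z /= yx xz; apply: leq_trans xz yx. Qed.

Lemma nth_sorted_le s i j : sorted geq s -> (i <= j)%N ->
  (nth 0 s j <= nth 0 s i)%N.
Proof.
move=> ss ij; have [jl|jl] := ltnP j (size s); last by rewrite nth_default.
by apply: (sorted_leq_nth geq_trans) => //; [exact: leqnn |
  rewrite inE; apply: leq_ltn_trans ij jl].
Qed.

Lemma nth_intpart_le lam i j : (i <= j)%N -> (nth 0 lam j <= nth 0 lam i)%N.
Proof. exact/nth_sorted_le/intpart_sorted. Qed.

Lemma nth_intpart_gt0 lam i : (0 < nth 0 lam i)%N = (i < size lam)%N.
Proof.
have [il|il] := ltnP i (size lam); last by rewrite nth_default.
by rewrite (intpart_gt0 (mem_nth 0%N il)).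
Qed.

Lemma intpart_eq lam mu : (forall i, nth 0%N lam i = nth 0%N mu i) -> lam = mu.
Proof.
have le_size (l m : intpart) : (forall i, nth 0%N l i = nth 0%N m i) ->
    (size (parts l) <= size (parts m))%N.
  by move=> e; rewrite leqNgt -nth_intpart_gt0 e nth_default.
move=> e; apply/val_inj; apply: (@eq_from_nth _ 0%N) => [|i _]; last exact: e.
by apply/eqP; rewrite eqn_leq !le_size.
Qed.

Lemma sumn_nth s N : (size s <= N)%N -> sumn s = (\sum_(i < N) nth 0 s i)%N.
Proof.
elim: s N => [|x s IH] [|N] //= sN; first by rewrite big_ord0.
  by rewrite big1 // => i _; rewrite nth_nil.
by rewrite big_ord_recl /= (IH N).
Qed.

Lemma size_intpart_le lam : (size lam <= sumn lam)%N.
Proof.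
rewrite (sumn_nth (leqnn _)) -[X in (X <= _)%N]card_ord -sum1_card.
by apply: leq_sum => i _; rewrite nth_intpart_gt0.
Qed.

Lemma nth_le_sumn s i : (nth 0 s i <= sumn s)%N.
Proof.
have [il|il] := ltnP i (size s); last by rewrite nth_default.
by rewrite (sumn_nth (leqnn _)) (bigD1 (Ordinal il)) //= leq_addr.
Qed.

Lemma sorted_filter_pos s :
  sorted geq s -> is_intpart [seq x <- s | 0 < x]%N.
Proof.
move=> ss; rewrite /is_intpart (sorted_filter geq_trans) //=.
by rewrite mem_filter.
Qed.

Definition empty_part : intpart := IntPart (isT : is_intpart [::]).

Definition to_intpart s : intpart := insubd empty_part [seq x <- s | 0 < x]%N.

Lemma to_intpartE s : sorted geq s ->
  parts (to_intpart s) = [seq x <- s | 0 < x]%N.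
Proof.
by move=> ss; apply: insubdK; apply: sorted_filter_pos.
Qed.

Lemma nth_to_intpart s i : sorted geq s -> nth 0%N (to_intpart s) i = nth 0%N s i.
Proof.
move=> ss; rewrite to_intpartE //; elim: s ss i => [|x s IH] //= xs i.
case: posnP => [x0|x0]; last by case: i => //= i; rewrite IH // (path_sorted xs).
have {}xs : path geq 0%N s by rewrite -x0.
rewrite IH ?(path_sorted xs) //.
have z j : nth 0%N (0 :: s)%N j = 0%N.
  by apply/eqP; rewrite -leqn0; apply: (@nth_sorted_le (0 :: s)%N 0).
rewrite x0 z; exact: (z i.+1).
Qed.

Lemma mkseq_sorted (f : nat -> nat) N :
  (forall i, (f i.+1 <= f i)%N) -> sorted geq (mkseq f N).
Proof.
move=> fS; rewrite /mkseq; apply: (@homo_sorted _ _ f ltn); last exact: iota_ltn_sorted.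
move=> i j /= /ltnW /subnK <-; elim: (j - i)%N => //= n IH.
exact: leq_trans (fS _) IH.
Qed.

Lemma nth_mkpart (f : nat -> nat) N i :
  (forall i, (f i.+1 <= f i)%N) -> f N = 0%N ->
  nth 0%N (to_intpart (mkseq f N)) i = f i.
Proof.
move=> fS fN; rewrite nth_to_intpart ?mkseq_sorted //.
have [iN|Ni] := ltnP i N; first by rewrite nth_mkseq.
rewrite nth_default ?size_mkseq //; apply/esym/eqP; rewrite -leqn0 -{1}fN.
by rewrite -(subnK Ni); elim: (i - N)%N => //= n IH; apply: leq_trans (fS _) IH.
Qed.

Lemma finite_intpart n : finite_set [set lam : intpart | (sumn lam <= n)%N]%classic.
Proof.
pose f (h : {ffun 'I_n.+1 -> 'I_n.+1}) :=
  to_intpart (sort geq [seq (h i : nat) | i : 'I_n.+1]).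
apply: (@sub_finite_set _ _ (f @` [set: {ffun 'I_n.+1 -> 'I_n.+1}])%classic); last first.
  by apply: finite_image; exact: finite_finset.
move=> lam /= ln; exists [ffun i : 'I_n.+1 => inord (nth 0%N lam i)] => //.
have e : [seq (([ffun i : 'I_n.+1 => inord (nth 0%N lam i)] :
     {ffun 'I_n.+1 -> 'I_n.+1}) i : nat) | i : 'I_n.+1]
   = mkseq (nth 0%N lam) n.+1.
  rewrite /mkseq -val_enum_ord -map_comp; apply: eq_map => i /=.
  by rewrite ffunE inordK // ltnS; apply: leq_trans (nth_le_sumn _ _) ln.
have ss : sorted geq (mkseq (nth 0%N lam) n.+1).
  by apply: mkseq_sorted => i; apply: nth_intpart_le.
rewrite /f e sorted_sort //; last exact: geq_trans.
apply: intpart_eq => i; rewrite nth_mkpart //; first by move=> j; apply: nth_intpart_le.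
by rewrite nth_default // (leq_trans (size_intpart_le _)) // ltnW.
Qed.

Fact ptn_key : unit. Proof. by []. Qed.

Definition ptn n : seq intpart := locked_with ptn_key
  [seq lam <- enum_fset (fset_set [set lam : intpart | (sumn lam <= n)%N]%classic)
  | sumn (parts lam) == n].

Lemma mem_ptn n lam : (lam \in ptn n) = (sumn lam == n).
Proof.
rewrite /ptn locked_withE mem_filter andbC; case: eqP => [<-|]; last by rewrite andbF.
rewrite andbT; have := in_fset_set (finite_intpart (sumn lam)) lam.
by move=> h; apply: etrans h _; apply/mem_set => /=.
Qed.

Lemma ptn_uniq n : uniq (ptn n).
Proof. by rewrite /ptn locked_withE; exact/filter_uniq/fset_uniq. Qed.

Lemma sum_delta (T : eqType) (V : nmodType) (s : seq T) (x : T) (F : T -> V) :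
  uniq s -> \sum_(y <- s | y == x) F y = if x \in s then F x else 0.
Proof.
move=> us; rewrite -big_filter; have [xs|xs] := boolP (x \in s).
  by rewrite filter_pred1_uniq // big_seq1.
rewrite (_ : filter _ _ = [::]) ?big_nil //.
by apply/eqP; rewrite -(negbK (_ == _)) -has_filter has_pred1.
Qed.

Definition colsum s c := (\sum_(x <- s) minn x c)%N.

Lemma colsumE s N c : (size s <= N)%N ->
  colsum s c = (\sum_(i < N) minn (nth 0 s i) c)%N.
Proof.
rewrite /colsum; elim: s N => [|x s IH] [|N] //= sN; rewrite ?big_ord0 ?big_nil //.
  by rewrite big1 // => i _; rewrite nth_nil min0n.
by rewrite big_ord_recl big_cons /= (IH N).
Qed.

Lemma colsum_sumn s c : (sumn s <= c)%N -> colsum s c = sumn s.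
Proof.
rewrite /colsum; elim: s => [|x s IH] /= sc; rewrite ?big_nil // big_cons IH.
  by rewrite (minn_idPl _) // (leq_trans _ sc) // leq_addr.
by apply: leq_trans sc; rewrite leq_addl.
Qed.

Definition colsum_le s t := forall c, (colsum s c <= colsum t c)%N.

Lemma colsum_inj lam mu : (forall c, colsum lam c = colsum mu c) -> lam = mu.
Proof.
have colS (l : intpart) c : (colsum l c.+1 - colsum l c = count (fun x => c < x) l)%N.
  rewrite /colsum; elim: (parts l) => [|x s IH]; rewrite ?big_nil //= !big_cons -IH.
  have : (\sum_(j <- s) minn j c <= \sum_(j <- s) minn j c.+1)%N.
    by apply: leq_sum => i _; rewrite leq_min geq_minl /= ltnW // ltnS geq_minr.
  by lia.
move=> e.
have {colS}e c : count (fun x => c < x)%N lam = count (fun x => c < x)%N mu.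
  by rewrite -!colS !e.
have sz (l : intpart) i c :
    (i < count (fun x => c < x)%N l)%N = (c < nth 0%N l i)%N.
  have := intpart_sorted l; elim: (parts l) i => [|x s IH] i; first by rewrite nth_nil.
  move=> xs; have ss := path_sorted xs; rewrite /=; case: (ltnP c x) => cx.
    by case: i => [|i] //=; rewrite add1n ltnS IH.
  rewrite add0n IH //; case: i => [|i] /=.
    rewrite [RHS]ltnNge cx; apply/negbTE; rewrite -leqNgt.
    exact: leq_trans (@nth_sorted_le (x :: s) 0 1 xs isT) cx.
  apply/idP/idP => [h|]; last first.
    by rewrite ltnNge (leq_trans (@nth_sorted_le (x :: s) 0 i.+1 xs isT) cx).
  by move: h; rewrite ltnNge
    (leq_trans (@nth_sorted_le (x :: s) 0 i.+2 xs isT) cx).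
have lt i c : (c < nth 0%N lam i)%N = (c < nth 0%N mu i)%N by rewrite -!sz e.
apply: intpart_eq => i; have := lt i (nth 0%N mu i); have := lt i (nth 0%N lam i).
by rewrite !ltnn; lia.
Qed.

Definition colsum_rank s := (\sum_(c < (sumn s).+1) colsum s c)%N.

Lemma colsum_le_rank lam mu : sumn lam = sumn mu -> colsum_le lam mu ->
  lam = mu \/ (colsum_rank lam < colsum_rank mu)%N.
Proof.
move=> e le; have [->|ne] := eqVneq lam mu; [by left | right].
have [c cP] : exists c, colsum lam c != colsum mu c.
  apply: contrapT => h; case/eqP: ne; apply: colsum_inj => c.
  by apply/eqP; apply: contrapT => /negP hc; apply: h; exists c.
have cs : (c < (sumn mu).+1)%N.
  rewrite ltnNge; apply: contra cP => cs; rewrite !colsum_sumn ?e //; exact: ltnW.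
rewrite /colsum_rank e (bigD1 (Ordinal cs)) //= [ltnRHS](bigD1 (Ordinal cs)) //=.
rewrite -addSn; apply: leq_add; first by rewrite ltn_neqAle cP le.
by apply: leq_sum => i _; exact: le.
Qed.
End Partitions.

(** * Group algebras *)

Section GroupAlgebra.
Variable gT : finGroupType.

Definition galg := gT -> rat.
HB.instance Definition _ := GRing.Lmodule.copy galg (gT -> rat^o).
Implicit Types (f h k : galg) (g z : gT).

Definition galg_mul f h : galg := fun g => \sum_x f x * h (x^-1 * g)%g.
Definition galg_one : galg := fun g => (g == 1%g)%:R.

Lemma galg_mulA : associative galg_mul.
Proof.
move=> f h k; apply: funext => g; rewrite /galg_mul.
transitivity (\sum_x \sum_y f x * (h (x^-1 * y)%g * k (y^-1 * g)%g)).
  apply: eq_bigr => x _; rewrite mulr_sumr (reindex_inj (mulgI x^-1%g)) /=.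
  by apply: eq_bigr => y _; rewrite invMg invgK -mulgA mulKVg.
rewrite exchange_big; apply: eq_bigr => y _; rewrite mulr_suml.
by apply: eq_bigr => x _; rewrite mulrA.
Qed.

Lemma galg_mul1l : left_id galg_one galg_mul.
Proof.
move=> f; apply: funext => g; rewrite /galg_mul (bigD1 1%g) //= /galg_one eqxx.
rewrite mul1r invg1 mul1g big1 ?addr0 // => x /negPf ->; exact: mul0r.
Qed.

Lemma galg_mul1r : right_id galg_one galg_mul.
Proof.
move=> f; apply: funext => g; rewrite /galg_mul (bigD1 g) //= /galg_one.
rewrite mulVg eqxx mulr1 big1 ?addr0 // => x xg; case: eqP => [/eqP|]; last first.
  by rewrite mulr0.
by rewrite -eq_mulVg1 (negPf xg).
Qed.

Lemma galg_mulDl : left_distributive galg_mul +%R.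
Proof.
move=> f h k; apply: funext => g.
rewrite -[RHS]/(galg_mul f k g + galg_mul h k g) -big_split /=.
by apply: eq_bigr => x _; rewrite -mulrDl.
Qed.

Lemma galg_mulDr : right_distributive galg_mul +%R.
Proof.
move=> f h k; apply: funext => g.
rewrite -[RHS]/(galg_mul f h g + galg_mul f k g) -big_split /=.
by apply: eq_bigr => x _; rewrite -mulrDr.
Qed.

Lemma galg_one_neq0 : galg_one != 0.
Proof.
apply/eqP => /(congr1 (fun f => f 1%g)); rewrite /galg_one eqxx.
exact/eqP/oner_neq0.
Qed.

HB.instance Definition _ := GRing.Zmodule_isNzRing.Build galg
  galg_mulA galg_mul1l galg_mul1r galg_mulDl galg_mulDr galg_one_neq0.

Lemma galg_scaleAl (a : rat) f h : a *: (f * h) = (a *: f) * h.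
Proof.
apply: funext => g; rewrite -[LHS]/(a * galg_mul f h g) mulr_sumr.
by apply: eq_bigr => x _; rewrite mulrA.
Qed.

HB.instance Definition _ := GRing.Lmodule_isLalgebra.Build rat galg galg_scaleAl.

Lemma galg_scaleAr (a : rat) f h : a *: (f * h) = f * (a *: h).
Proof.
apply: funext => g; rewrite -[LHS]/(a * galg_mul f h g) mulr_sumr.
by apply: eq_bigr => x _; rewrite mulrCA.
Qed.

HB.instance Definition _ := GRing.Lalgebra_isAlgebra.Build rat galg galg_scaleAr.

Lemma galgME f h g : (f * h) g = \sum_x f x * h (x^-1 * g)%g.
Proof. by []. Qed.

Lemma galgZE (a : rat) f g : (a *: f) g = a * f g. Proof. by []. Qed.

Lemma galg_sumE I (r : seq I) (F : I -> galg) g :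
  (\sum_(i <- r) F i) g = \sum_(i <- r) F i g.
Proof. exact: (big_morph (fun f : galg => f g)). Qed.

Definition gdelta g : galg := fun x => (x == g)%:R.

Lemma mul_gdeltal g f x : (gdelta g * f) x = f (g^-1 * x)%g.
Proof.
rewrite galgME (bigD1 g) //= /gdelta eqxx mul1r big1 ?addr0 // => y /negPf ->.
exact: mul0r.
Qed.

Lemma mul_gdeltar g f x : (f * gdelta g) x = f (x * g^-1)%g.
Proof.
rewrite galgME (bigD1 (x * g^-1)%g) //= /gdelta invMg invgK mulgKV eqxx mulr1.
rewrite big1 ?addr0 // => y yx; case: eqP => [e|]; last by rewrite mulr0.
by case/eqP: yx; rewrite -e invMg invgK mulKVg.
Qed.

Lemma gdeltaM g z : gdelta (g * z)%g = gdelta g * gdelta z.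
Proof.
apply: funext => x; rewrite mul_gdeltal /gdelta; congr (_%:R).
by rewrite -(inj_eq (mulgI g^-1%g)) mulKg.
Qed.

Lemma galg_expand f : f = \sum_g f g *: gdelta g.
Proof.
apply: funext => x; rewrite galg_sumE (bigD1 x) //= galgZE /gdelta eqxx mulr1.
rewrite big1 ?addr0 // => y; rewrite eq_sym galgZE => /negPf ->; exact: mulr0.
Qed.

Definition ginv f : galg := fun g => f g^-1%g.

Lemma ginvM f h : ginv (f * h) = ginv h * ginv f.
Proof.
apply: funext => g; rewrite /ginv !galgME (reindex_inj (mulgI g^-1)%g) /=.
apply: eq_bigr => x _; rewrite mulrC; congr (_ * _); congr (_ _).
  by rewrite invMg invgK mulgK.
by rewrite invMg invgK.
Qed.

Lemma ginvZ a f : ginv (a *: f) = a *: ginv f.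
Proof. by []. Qed.

Definition gtrace f h := \sum_z (f * gdelta z * h) z.

Lemma gtraceE f h :
  gtrace f h = \sum_z \sum_g f g * h (z^-1 * g^-1 * z)%g.
Proof.
apply: eq_bigr => z _; rewrite galgME (reindex_inj (mulIg z)) /=.
by apply: eq_bigr => g _; rewrite mul_gdeltar mulgK invMg.
Qed.

Lemma gtraceC f h : gtrace f h = gtrace h f.
Proof.
rewrite !gtraceE (reindex_inj invg_inj); apply: eq_bigr => z _ /=.
rewrite (reindex_inj (inj_comp invg_inj (conjg_inj z))) /=.
apply: eq_bigr => g _; rewrite mulrC invgK; congr (_ * _); congr (_ _).
  by rewrite invgK conjgE !mulgA mulgV mul1g mulgK.
by rewrite -conjVg conjgE mulgA.
Qed.

Lemma gtraceZl a f h : gtrace (a *: f) h = a * gtrace f h.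
Proof. by rewrite /gtrace mulr_sumr; apply: eq_bigr => z _; rewrite -!scalerAl. Qed.

Lemma gtraceZr a f h : gtrace f (a *: h) = a * gtrace f h.
Proof. by rewrite gtraceC gtraceZl gtraceC. Qed.

End GroupAlgebra.

Lemma mxtrace_quasi_idem (F : fieldType) n (A : 'M[F]_n) c :
  A *m A = c *: A -> \tr A = c * (\rank A)%:R.
Proof.
move=> AA.
have : row_free (row_base A) by exact: row_base_free.
have : row_full (col_base A) by exact: col_base_full.
move: (col_base A) (row_base A) (mulmx_base A); move: (\rank A) => r.
move=> cb rb defA fc fr.
have e : rb *m cb = c%:M.
  apply: (row_free_inj fr); apply: (row_full_inj fc).
  rewrite /= mul_scalar_mx -scalemxAr defA -AA -defA.
  by rewrite !mulmxA.
by rewrite -defA mxtrace_mulC e mxtrace_scalar mulr_natr.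
Qed.

Lemma gquasi_idem_trace (gT : finGroupType) (f : galg gT) (c : rat) :
  f * f = c *: f -> exists r : nat, #|gT|%:R * f 1%g = c * r%:R.
Proof.
move=> ff.
pose L (h : galg gT) : 'M[rat]_#|gT| :=
  \matrix_(i, j) h ((enum_val i)^-1 * enum_val j)%g.
have LM h k : L h *m L k = L (h * k).
  apply/matrixP => i j; rewrite !mxE galgME.
  rewrite (reindex_inj (mulgI (enum_val i)^-1%g)) /=.
  rewrite (reindex (fun i : 'I_#|gT| => enum_val i)) /=; last first.
    by exists enum_rank => x _; [exact: enum_valK | exact: enum_rankK].
  by apply: eq_bigr => l _; rewrite !mxE invMg invgK mulgA mulgK.
exists (\rank (L f)).
rewrite -mxtrace_quasi_idem; last by rewrite LM ff; apply/matrixP => i j; rewrite !mxE.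
rewrite /mxtrace (eq_bigr (fun=> f 1%g)); last by move=> i _; rewrite mxE mulVg.
by rewrite sumr_const card_ord mulr_natl.
Qed.

(** * Young symmetrizers *)

Section YoungSymmetrizers.
Implicit Types (lam mu : intpart).

Lemma box_row_cons x s k : box_row (x :: s) k =
  if (k < x)%N then 0%N else (box_row s (k - x)).+1.
Proof.
rewrite /box_row /reshape_index /= subn_eq0; case: ltnP => // xk.
by rewrite subSn.
Qed.

Lemma box_col_cons x s k : box_col (x :: s) k =
  if (k < x)%N then k else box_col s (k - x).
Proof.
rewrite /box_col /reshape_offset -!/(box_row _ _) box_row_cons.
by case: ltnP => xk /=; rewrite ?subn0 ?subnDA.
Qed.

Lemma sum_boxes (V : nmodType) s (F : nat -> nat -> V) :
  \sum_(0 <= k < sumn s) F (box_row s k) (box_col s k) =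
  \sum_(0 <= i < size s) \sum_(0 <= j < nth 0%N s i) F i j.
Proof.
elim: s F => [|x s IH] F /=; first by rewrite !big_nil.
rewrite (big_cat_nat (n := x)) //= ?leq_addr // big_nat_recl //; congr (_ + _).
  apply: eq_big_nat => k /andP[_ kx].
  by rewrite box_row_cons box_col_cons kx.
rewrite -{1}[x]add0n big_addn addKn -(IH (fun i => F i.+1)).
apply: eq_big_nat => k _.
by rewrite box_row_cons box_col_cons ltnNge leq_addl /= addnK.
Qed.

Lemma box_row_lt s k : (k < sumn s)%N -> (box_row s k < size s)%N.
Proof. exact: reshape_indexP. Qed.

Lemma box_col_lt s k : (k < sumn s)%N -> (box_col s k < nth 0 s (box_row s k))%N.
Proof. exact: reshape_offsetP. Qed.

Lemma box_inj s k l : box_row s k = box_row s l -> box_col s k = box_col s l -> k = l.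
Proof.
move=> r c; rewrite -(reshape_indexK s k) -(reshape_indexK s l).
by rewrite -/(box_row s k) -/(box_col s k) r c.
Qed.

Variable n : nat.
Implicit Types (s : seq nat) (g p q : 'S_n).

Lemma mem_row_group s p :
  reflect (forall k, box_row s (p k) = box_row s k) (p \in row_group n s).
Proof. by rewrite inE; apply: (iffP forallP) => h k; apply/eqP; rewrite h. Qed.

Lemma mem_col_group s p :
  reflect (forall k, box_col s (p k) = box_col s k) (p \in col_group n s).
Proof. by rewrite inE; apply: (iffP forallP) => h k; apply/eqP; rewrite h. Qed.

Lemma row_groupMr s p q : p \in row_group n s ->
  (q * p \in row_group n s)%g = (q \in row_group n s).
Proof.
move=> /mem_row_group hp; apply/mem_row_group/mem_row_group => h k.
  by have := h k; rewrite permM hp.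
by rewrite permM hp.
Qed.

Lemma row_groupV s p : (p^-1 \in row_group n s)%g = (p \in row_group n s).
Proof.
apply/mem_row_group/mem_row_group => h k; first by rewrite -(h (p k)) permK.
by rewrite -[in RHS](permKV p k) h.
Qed.

Lemma col_groupMl s p q : p \in col_group n s ->
  (p * q \in col_group n s)%g = (q \in col_group n s).
Proof.
move=> /mem_col_group hp; apply/mem_col_group/mem_col_group => h k.
  by have := h (p^-1%g k); rewrite permM permKV => ->; rewrite -{2}(permKV p k) hp.
by rewrite permM h hp.
Qed.

Lemma col_groupV s p : (p^-1 \in col_group n s)%g = (p \in col_group n s).
Proof.
apply/mem_col_group/mem_col_group => h k; first by rewrite -(h (p k)) permK.
by rewrite -[in RHS](permKV p k) h.
Qed.

Lemma row_col_group1 s p : p \in row_group n s -> p \in col_group n s -> p = 1%g.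
Proof.
move=> /mem_row_group r /mem_col_group c; apply/permP => k; rewrite perm1.
by apply/val_inj/(box_inj (r k) (c k)).
Qed.

Definition rowsum s : galg 'S_n := fun p => (p \in row_group n s)%:R.
Definition colsgn s : galg 'S_n := fun q => (q \in col_group n s)%:R * (-1) ^+ q.

Lemma rowsum_absorb s p : p \in row_group n s ->
  rowsum s * gdelta p = rowsum s.
Proof.
move=> hp; apply: funext => g; rewrite mul_gdeltar /rowsum.
by rewrite row_groupMr // row_groupV.
Qed.

Lemma colsgn_absorb s q : q \in col_group n s ->
  gdelta q * colsgn s = (-1) ^+ q *: colsgn s.
Proof.
move=> hq; apply: funext => g; rewrite mul_gdeltal galgZE /colsgn.
rewrite col_groupMl ?col_groupV // odd_permM odd_permV signr_addb mulrCA.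
by [].
Qed.

Lemma ginv_rowsum s : ginv (rowsum s) = rowsum s.
Proof. by apply: funext => p; rewrite /ginv /rowsum row_groupV. Qed.

Lemma ginv_colsgn s : ginv (colsgn s) = colsgn s.
Proof. by apply: funext => p; rewrite /ginv /colsgn col_groupV odd_permV. Qed.

Definition transversal_to mu lam g :=
  injective (fun k : 'I_n => (box_row mu k, box_col lam (g k))).

Lemma young_mul0 mu lam g : ~ transversal_to mu lam g ->
  rowsum mu * gdelta g * colsgn lam = 0.
Proof.
move=> ninj.
have [k [l [kl r c]]] : exists k l : 'I_n,
    [/\ k != l, box_row mu k = box_row mu l & box_col lam (g k) = box_col lam (g l)].
  apply: contrapT => h; apply: ninj => k l [r c]; apply: contrapT => /eqP kl.
  by apply: h; exists k, l.
have tr : tperm k l \in row_group n mu.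
  by apply/mem_row_group => i; case: tpermP => [->|->|].
have tc : tperm (g k) (g l) \in col_group n lam.
  by apply/mem_col_group => i; case: tpermP => [->|->|].
set X := _ * _ * _.
have e : X = - X.
  rewrite {1}/X -{1}(rowsum_absorb tr).
  rewrite -(mulrA (rowsum mu)) -gdeltaM.
  have -> : (tperm k l * g = g * tperm (g k) (g l))%g.
    by rewrite -tpermJ conjgE !mulgA mulgV mul1g.
  rewrite gdeltaM mulrA -(mulrA _ _ (colsgn lam)) colsgn_absorb // odd_tperm.
  by rewrite (inj_eq perm_inj) kl expr1 scaleN1r mulrN.
apply: funext => z; have := congr1 (fun f => f z) e => /eqP.
rewrite -[(- X) z]/(- X z) -subr_eq0 opprK -mulr2n mulrn_eq0 /=.
by move=> /eqP.
Qed.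

Section Transversal.
Variables (mu lam : intpart) (g : 'S_n).
Hypotheses (mun : sumn mu = n) (lamn : sumn lam = n).
Hypothesis inj : transversal_to mu lam g.

Definition rowcount c i :=
  #|[set k : 'I_n | (box_row mu k == i) && (box_col lam (g k) < c)%N]|.

Lemma sum_box_ord s (F : nat -> nat -> nat) : sumn s = n ->
  (\sum_(k < n) F (box_row s k) (box_col s k) =
   \sum_(0 <= i < size s) \sum_(0 <= j < nth 0%N s i) F i j)%N.
Proof.
by move=> sn; rewrite -sum_boxes sn -(big_mkord xpredT (fun k => F (box_row s k) (box_col s k))).
Qed.

Lemma sum_mem_nat (P : pred nat) m : (\sum_(0 <= j < m) P j = count P (iota 0 m))%N.
Proof. by rewrite /index_iota subn0 -sum1_count [RHS]big_mkcond /=;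
  apply: eq_bigr => j _; case: (P j). Qed.

Lemma row_card i : #|[set k : 'I_n | box_row mu k == i]| = nth 0%N mu i.
Proof.
rewrite -sum1dep_card big_mkcond /=.
rewrite (eq_bigr (fun k : 'I_n => (box_row mu k == i) : nat)); last first.
  by move=> k _; case: eqP.
rewrite (sum_box_ord (fun r _ => (r == i) : nat) mun).
under eq_bigr do rewrite sum_nat_const_nat subn0.
have [il|il] := ltnP i (size mu); last first.
  rewrite nth_default // big1_seq // => r; rewrite mem_index_iota /= => rl.
  by case: eqP => [ri|]; rewrite ?muln0 //; move: rl; rewrite ri ltnNge il.
rewrite (bigD1_seq i) ?mem_index_iota ?iota_uniq //= eqxx muln1 big1 ?addn0 //.
by move=> r /negPf ->; rewrite muln0.
Qed.

Lemma rowcount_le c i : (rowcount c i <= minn (nth 0 mu i) c)%N.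
Proof.
rewrite leq_min -row_card; apply/andP; split.
  by apply/subset_leq_card/fintype.subsetP => k; rewrite !inE => /andP[].
rewrite /rowcount; set A := [set k | _].
have [c0|c0] := posnP c.
  by rewrite c0 leqn0 cards_eq0; apply/eqP/setP => k; rewrite !inE c0 ltn0 andbF.
have iA : {in A &, injective (fun k => inord (box_col lam (g k)) : 'I_c.-1.+1)}.
  move=> k l; rewrite !inE => /andP[/eqP rk ck] /andP[/eqP rl cl].
  move=> /(congr1 (@nat_of_ord _)); rewrite !inordK ?prednK // => cc.
  by apply: inj; rewrite rk rl cc.
have := max_card (mem [set (inord (box_col lam (g k)) : 'I_c.-1.+1) | k in A]).
by rewrite card_in_imset // card_ord prednK.
Qed.

Lemma colsum_rowcount c : colsum lam c = (\sum_(i < size mu) rowcount c i)%N.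
Proof.
transitivity (\sum_(k < n) (box_col lam (g k) < c))%N.
  rewrite -(@reindex_inj _ _ _ _ _ xpredT (fun k : 'I_n =>
    (box_col lam k < c)%N : nat) (@perm_inj _ g)) /=.
  rewrite (sum_box_ord (fun _ r => (r < c)%N : nat) lamn).
  rewrite (colsumE c (leqnn _)) -(big_mkord xpredT (fun i => minn (nth 0 lam i) c)%N).
  apply: eq_bigr => i _; rewrite sum_mem_nat.
  elim: (nth 0 lam i)%N => [|m IH]; first by rewrite min0n.
  by rewrite -addn1 iotaD count_cat -IH add0n /= addn0; case: ltnP; lia.
under [RHS]eq_bigr do rewrite /rowcount -sum1dep_card big_mkcond /=.
rewrite exchange_big /=; apply: eq_bigr => k _.
have kr : (box_row mu k < size mu)%N by apply: box_row_lt; rewrite mun.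
rewrite (bigD1 (Ordinal kr)) //= eqxx big1 ?addn0; first by case: (_ < _)%N.
move=> i; rewrite -val_eqE /= eq_sym => /negPf ->.
by [].
Qed.

Lemma transversal_colsum_le : colsum_le lam mu.
Proof.
move=> c; rewrite colsum_rowcount (colsumE c (leqnn (size mu))).
by apply: leq_sum => i _; apply: rowcount_le.
Qed.
End Transversal.

Lemma transversal_factor lam g : sumn lam = n -> transversal_to lam lam g ->
  exists p q, [/\ p \in row_group n lam, q \in col_group n lam & g = (p * q)%g].
Proof.
move=> lamn inj.
have full c i : rowcount lam lam g c i = minn (nth 0%N lam i) c.
  have [il|il] := ltnP i (size lam); last first.
    have := rowcount_le lamn inj c i.
    by rewrite [nth _ _ _]nth_default // min0n leqn0 => /eqP.
  apply/eqP; rewrite eqn_leq rowcount_le //=.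
  have := colsum_rowcount g lamn lamn c.
  rewrite (colsumE c (leqnn _)) (bigD1 (Ordinal il)) //=.
  rewrite [X in _ = X -> _](bigD1 (Ordinal il)) //=.
  have : (\sum_(i0 < size lam | i0 != Ordinal il) rowcount lam lam g c i0 <=
          \sum_(i0 < size lam | i0 != Ordinal il) minn (nth 0 lam i0) c)%N.
    by apply: leq_sum => j _; apply: rowcount_le.
  move=> le e.
  rewrite -(leq_add2r (\sum_(j < size lam | j != Ordinal il) minn (nth 0 lam j) c)).
  by rewrite e leq_add2l.
have lt (k : 'I_n) : (box_col lam (g k) < nth 0 lam (box_row lam k))%N.
  set i := box_row lam k.
  have := full (nth 0%N lam i) i; rewrite minnn -(row_card lamn i) /rowcount.
  set A := [set _ | _]; set B := [set _ | _ == i] => AB.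
  have sAB : A \subset B by apply/fintype.subsetP => l; rewrite !inE => /andP[].
  have /eqP E : A == B by rewrite eqEcard sAB AB leqnn.
  have : k \in A by rewrite E inE.
  by rewrite inE => /andP[].
have bnd (k : 'I_n) : (flatten_index lam (box_row lam k) (box_col lam (g k)) < n)%N.
  by rewrite -[X in (_ < X)%N]lamn; apply: flatten_indexP.
pose f k : 'I_n := Ordinal (bnd k).
have fr k : box_row lam (f k) = box_row lam k by exact: flatten_indexKl.
have fc k : box_col lam (f k) = box_col lam (g k) by exact: flatten_indexKr.
have fi : injective f.
  by move=> k l e; apply: inj; rewrite -!fc -fr -(fr l) e.
exists (perm fi), ((perm fi)^-1 * g)%g; split; last by rewrite mulKVg.
  by apply/mem_row_group => k; rewrite permE.
apply/mem_col_group => k; rewrite permM -fc -(permE fi) permKV.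
by [].
Qed.

Definition row_col s : galg 'S_n := rowsum s * colsgn s.
Definition young s : galg 'S_n := colsgn s * rowsum s.

Lemma ginv_young s : ginv (row_col s) = young s.
Proof. by rewrite /row_col ginvM ginv_rowsum ginv_colsgn. Qed.

Lemma row_col_factor s p q : p \in row_group n s -> q \in col_group n s ->
  row_col s (p * q)%g = (-1) ^+ q.
Proof.
move=> pr qc; rewrite /row_col galgME (bigD1 p) //= mulKg /rowsum /colsgn pr qc.
rewrite !mul1r big1 ?addr0 // => r rp; have [rr|] := boolP (r \in _); last by rewrite mul0r.
have [rc|] := boolP (_ \in col_group n s); last by rewrite mul0r mulr0.
case/eqP: rp; apply/esym; apply: (mulgI r^-1%g); rewrite mulVg.
apply: (@row_col_group1 s); first by rewrite row_groupMr // row_groupV.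
have : (r^-1 * (p * q) * q^-1)%g \in col_group n s by rewrite col_groupMl ?col_groupV.
by rewrite mulgA mulgK.
Qed.

Lemma row_col_neq0 s g : row_col s g != 0 ->
  exists p q, [/\ p \in row_group n s, q \in col_group n s & g = (p * q)%g].
Proof.
move=> nz; apply: contrapT => h; case/eqP: nz; rewrite /row_col galgME.
apply: big1 => p _; rewrite /rowsum /colsgn.
have [rr|] := boolP (p \in _); last by rewrite mul0r.
have [rc|] := boolP (_ \in col_group n s); last by rewrite mul0r mulr0.
by case: h; exists p, (p^-1 * g)%g; rewrite mulKVg.
Qed.

Variable lam : intpart.
Hypothesis lamn : sumn lam = n.

Lemma row_col_sandwich g :
  rowsum lam * gdelta g * colsgn lam = row_col lam g *: row_col lam.
Proof.
have [inj|ninj] := pselect (transversal_to lam lam g).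
  have [p [q [pr qc ->]]] := transversal_factor lamn inj.
  rewrite row_col_factor // gdeltaM mulrA rowsum_absorb // -mulrA.
  by rewrite colsgn_absorb // scalerAr.
rewrite young_mul0 //; have [->|] := eqVneq (row_col lam g) 0.
  by rewrite scale0r.
move=> /row_col_neq0[p [q [/mem_row_group pr /mem_col_group qc e]]]; case: ninj.
move=> k l; rewrite e !permM !qc => -[r c]; apply/(@perm_inj _ p)/val_inj.
by apply: (@box_inj lam) => //; rewrite !pr.
Qed.

Lemma row_col_sandwich_sum (f : galg 'S_n) :
  rowsum lam * f * colsgn lam = (\sum_g f g * row_col lam g) *: row_col lam.
Proof.
rewrite {1}(galg_expand f) mulr_sumr mulr_suml scaler_suml.
apply: eq_bigr => g _.
by rewrite -scalerAr -scalerAl row_col_sandwich scalerA.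
Qed.

Definition young_coef : rat := \sum_g young lam g * row_col lam g.

Lemma row_col1 : row_col lam 1%g = 1.
Proof.
rewrite -{1}(mulg1 1%g) row_col_factor ?odd_perm1 //.
  by apply/mem_row_group => k; rewrite perm1.
by apply/mem_col_group => k; rewrite perm1.
Qed.

Lemma row_col_sq : row_col lam * row_col lam = young_coef *: row_col lam.
Proof.
rewrite -row_col_sandwich_sum /row_col /young.
by rewrite !mulrA.
Qed.

Lemma young_sq : young lam * young lam = young_coef *: young lam.
Proof. by rewrite -ginv_young -ginvM row_col_sq ginvZ. Qed.

Lemma young1 : young lam 1%g = 1.
Proof. by rewrite -ginv_young /ginv invg1 row_col1. Qed.

Lemma young_coef_neq0 : young_coef != 0.
Proof.
have [r] := gquasi_idem_trace young_sq; rewrite young1 mulr1 => e.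
apply: contraTneq isT => c0; move/eqP: e; rewrite c0 mul0r pnatr_eq0.
by rewrite card_Sn; have := fact_gt0 n; case: (n`!)%N.
Qed.

Definition specht_idem : galg 'S_n := young_coef^-1 *: young lam.

Lemma specht_idemM : specht_idem * specht_idem = specht_idem.
Proof.
rewrite -scalerAl -scalerAr young_sq !scalerA; congr (_ *: _).
by rewrite -mulrA mulVf ?mulr1 // young_coef_neq0.
Qed.

Lemma gtrace_specht_idem : gtrace specht_idem specht_idem = 1.
Proof.
rewrite gtraceZl gtraceZr /gtrace.
rewrite (eq_bigr (fun g => young_coef * (young lam g * row_col lam g))); last first.
  move=> g _.
  have -> : young lam * gdelta g * young lam =
      colsgn lam * (rowsum lam * gdelta g * colsgn lam * rowsum lam).
    by rewrite /young !mulrA.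
  rewrite row_col_sandwich -scalerAl -scalerAr galgZE.
  have -> : colsgn lam * (row_col lam * rowsum lam) = young lam * young lam.
    by rewrite /row_col /young !mulrA.
  by rewrite young_sq galgZE mulrC -mulrA.
by rewrite -mulr_sumr -/young_coef mulKf ?mulVf // young_coef_neq0.
Qed.

Lemma gtrace_rowsum : gtrace (rowsum lam) specht_idem = #|row_group n lam|%:R.
Proof.
rewrite gtraceZr /gtrace.
have aa : rowsum lam * rowsum lam = #|row_group n lam|%:R *: rowsum lam.
  rewrite {2}(galg_expand (rowsum lam)) mulr_sumr.
  rewrite (eq_bigr (fun g => (g \in row_group n lam)%:R *: rowsum lam)); last first.
    move=> g _; rewrite -scalerAr {1 3}/rowsum; case: (boolP (g \in _)) => h.
      by rewrite rowsum_absorb.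
    by rewrite !scale0r.
  rewrite -scaler_suml -natr_sum; congr (_%:R *: _).
  by rewrite -sum1_card [RHS]big_mkcond /=; apply: eq_bigr => g _; case: (_ \in _).
pose f : galg 'S_n := row_col lam * rowsum lam.
rewrite (eq_bigr (fun g => f g * row_col lam g)); last first.
  by move=> g _; rewrite /young mulrA row_col_sandwich -scalerAl galgZE mulrC.
have : (\sum_g f g * row_col lam g) *: row_col lam =
    (#|row_group n lam|%:R * young_coef) *: row_col lam.
  rewrite -row_col_sandwich_sum -scalerA -row_col_sq /f /row_col.
  by rewrite !mulrA aa -!scalerAl.
move=> /(congr1 (fun f => f 1%g)); rewrite !galgZE row_col1 !mulr1 => ->.
by rewrite mulrC mulfK // young_coef_neq0.
Qed.

End YoungSymmetrizers.

Section YoungOrthogonality.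
Variables (n : nat) (lam mu : intpart).
Hypotheses (lamn : sumn lam = n) (mun : sumn mu = n).

Lemma rowsum_colsgn0 g : ~ colsum_le lam mu ->
  rowsum mu * gdelta g * colsgn lam = 0 :> galg 'S_n.
Proof. by move=> h; apply: young_mul0 => inj; apply/h/(transversal_colsum_le mun lamn inj). Qed.

Lemma gtrace_rowsum0 : ~ colsum_le lam mu ->
  gtrace (rowsum mu : galg 'S_n) (specht_idem lam) = 0.
Proof.
move=> h; rewrite gtraceZr /gtrace big1 ?mulr0 // => z _.
by rewrite /young mulrA rowsum_colsgn0 // mul0r.
Qed.
End YoungOrthogonality.

Lemma gtrace_specht_idem0 n (lam mu : intpart) :
  sumn lam = n -> sumn mu = n -> lam != mu ->
  gtrace (specht_idem lam : galg 'S_n) (specht_idem mu) = 0.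
Proof.
wlog h : lam mu / ~ colsum_le mu lam.
  move=> W lamn mun ne; have [le|nle] := pselect (colsum_le mu lam); last exact: W.
  rewrite gtraceC; apply: W; rewrite 1?eq_sym // => le'; case/eqP: ne.
  by apply: colsum_inj => c; apply/eqP; rewrite eqn_leq le le'.
move=> lamn mun _; rewrite gtraceZl gtraceZr /gtrace big1 ?mulr0 // => z _.
rewrite /young !mulrA -(mulrA (colsgn lam)) -(mulrA (colsgn lam)).
by rewrite rowsum_colsgn0 // mulr0 mul0r.
Qed.

(** * Cycle types *)

Section CycleType.
Variable n : nat.
Implicit Types (w g : 'S_n) (O : {set 'I_n}).

Lemma mem_uniq_full (s : seq 'I_n) k : uniq s -> size s = n -> k \in s.
Proof.
move=> us ss; have := @uniq_min_size _ s (enum 'I_n) us (fun x _ => mem_enum 'I_n x).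
by rewrite size_enum_ord ss => /(_ (leqnn n)) [_ ->]; rewrite mem_enum.
Qed.

Lemma map_perm_exists (s s' : seq 'I_n) : uniq s -> uniq s' ->
  size s = n -> size s' = n -> exists g : 'S_n, map g s = s'.
Proof.
move=> us us' ss ss'.
have ms k := @mem_uniq_full s k us ss.
pose f k := nth k s' (index k s).
have fE k l : f l = nth k s' (index l s).
  by apply: set_nth_default; rewrite ss' -[X in (_ < X)%N]ss index_mem.
have fi : injective f.
  move=> k l; rewrite !(fE k) => /eqP.
  rewrite nth_uniq ?ss' -?[X in (_ < X)%N]ss ?index_mem // => /eqP.
  by move=> e; rewrite -(nth_index k (ms k)) e nth_index.
exists (perm fi); case: s us ss ms @f fE fi => [|x s] us ss ms f fE fi.
  by apply/esym/nilP; rewrite /nilp ss' -[X in X == _]ss.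
apply: (@eq_from_nth _ x) => [|i]; first by rewrite size_map ss ss'.
rewrite size_map => il; rewrite (nth_map x) // permE (fE x) index_uniq //.
Qed.

Definition orbit_sizes w := map (fun O : {set 'I_n} => #|O|) (enum (porbits w)).

Definition cyc w : intpart := to_intpart (sort geq (orbit_sizes w)).

Lemma geq_total : total geq.
Proof. by move=> a b /=; exact: leq_total. Qed.

Lemma porbits_gt0 w O : O \in porbits w -> (0 < #|O|)%N.
Proof. by case/imsetP => x _ ->; rewrite lt0n card_porbit_neq0. Qed.

Lemma parts_cyc w : parts (cyc w) = sort geq (orbit_sizes w).
Proof.
rewrite /cyc to_intpartE; last exact/sort_sorted/geq_total.
apply/all_filterP; rewrite all_sort; apply/allP => k /mapP[O].
by rewrite mem_enum => /porbits_gt0 h ->.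
Qed.

Lemma prod_cyc (R : comPzRingType) w (F : nat -> R) :
  \prod_(k <- parts (cyc w)) F k = \prod_(O in porbits w) F #|O|.
Proof.
rewrite parts_cyc (perm_big (orbit_sizes w)) ?perm_sort //=.
by rewrite big_map big_enum.
Qed.

Lemma sumn_cyc w : sumn (cyc w) = n.
Proof.
rewrite parts_cyc (perm_sumn (s2 := (orbit_sizes w))) ?perm_sort //.
rewrite sumnE big_map big_enum /=.
have tr : finset.partition (porbits w) [set: 'I_n].
  apply/and3P; split.
  - rewrite finset.eqEsubset finset.subsetT /=; apply/fintype.subsetP => x _.
    by apply/bigcupP; exists (porbit w x); rewrite ?imset_f ?porbit_id.
  - apply/finset.trivIsetP => _ _ /imsetP[x _ ->] /imsetP[y _ ->] ne.
    rewrite -setI_eq0; apply/set0Pn => -[z /setIP[zx zy]]; case/eqP: ne.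
    move: zx zy; rewrite -!eq_porbit_mem => /eqP <- /eqP <- //.
  - by apply/negP => /porbits_gt0; rewrite cards0.
by rewrite -(card_partition tr) cardsT card_ord.
Qed.

Lemma porbit_eq w O x : O \in porbits w -> x \in O -> O = porbit w x.
Proof.
by case/imsetP => y _ -> ; rewrite -eq_porbit_mem => /eqP ->.
Qed.

Definition orbit_seq w O : seq 'I_n :=
  if [pick x in O] is Some x then traject w x #|O| else [::].

Lemma orbit_seqP w O : O \in porbits w ->
  exists2 x, x \in O & orbit_seq w O = traject w x #|O|.
Proof.
move=> Ow; rewrite /orbit_seq; case: pickP => [x xO|h]; first by exists x.
by have := porbits_gt0 Ow; rewrite -sum1_card big_pred0.
Qed.

Lemma size_orbit_seq w O : O \in porbits w -> size (orbit_seq w O) = #|O|.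
Proof. by move=> /orbit_seqP[x _ ->]; rewrite size_traject. Qed.

Lemma map_orbit_seq w O : O \in porbits w ->
  map w (orbit_seq w O) = rot 1 (orbit_seq w O).
Proof.
move=> Ow; have [x xO ->] := orbit_seqP Ow.
have : (0 < #|O|)%N := porbits_gt0 Ow.
have -> : #|O| = #|porbit w x| by rewrite -(porbit_eq Ow xO).
have := iter_porbit w x; case: #|porbit w x| => // m it _.
rewrite {2}trajectS rot1_cons; transitivity (traject w (w x) m.+1).
  by elim: (m.+1) (x) => //= k IH y; rewrite IH.
by rewrite trajectSr -iterSr it.
Qed.

Definition orbit_list w := 
  sort (relpre (fun O : {set 'I_n} => #|O|) geq) (enum (porbits w)).

Lemma mem_orbit_list w O : (O \in orbit_list w) = (O \in porbits w).
Proof. by rewrite mem_sort mem_enum. Qed.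

Lemma shape_orbit_list w :
  shape (map (orbit_seq w) (orbit_list w)) = parts (cyc w).
Proof.
rewrite parts_cyc /shape -map_comp sort_map.
by apply/eq_in_map => O; rewrite mem_orbit_list /= => /size_orbit_seq.
Qed.

Lemma cyc_conj w w' : cyc w = cyc w' -> exists g, w' = (w ^ g)%g.
Proof.
move=> e; pose b u := map (orbit_seq u) (orbit_list u).
have sz u : size (flatten (b u)) = n.
  by rewrite size_flatten shape_orbit_list sumn_cyc.
have mem u x : x \in flatten (b u).
  apply/flattenP; exists (orbit_seq u (porbit u x)).
    by apply: map_f; rewrite mem_orbit_list imset_f.
  have Ou : porbit u x \in porbits u by rewrite imset_f.
  have [y yO ->] := orbit_seqP Ou.
  have -> : porbit u x = porbit u y by apply: porbit_eq yO.
  by rewrite -porbit_traject porbit_sym.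
have un u : uniq (flatten (b u)).
  apply: (@leq_size_uniq _ (enum 'I_n)); first exact: enum_uniq.
    by move=> x _; exact: mem.
  by rewrite sz size_enum_ord.
have [g] := map_perm_exists (un w) (un w') (sz w) (sz w').
rewrite map_flatten => /eq_from_flatten_shape gb; exists g.
have {}gb : map (map g) (b w) = b w'.
  apply: gb; rewrite [RHS]shape_orbit_list -e -shape_orbit_list.
  by rewrite /shape -map_comp; apply: eq_map => s; rewrite /= size_map.
apply/permP => x; rewrite conjgE !permM.
suff h k : w' (g k) = g (w k) by rewrite -h permKV.
have /flattenP[s sb ks] := mem w k.
have sb' : map g s \in b w' by rewrite -gb map_f.
have r u t : t \in b u -> map u t = rot 1 t.
  by case/mapP => O; rewrite mem_orbit_list => Ou ->; apply: map_orbit_seq.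
have := r _ _ sb'; rewrite -map_rot -(r _ _ sb) -!map_comp => /eq_in_map.
by apply.
Qed.

Lemma cycJ w g : cyc (w ^ g)%g = cyc w.
Proof.
have pJ u x h : porbit (u ^ h)%g (h x) = h @: porbit u x.
  apply/setP => y; apply/porbitP/imsetP => [[i ->]|[z /porbitP[i ->] ->]].
    exists ((u ^+ i)%g x); first exact: mem_porbit.
    by rewrite -conjXg conjgE !permM permK.
  by exists i; rewrite -conjXg conjgE !permM permK.
have psJ : porbits (w ^ g)%g = [set g @: (O : {set 'I_n}) | O in porbits w].
  apply/setP => O; apply/imsetP/imsetP => [[x _ ->]|[_ /imsetP[x _ ->] ->]].
    exists (porbit w (g^-1%g x)); first exact: imset_f.
    by rewrite -pJ permKV.
  by exists (g x) => //; rewrite pJ.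
apply/val_inj; rewrite /= !parts_cyc; apply/perm_sortP.
- exact: geq_total.
- exact: geq_trans.
- by move=> a b /andP[/= ab ba]; apply/eqP; rewrite eqn_leq ab ba.
have -> : (orbit_sizes w) =
    map (fun O : {set 'I_n} => #|O|) (map (fun O : {set 'I_n} => g @: O) (enum (porbits w))).
  by rewrite -map_comp; apply: eq_map => O; rewrite /= card_imset //; exact: perm_inj.
apply: perm_map; apply: uniq_perm; first exact: enum_uniq.
  by rewrite map_inj_uniq ?enum_uniq //; apply: imset_inj; apply: perm_inj.
move=> O; rewrite mem_enum psJ; apply/imsetP/mapP => -[P h ->]; exists P => //.
  by rewrite mem_enum.
by rewrite mem_enum in h.
Qed.

Lemma cycV w : cyc w^-1%g = cyc w.
Proof. by rewrite /cyc /orbit_sizes porbitsV. Qed.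

End CycleType.

Section TraceLemma.
Variables (R : comPzRingType) (A : finType) (M : A -> A -> R).

Fixpoint walk k a b : R :=
  if k is k'.+1 then \sum_c M a c * walk k' c b else (a == b)%:R.

Lemma walkSr k a c : walk k.+1 a c = \sum_b walk k a b * M b c.
Proof.
elim: k a c => [|k IH] a c /=.
  rewrite (bigD1 c) //= eqxx mulr1 big1 ?addr0; last first.
    by move=> b /negPf ->; rewrite mulr0.
  rewrite (bigD1 a) //= eqxx mul1r big1 ?addr0 // => b.
  by rewrite eq_sym => /negPf ->; rewrite mul0r.
rewrite (eq_bigr (fun d => \sum_b M a d * (walk k d b * M b c))); last first.
  by move=> d _; rewrite -mulr_sumr -IH.
rewrite exchange_big; apply: eq_bigr => b _; rewrite mulr_suml.
by apply: eq_bigr => d _; rewrite mulrA.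
Qed.

Fixpoint path_weight (K : A -> R) a (t : seq A) : R :=
  if t is b :: t' then M a b * path_weight K b t' else K a.

Lemma sum_path_weight K k a :
  \sum_(t : k.-tuple A) path_weight K a t = \sum_b walk k a b * K b.
Proof.
elim: k a => [|k IH] a /=.
  rewrite (big_pred1 [tuple]); last by move=> t; rewrite [t]tuple0; apply/esym/eqP.
  rewrite (bigD1 a) //= eqxx mul1r big1 ?addr0 // => b.
  by rewrite eq_sym => /negPf ->; rewrite mul0r.
transitivity (\sum_(u : A * k.-tuple A) path_weight K a (u.1 :: u.2)).
  rewrite (reindex (fun u : A * k.-tuple A => [tuple of u.1 :: u.2])) //=.
  exists (fun t : k.+1.-tuple A => (thead t, [tuple of behead t])) => [[b t]|t] _ /=.
    by congr (_, _); apply/val_inj.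
  by rewrite -tuple_eta.
rewrite -(pair_bigA _ (fun b (t : k.-tuple A) => path_weight K a (b :: t))) /=.
rewrite (eq_bigr (fun c => \sum_b M a c * (walk k c b * K b))); last first.
  move=> c _; transitivity (M a c * \sum_(t : k.-tuple A) path_weight K c t).
    by rewrite mulr_sumr.
  by rewrite IH mulr_sumr.
rewrite exchange_big; apply: eq_bigr => b _; rewrite mulr_suml.
by apply: eq_bigr => d _; rewrite mulrA.
Qed.

Variable n : nat.
Implicit Types (w : 'S_n) (O : {set 'I_n}).

Lemma prod_traject w (h : 'I_n -> A) x z m : iter m.+1 w x = z ->
  \prod_(i <- traject w x m.+1) M (h i) (h (w i)) =
  path_weight (fun b => M b (h z)) (h x) (map h (traject w (w x) m)).
Proof.
elim: m x => [|m IH] x itx; first by rewrite big_seq1 -itx.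
by rewrite trajectS big_cons IH // -iterSr.
Qed.

Lemma sum_on_orbit (a0 : A) w O : O \in porbits w ->
  \sum_(h in pffun_on a0 (mem O) predT) \prod_(i in O) M (h i) (h (w i)) =
  \sum_a walk #|O| a a.
Proof.
move=> Ow; have [x xO _] := orbit_seqP Ow.
have OE := porbit_eq Ow xO.
have : (0 < #|O|)%N by apply: porbits_gt0 Ow.
have Otraj : O =i traject w x #|O| by move=> y; rewrite OE porbit_traject.
have utraj : uniq (traject w x #|O|) by rewrite OE uniq_traject_porbit.
have itx : iter #|O| w x = x by rewrite OE iter_porbit.
move: #|O| Otraj utraj itx => [//|m] Otraj utraj itx _.
set tr := traject w x m.+1 in Otraj utraj.
pose tt : m.-tuple 'I_n := Tuple (introT eqP (size_traject w (w x) m)).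
pose psi (h : {ffun 'I_n -> A}) : A * m.-tuple A := (h x, map_tuple h tt).
pose phi (u : A * m.-tuple A) : {ffun 'I_n -> A} :=
  [ffun i => if i \in O then nth a0 (u.1 :: u.2) (index i tr) else a0].
have psiE (u : A * m.-tuple A) : map (phi u) tr = u.1 :: u.2.
  apply: (@eq_from_nth _ a0) => [|j]; first by rewrite size_map size_traject /= size_tuple.
  rewrite size_map => jl; rewrite (nth_map x) // ffunE Otraj mem_nth //.
  by rewrite index_uniq.
rewrite (reindex_onto phi psi); last first.
  move=> h /pffun_onP[hO _]; apply/ffunP => i; rewrite ffunE.
  case: (boolP (i \in O)) => iO.
    by rewrite -[_ :: _]/(map h tr) (nth_map x) ?index_mem -?Otraj // nth_index -?Otraj.
  apply/esym/eqP/negP => /negP hi; case/negP: iO; apply: (fintype.subsetP hO).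
  by rewrite inE.
rewrite (eq_bigl xpredT); last first.
  move=> u; apply/andP; split.
    apply/pffun_onP; split=> //; apply/fintype.subsetP => i; rewrite inE ffunE.
    by case: (i \in O) => //; rewrite eqxx.
  apply/eqP; case: u => a t; have := psiE (a, t).
  by rewrite /psi /= => -[-> e]; congr (_, _); apply/val_inj.
transitivity (\sum_(u : A * m.-tuple A) path_weight (fun b => M b u.1) u.1 u.2).
  apply: eq_bigr => u _; rewrite (eq_bigl (mem tr)); last exact: Otraj.
  rewrite -(big_uniq _ utraj) /= (prod_traject _ itx).
  by have := psiE u; rewrite /= => -[-> ->].
rewrite -(pair_bigA _ (fun a (t : m.-tuple A) => path_weight (fun b => M b a) a t)) /=.
by apply: eq_bigr => a _; rewrite sum_path_weight -walkSr.
Qed.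

Lemma sum_prod_cyc w :
  \sum_(f : {ffun 'I_n -> A}) \prod_i M (f i) (f (w i)) =
  \prod_(k <- parts (cyc w)) \sum_a walk k a a.
Proof.
have cover (F : 'I_n -> R) : \prod_i F i = \prod_(O in porbits w) \prod_(i in O) F i.
  rewrite (partition_big (porbit w) (mem (porbits w))) /=; last first.
    by move=> i _; exact: imset_f.
  apply: eq_bigr => O Ow; apply: eq_bigl => i.
  apply/eqP/idP => [<-|iO]; first exact: porbit_id.
  by rewrite -(porbit_eq Ow iO).
rewrite prod_cyc; have [a0 _|A0] := pickP A; last first.
  have [n0|n0] := posnP n.
    transitivity (\sum_(f : {ffun 'I_n -> A}) (1 : R)).
      apply: eq_bigr => f _; rewrite big1 // => i _.
      by have := ltn_ord i; rewrite [X in (_ < X)%N]n0.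
    rewrite sumr_const card_ffun card_ord [X in (_ ^ X)%N]n0 expn0.
    rewrite big1 // => O Ow; have := porbits_gt0 Ow.
    by have := max_card (mem O); rewrite card_ord [X in (_ <= X)%N]n0 leqn0 => /eqP ->.
  rewrite big1 => [|f _]; last by have := A0 (f (Ordinal n0)).
  by rewrite (bigD1 (porbit w (Ordinal n0))) ?imset_f //= big_pred0 // mul0r.
rewrite (eq_bigr _ (fun O Ow => esym (sum_on_orbit a0 Ow))).
rewrite (big_distr_big_dep [ffun=> a0]) /=.
pose phi (f : {ffun 'I_n -> A}) : {ffun {set 'I_n} -> {ffun 'I_n -> A}} :=
  [ffun O : {set 'I_n} => [ffun i => if (i \in O) && (O \in porbits w) then f i else a0]].
pose psi (G : {ffun {set 'I_n} -> {ffun 'I_n -> A}}) : {ffun 'I_n -> A} :=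
  [ffun i => G (porbit w i) i].
rewrite [RHS](reindex_onto phi psi); last first.
  move=> G /pfamilyP[GP Gon]; apply/ffunP => O; rewrite ffunE; apply/ffunP => i.
  rewrite ffunE; case: (boolP (O \in porbits w)) => Ow; last first.
    rewrite andbF; have [->|] := eqVneq (G O) [ffun=> a0]; first by rewrite ffunE.
    by move=> GO; case/negP: Ow; apply: (fintype.subsetP GP).
  rewrite andbT ffunE; case: (boolP (i \in O)) => iO; first by rewrite -(porbit_eq Ow iO).
  have /pffun_onP[hO _] := Gon O Ow.
  apply/esym/eqP/negP => /negP hi; case/negP: iO; apply: (fintype.subsetP hO).
  by rewrite inE.
apply: eq_big => [f|f _].
  apply/esym/andP; split; last first.
    by apply/eqP/ffunP => i; rewrite !ffunE porbit_id imset_f.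
  apply/pfamilyP; split=> [|O Ow].
    apply/fintype.subsetP => O; rewrite inE; apply: contraR => Ow.
    by apply/eqP/ffunP => i; rewrite !ffunE (negPf Ow) andbF.
  apply/pffun_onP; split=> //; apply/fintype.subsetP => i; rewrite inE !ffunE Ow andbT.
  by case: (i \in O) => //; rewrite eqxx.
rewrite cover; apply: eq_bigr => O Ow; apply: eq_bigr => i iO.
have wiO : w i \in O by rewrite (porbit_eq Ow iO) -{1}(expg1 w) mem_porbit.
by rewrite !ffunE iO wiO Ow.
Qed.
End TraceLemma.

(** * Characters of symmetric groups *)

Lemma seq_matrix_inv (T : eqType) (K : fieldType) (s : seq T) (F G : T -> T -> K) :
  uniq s ->
  {in s &, forall a b, \sum_(c <- s) F a c * G c b = (a == b)%:R} ->
  {in s &, forall a b, \sum_(c <- s) G a c * F c b = (a == b)%:R}.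
Proof.
move=> us FG; case: s us FG => [|x0 s0]; first by move=> _ _ a b.
set s := x0 :: s0 => us FG.
pose mx (H : T -> T -> K) : 'M[K]_(size s) :=
  \matrix_(i, j) H (nth x0 s i) (nth x0 s j).
have e : mx F *m mx G = 1%:M.
  apply/matrixP => i j; rewrite !mxE.
  have := FG _ _ (mem_nth x0 (ltn_ord i)) (mem_nth x0 (ltn_ord j)).
  rewrite nth_uniq // (big_nth x0) big_mkord => <-.
  by apply: eq_bigr => k _; rewrite !mxE.
move=> a b ia ib; have ja := ia; have jb := ib; rewrite -index_mem in ja; rewrite -index_mem in jb.
have /matrixP/(_ (Ordinal ja) (Ordinal jb)) := mulmx1C e; rewrite !mxE.
rewrite -val_eqE /= (inj_in_eq (@index_inj _ x0 s)) // => <-.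
rewrite (big_nth x0) big_mkord; apply: eq_bigr => k _.
by rewrite !mxE /= !nth_index.
Qed.

Section Characters.
Variable n : nat.
Implicit Types (g h : 'S_n) (lam rho : intpart).

Definition chi lam g : rat := \sum_(z : 'S_n) specht_idem lam (z^-1 * g^-1 * z)%g.

Lemma gtrace_chi (f : galg 'S_n) lam :
  gtrace f (specht_idem lam) = \sum_g f g * chi lam g.
Proof.
rewrite gtraceE exchange_big; apply: eq_bigr => g _.
by rewrite mulr_sumr.
Qed.

Lemma chiJ lam g h : chi lam (g ^ h)%g = chi lam g.
Proof.
rewrite /chi [RHS](reindex_inj (mulgI h)) /=; apply: eq_bigr => z _.
by rewrite conjgE !invMg !invgK !mulgA.
Qed.

Lemma chi_cyc lam g h : cyc g = cyc h -> chi lam g = chi lam h.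
Proof. by move=> /cyc_conj[k ->]; rewrite chiJ. Qed.

Lemma chiV lam g : chi lam g^-1%g = chi lam g.
Proof. by apply: chi_cyc; rewrite cycV. Qed.

Lemma chi_orth lam mu : lam \in ptn n -> mu \in ptn n ->
  \sum_g specht_idem lam g * chi mu g = (lam == mu)%:R.
Proof.
rewrite !mem_ptn => /eqP ln /eqP mn; rewrite -gtrace_chi.
have [<-|ne] := eqVneq lam mu; first exact: gtrace_specht_idem.
exact: gtrace_specht_idem0.
Qed.

Definition chi_at lam rho : rat :=
  if [pick g : 'S_n | cyc g == rho] is Some g then chi lam g else 0.

Lemma chi_atE lam g : chi_at lam (cyc g) = chi lam g.
Proof.
rewrite /chi_at; case: pickP => [h /eqP|/(_ g)]; last by rewrite eqxx.
exact: chi_cyc.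
Qed.

Definition idem_at lam rho : rat := \sum_(g : 'S_n | cyc g == rho) specht_idem lam g.

Lemma cyc_ptn g : cyc g \in ptn n.
Proof. by rewrite mem_ptn sumn_cyc. Qed.

Lemma sum_cyc (V : nmodType) (F : 'S_n -> V) :
  \sum_g F g = \sum_(rho <- ptn n) \sum_(g | cyc g == rho) F g.
Proof.
under [RHS]eq_bigr do rewrite big_mkcond.
rewrite exchange_big; apply: eq_bigr => g _ /=.
rewrite -big_mkcond (eq_bigl (fun rho => rho == cyc g)) => [|rho]; last exact: eq_sym.
by rewrite sum_delta ?ptn_uniq // cyc_ptn.
Qed.

Lemma chi_at_orth : {in ptn n &, forall lam mu,
  \sum_(rho <- ptn n) chi_at lam rho * idem_at mu rho = (lam == mu)%:R}.
Proof.
move=> lam mu ln mn; rewrite eq_sym -(chi_orth mn ln) sum_cyc.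
apply: eq_bigr => rho _; rewrite mulr_sumr; apply: eq_bigr => g /eqP <-.
by rewrite chi_atE mulrC.
Qed.

Lemma idem_at_orth : {in ptn n &, forall rho sig,
  \sum_(lam <- ptn n) idem_at lam rho * chi_at lam sig = (rho == sig)%:R}.
Proof.
exact: (@seq_matrix_inv _ _ _ chi_at (fun rho lam => idem_at lam rho)
  (ptn_uniq n) chi_at_orth).
Qed.

Lemma class_fun_expand (K : numFieldType) (f : 'S_n -> K) g :
  (forall g h, cyc g = cyc h -> f g = f h) ->
  f g = \sum_(lam <- ptn n) (\sum_h ratr (specht_idem lam h) * f h) * ratr (chi lam g).
Proof.
move=> fc.
pose f' rho := if [pick h : 'S_n | cyc h == rho] is Some h then f h else 0.
have f'E h : f' (cyc h) = f h.
  rewrite /f'; case: pickP => [k /eqP|/(_ h)]; last by rewrite eqxx.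
  exact: fc.
transitivity (\sum_(lam <- ptn n) \sum_(rho <- ptn n)
   f' rho * ratr (idem_at lam rho * chi_at lam (cyc g))).
  rewrite exchange_big /= (eq_big_seq (fun rho => f' rho * (rho == cyc g)%:R)); last first.
    move=> rho rn; rewrite -mulr_sumr -rmorph_sum /= idem_at_orth ?cyc_ptn //.
    by rewrite ratr_nat.
  rewrite (bigD1_seq (cyc g)) ?cyc_ptn ?ptn_uniq //= eqxx mulr1 f'E big1 ?addr0 //.
  by move=> rho /negPf ->; rewrite mulr0.
apply: eq_bigr => lam _; rewrite sum_cyc mulr_suml; apply: eq_bigr => rho _.
rewrite chi_atE rmorphM /= mulrA; congr (_ * _).
rewrite rmorph_sum mulr_sumr; apply: eq_bigr => h /eqP <-.
by rewrite f'E mulrC.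
Qed.

Definition cyc_count rho := #|[set g : 'S_n | cyc g == rho]|.

Lemma idem_at_chi lam rho :
  (n`!)%:R * idem_at lam rho = (cyc_count rho)%:R * chi_at lam rho.
Proof.
transitivity (\sum_(g : 'S_n | cyc g == rho) chi lam g).
  rewrite exchange_big /= (eq_bigr (fun=> idem_at lam rho)).
    by rewrite sumr_const card_Sn mulr_natl.
  move=> z _; rewrite (reindex_inj invg_inj) /= (reindex_inj (conjg_inj z^-1%g)) /=.
  apply: eq_big => g; first by rewrite cycV cycJ.
  by move=> _; rewrite invgK conjgE invgK !mulgA mulVg mul1g mulgKV.
rewrite (eq_bigr (fun=> chi_at lam rho)); last by move=> g /eqP <-; rewrite chi_atE.
by rewrite sumr_const mulr_natl /cyc_count cardsE.
Qed.

Lemma cyc_count_gt0 rho : rho \in ptn n -> (0 < cyc_count rho)%N.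
Proof.
move=> rn; rewrite lt0n; apply: contraTneq isT => c0.
have := idem_at_orth rn rn; rewrite eqxx big1 => [/eqP|lam _]; first by rewrite eq_sym oner_eq0.
have := idem_at_chi lam rho; rewrite c0 mul0r => /eqP.
rewrite mulf_eq0 pnatr_eq0 -[(_ == _)%N]negbK -lt0n fact_gt0 /= => /eqP ->.
exact: mul0r.
Qed.

Lemma cyc_surj rho : rho \in ptn n -> exists g : 'S_n, cyc g = rho.
Proof.
move=> /cyc_count_gt0; rewrite /cyc_count card_gt0 => /set0Pn[g].
by rewrite inE => /eqP; exists g.
Qed.

End Characters.

(** * Horizontal strips and Kostka numbers *)

Section Kostka.
Implicit Types (lam mu nu th rho si ka : intpart) (al be : seq nat).

Definition hstrip (s t : seq nat) : bool :=
  all (fun i => (nth 0 t i <= nth 0 s i) && (nth 0 s i.+1 <= nth 0 t i))%N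
    (iota 0 (size s + size t)).

Lemma hstripP (s t : seq nat) :
  reflect (forall i, (nth 0 t i <= nth 0 s i) /\ (nth 0 s i.+1 <= nth 0 t i))%N
    (hstrip s t).
Proof.
apply: (iffP allP) => [h i|h i _]; last by apply/andP/h.
have [il|il] := ltnP i (size s + size t).
  by apply/andP/h; rewrite mem_iota.
have si : (size s <= i)%N by apply: leq_trans il; exact: leq_addr.
have ti : (size t <= i)%N by apply: leq_trans il; exact: leq_addl.
by rewrite !(nth_default _ si) (nth_default _ ti) (nth_default _ (leqW si)).
Qed.

Lemma sumn_nth_big s K (f : nat -> nat) : (forall i, nth 0 s i = f i) ->
  (size s <= K)%N -> sumn s = (\sum_(i < K) f i)%N.
Proof. by move=> e sK; rewrite (sumn_nth sK); apply: eq_bigr. Qed.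

Lemma leq_sumn_nth s t : (forall i, nth 0 s i <= nth 0 t i)%N ->
  (sumn s <= sumn t)%N.
Proof.
move=> h; rewrite (@sumn_nth s (maxn (size s) (size t))) ?leq_maxl //.
rewrite (@sumn_nth t (maxn (size s) (size t))) ?leq_maxr //.
by apply: leq_sum => i _; apply: h.
Qed.

Lemma hstrip_sumn s t : hstrip s t -> (sumn t <= sumn s)%N.
Proof. by move=> /hstripP h; apply: leq_sumn_nth => i; case: (h i). Qed.

Definition ptnle n : seq intpart :=
  enum_fset (fset_set [set lam : intpart | (sumn lam <= n)%N]%classic).

Lemma ptnle_uniq n : uniq (ptnle n).
Proof. exact: fset_uniq. Qed.

Lemma mem_ptnle n lam : (lam \in ptnle n) = (sumn lam <= n)%N.
Proof.
have := in_fset_set (finite_intpart n) lam => h; apply: etrans h _.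
by apply/idP/idP => [/set_mem|?]; [|apply/mem_set].
Qed.

Lemma sum_ptnle (V : nmodType) n m (F : intpart -> V) : (m <= n)%N ->
  \sum_(lam <- ptnle n | sumn lam == m) F lam = \sum_(lam <- ptn m) F lam.
Proof.
move=> mn; rewrite -big_filter; apply: perm_big; apply: uniq_perm.
- exact/filter_uniq/ptnle_uniq.
- exact: ptn_uniq.
- move=> lam; rewrite mem_filter mem_ptnle mem_ptn.
  by case: eqP => // ->.
Qed.

Fixpoint kostka lam al : nat :=
  if al is a :: al' then
    \sum_(mu <- ptn (sumn al') | hstrip lam mu && (sumn lam == a + sumn al'))
       kostka mu al'
  else (lam == empty_part).

Lemma sumn_eq0 lam : sumn lam = 0%N -> lam = empty_part.
Proof.
move=> l0; apply: intpart_eq => i; rewrite nth_nil; apply/eqP; rewrite -leqn0.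
by rewrite -[X in (_ <= X)%N]l0; exact: nth_le_sumn.
Qed.

Lemma kostka_sumn lam al : kostka lam al != 0%N -> sumn lam = sumn al.
Proof.
case: al => [|a al] /=; first by case: (lam =P empty_part) => // ->.
case: (sumn lam =P (a + sumn al)%N) => // _; rewrite big1 ?eqxx // => mu.
by rewrite andbF.
Qed.

Lemma kostka_cons n lam a al : (sumn lam <= n)%N -> kostka lam (a :: al) =
  (\sum_(mu <- ptnle n | hstrip lam mu && (sumn lam == a + sumn mu))
     kostka mu al)%N.
Proof.
move=> ln /=.
have [e|ne] := eqVneq (sumn lam) (a + sumn al)%N; last first.
  rewrite big1; last by move=> mu; rewrite andbF.
  rewrite big1 // => mu /andP[_ /eqP e]; apply/eqP; apply: contraNT ne.
  by move=> /kostka_sumn <-; rewrite -e.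
have aln : (sumn al <= n)%N by rewrite (leq_trans _ ln) // e leq_addl.
under eq_bigl do rewrite andbT.
rewrite big_mkcond -(sum_ptnle _ aln) -big_mkcondr /=.
rewrite big_mkcond [RHS]big_mkcond; apply: eq_bigr => mu _.
rewrite e eqn_add2l [in RHS]eq_sym andbC.
by case: (hstrip lam mu).
Qed.

Fixpoint sum_le al (F : seq nat -> nat) : nat :=
  if al is a :: al' then \sum_(b < a.+1) sum_le al' (fun be => F ((b : nat) :: be))
  else F [::].

Lemma sum_le_cons a al F : sum_le (a :: al) F =
  (\sum_(b < a.+1) sum_le al (fun be => F ((b : nat) :: be)))%N.
Proof. by []. Qed.

Lemma eq_sum_le al F G : (forall be, F be = G be) -> sum_le al F = sum_le al G.
Proof.
elim: al F G => [|a al IH] F G e /=; first exact: e.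
by apply: eq_bigr => b _; apply: IH => be; apply: e.
Qed.

Lemma sum_le_sum (I : Type) (r : seq I) (P : pred I) al (F : I -> seq nat -> nat) :
  sum_le al (fun be => \sum_(i <- r | P i) F i be)%N =
  (\sum_(i <- r | P i) sum_le al (F i))%N.
Proof.
elim: al F => [|a al IH] F //=.
by rewrite exchange_big /=; apply: eq_bigr => b _; rewrite IH.
Qed.

Lemma size_le_inj (T : eqType) (s1 s2 : seq T) (f : T -> T) : uniq s1 ->
  {in s1, forall x, f x \in s2} -> {in s1 &, injective f} ->
  (size s1 <= size s2)%N.
Proof.
move=> u1 f12 fi; rewrite -(size_map f); apply: uniq_leq_size.
  by rewrite map_inj_in_uniq.
by move=> _ /mapP[x xs ->]; apply: f12.
Qed.

Section Commutation.
Variables th rho : intpart.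
Let lo i := minn (nth 0%N th i) (nth 0%N rho i).
Let hi i := maxn (nth 0%N th i) (nth 0%N rho i).
Let K := (sumn th + sumn rho)%N.

Lemma nth_sumn_default (s : intpart) i : (sumn s <= i)%N -> nth 0%N s i = 0%N.
Proof. by move=> si; rewrite nth_default // (leq_trans (size_intpart_le _)). Qed.

Lemma lo_le_hi i : (lo i <= hi i)%N.
Proof. by rewrite /lo /hi; lia. Qed.

Lemma lo_large i : (K <= i)%N -> lo i = 0%N.
Proof.
move=> Ki; rewrite /lo nth_sumn_default ?min0n //.
exact: leq_trans (leq_addr _ _) Ki.
Qed.

Lemma hi_large i : (K <= i)%N -> hi i = 0%N.
Proof.
move=> Ki; rewrite /hi !nth_sumn_default ?maxn0 //.
  exact: leq_trans (leq_addl _ _) Ki.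
exact: leq_trans (leq_addr _ _) Ki.
Qed.

Lemma sum_lo_hi : (\sum_(i < K.+1) (lo i + hi i) = sumn th + sumn rho)%N.
Proof.
rewrite (@sumn_nth th K.+1); last first.
  by rewrite (leq_trans (size_intpart_le _)) // leqW // leq_addr.
rewrite (@sumn_nth rho K.+1); last first.
  by rewrite (leq_trans (size_intpart_le _)) // leqW // leq_addl.
by rewrite -big_split; apply: eq_bigr => i _; rewrite /lo /hi addn_min_max.
Qed.

Lemma sum_lo_hiS : (hi 0 + \sum_(i < K.+1) (lo i + hi i.+1) = sumn th + sumn rho)%N.
Proof.
rewrite -sum_lo_hi !big_split /= [X in _ = (_ + X)%N]big_ord_recl /=.
rewrite [X in (_ + (_ + X))%N]big_ord_recr /= (@hi_large K.+1) ?leqnSn //.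
by rewrite addn0 addnCA.
Qed.

(* Toggling all rows at once exchanges the common lower bounds and the common
   upper bounds of th and rho; this is the local commutation behind Pieri. *)
Definition down (ka : intpart) := to_intpart (mkseq (fun i => lo i + hi i.+1 - nth 0 ka i.+1)%N K.+1).
Definition up a (si : intpart) := to_intpart (mkseq (fun i =>
  if i is i'.+1 then lo i' + hi i - nth 0 si i' else hi 0 + (a + sumn si - sumn th))%N K.+2).

Definition above ka := hstrip ka th && hstrip ka rho.
Definition ptn_below si := hstrip th si && hstrip rho si.

Lemma aboveP ka : reflect (forall i, hi i <= nth 0 ka i /\ nth 0 ka i.+1 <= lo i)%N
  (above ka).
Proof.
apply: (iffP andP) => [[/hstripP h1 /hstripP h2] i|h].
  by have := h1 i; have := h2 i; rewrite /hi /lo; lia.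
by split; apply/hstripP => i; have := h i; rewrite /hi /lo; lia.
Qed.

Lemma ptn_belowP si : reflect (forall i, hi i.+1 <= nth 0 si i /\ nth 0 si i <= lo i)%N
  (ptn_below si).
Proof.
apply: (iffP andP) => [[/hstripP h1 /hstripP h2] i|h].
  by have := h1 i; have := h2 i; rewrite /hi /lo; lia.
by split; apply/hstripP => i; have := h i; rewrite /hi /lo; lia.
Qed.

Lemma nth_down ka i : above ka ->
  nth 0%N (down ka) i = (lo i + hi i.+1 - nth 0 ka i.+1)%N.
Proof.
move=> /aboveP h; rewrite /down (nth_mkpart (f := fun i => lo i + hi i.+1 - nth 0 ka i.+1)%N) //.
  by move=> j; have := h j; have := h j.+1; have := h j.+2; have := lo_le_hi j.+1; lia.
by rewrite (@lo_large K.+1) ?(@hi_large K.+2) ?leqnSn // leqW // leqnSn.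
Qed.

Lemma below_down ka : above ka -> ptn_below (down ka).
Proof.
move=> ab; apply/ptn_belowP => i; rewrite nth_down //.
by move/aboveP: ab => h; have := h i; have := h i.+1; lia.
Qed.

Lemma sumn_down ka : above ka ->
  (sumn (down ka) + sumn ka = sumn th + sumn rho + (nth 0 ka 0 - hi 0))%N.
Proof.
move=> ab; have /aboveP h := ab.
have e1 : sumn (down ka) = (\sum_(i < K.+1) (lo i + hi i.+1 - nth 0 ka i.+1))%N.
  apply: (@sumn_nth_big _ K.+1 (fun i => lo i + hi i.+1 - nth 0 ka i.+1)%N) => [i|].
    exact: nth_down.
  rewrite leqNgt -nth_intpart_gt0 nth_down // -leqNgt leqn0.
  by rewrite lo_large ?hi_large //; lia.
have e2 : sumn ka = (nth 0 ka 0 + \sum_(i < K.+1) nth 0 ka i.+1)%N.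
  rewrite (@sumn_nth ka K.+2) ?big_ord_recl //.
  rewrite leqNgt -nth_intpart_gt0 -leqNgt; have [_ ] := h K.+1.
  by rewrite lo_large.
rewrite e1 {1}e2 -sum_lo_hiS addnCA -big_split /=.
rewrite (eq_bigr (fun i : 'I_K.+1 => lo i + hi i.+1)%N); last first.
  by move=> i _; have := h i; have := h i.+1; lia.
by have [h0 _] := h 0%N; lia.
Qed.

Lemma nth_up a si i : ptn_below si ->
  nth 0%N (up a si) i =
   (if i is i'.+1 then lo i' + hi i - nth 0 si i'
    else hi 0 + (a + sumn si - sumn th))%N.
Proof.
move=> /ptn_belowP h; rewrite /up (nth_mkpart (f := fun i => 
   if i is i'.+1 then lo i' + hi i - nth 0 si i'
    else hi 0 + (a + sumn si - sumn th))%N) //.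
  case=> [|j]; first by have := h 0%N; rewrite /lo /hi; lia.
  by have := h j; have := h j.+1; rewrite /lo /hi; lia.
by rewrite lo_large ?hi_large //; lia.
Qed.

Lemma above_up a si : ptn_below si -> above (up a si).
Proof.
move=> be; apply/aboveP => i; rewrite !nth_up //.
move/ptn_belowP: be => h; case: i => [|i]; first by have := h 0%N; lia.
by have := h i; have := h i.+1; lia.
Qed.

Lemma sumn_up a si : ptn_below si -> (sumn th <= a + sumn si)%N ->
  sumn (up a si) = (a + sumn rho)%N.
Proof.
move=> be le; have := sumn_down (above_up a be).
have -> : down (up a si) = si.
  apply: intpart_eq => i; rewrite nth_down ?above_up // nth_up //.
  by move/ptn_belowP: be => h; have := h i; lia.
rewrite nth_up //; lia.
Qed.

Lemma count_above_below a n : (sumn th <= n)%N ->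
  size [seq ka <- ptn (a + sumn rho)%N | above ka] =
  size [seq si <- ptnle n | ptn_below si && (sumn th <= a + sumn si)%N].
Proof.
move=> thn; apply/eqP; rewrite eqn_leq; apply/andP; split.
  apply: (size_le_inj (f := down)).
  - exact/filter_uniq/ptn_uniq.
  - move=> ka; rewrite !mem_filter mem_ptn mem_ptnle => /andP[ab /eqP e].
    have := sumn_down ab; have bd := below_down ab; rewrite bd e /= => e'.
    have /andP[/hstrip_sumn le _] := bd.
    by apply/andP; split; lia.
  - move=> ka ka'; rewrite !mem_filter !mem_ptn => /andP[ab /eqP e] /andP[ab' /eqP e'] d.
    have dn i : nth 0%N ka i.+1 = nth 0%N ka' i.+1.
      have := congr1 (fun s : intpart => nth 0%N s i) d; rewrite !nth_down //.
      move/aboveP: ab => h; move/aboveP: ab' => h'.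
      by have := h i; have := h' i; have := h i.+1; have := h' i.+1; lia.
    apply: intpart_eq => -[|i] //.
    have := sumn_down ab; rewrite d; have := sumn_down ab'.
    move/aboveP: ab => h; move/aboveP: ab' => h'.
    by have := h 0%N; have := h' 0%N; lia.
apply: (size_le_inj (f := up a)).
- exact/filter_uniq/ptnle_uniq.
- move=> si; rewrite !mem_filter mem_ptn => /andP[/andP[be le] _].
  by rewrite above_up //= sumn_up.
- move=> si si'; rewrite !mem_filter => /andP[/andP[be le] _] /andP[/andP[be' le'] _] e.
  have {}e : down (up a si) = down (up a si') by rewrite e.
  apply: intpart_eq => i; move/(congr1 (fun s : intpart => nth 0%N s i)): e.
  rewrite !nth_down ?above_up // !nth_up //.
  by move/ptn_belowP: be => h; move/ptn_belowP: be' => h'; have := h i; have := h' i; lia.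
Qed.
End Commutation.

Lemma pieri_kostka th al :
  (\sum_(ka <- ptn (sumn al) | hstrip ka th) kostka ka al)%N = sum_le al (kostka th).
Proof.
elim: al th => [|a al IH] th.
  rewrite /= -(big_filter _ (fun ka : intpart => hstrip ka th)).
  have [->|ne] := eqVneq th empty_part.
    rewrite (@perm_big _ _ _ _ _ [:: empty_part]) ?big_seq1 ?eqxx //.
    apply: uniq_perm => //; first exact/filter_uniq/ptn_uniq.
    move=> ka; rewrite mem_filter mem_ptn inE; apply/andP/eqP => [[_ /eqP/sumn_eq0] //|->].
    by split=> //; apply/hstripP => i; rewrite !nth_nil.
  rewrite big_seq big1 // => ka; rewrite mem_filter mem_ptn => /andP[h /eqP /sumn_eq0 k0].
  case/eqP: ne; apply: sumn_eq0; apply/eqP; rewrite -leqn0.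
  by have := hstrip_sumn h; rewrite k0.
set n := sumn th.
transitivity (\sum_(rho <- ptn (sumn al)) kostka rho al *
   size [seq ka <- ptn (a + sumn al)%N | above th rho ka])%N.
  transitivity (\sum_(ka <- ptn (sumn (a :: al))) \sum_(rho <- ptn (sumn al))
     (if above th rho ka then kostka rho al else 0))%N.
    rewrite big_mkcond; apply: eq_big_seq => ka; rewrite mem_ptn /= => ->.
    rewrite /above; case: (hstrip ka th); last by rewrite big1.
    by rewrite big_mkcond; apply: eq_bigr => rho _; rewrite andbT.
  rewrite exchange_big /=; apply: eq_bigr => rho _.
  rewrite -sum1_size big_filter big_distrr /= big_mkcond [RHS]big_mkcond.
  by apply: eq_bigr => ka _; rewrite muln1.
transitivity (\sum_(b < a.+1) \sum_(si <- ptnle n | hstrip th si && (n == b + sumn si))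
    \sum_(rho <- ptn (sumn al) | hstrip rho si) kostka rho al)%N; last first.
  rewrite sum_le_cons; apply: eq_bigr => b _; transitivity (sum_le al (fun be =>
      \sum_(si <- ptnle n | hstrip th si && (n == b + sumn si)) kostka si be)%N).
    by rewrite sum_le_sum; apply: eq_bigr => si _; rewrite IH.
  by apply: eq_sum_le => be; rewrite (kostka_cons b be (leqnn n)).
transitivity (\sum_(rho <- ptn (sumn al)) \sum_(b < a.+1) \sum_(si <- ptnle n)
   if hstrip th si && (n == b + sumn si) && hstrip rho si then kostka rho al
   else 0)%N; last first.
  rewrite exchange_big; apply: eq_bigr => b _.
  rewrite exchange_big [RHS]big_mkcond; apply: eq_bigr => si _.
  case: (_ && _); last by rewrite big1.
  by rewrite /= -big_mkcond.
apply: eq_big_seq => rho; rewrite mem_ptn => /eqP e.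
rewrite -e (count_above_below rho a (leqnn n)) -sum1_size big_filter big_distrr /=.
rewrite [RHS]exchange_big [LHS]big_mkcond; apply: eq_bigr => si _ /=; rewrite muln1.
rewrite /ptn_below; have [h1|] := boolP (hstrip th si); last by rewrite big1.
have [h2|] := boolP (hstrip rho si); last by rewrite big1 // => b _; rewrite andbF.
under eq_bigr do rewrite andbT.
rewrite /= -big_mkcond /= sum_nat_const; have le := hstrip_sumn h1.
case: leqP => h.
  have ba : (n - sumn si < a.+1)%N by rewrite ltnS leq_subLR addnC.
  rewrite (_ : #|_| = 1%N) ?mul1n // -(card1 (Ordinal ba)); apply: eq_card => b.
  rewrite !inE -val_eqE unfold_in /=.
  by apply/eqP/eqP; lia.
rewrite eq_card0 // => b; apply/negP => /eqP nb.
by have := ltn_ord b; move: h; rewrite -/n nb; lia.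
Qed.
End Kostka.

Section KostkaTriangular.
Implicit Types (lam mu : intpart) (al : seq nat).

Lemma hstrip_colsum lam mu c : hstrip lam mu ->
  (colsum lam c <= colsum mu c + minn (sumn lam - sumn mu) c)%N.
Proof.
move=> /hstripP h; pose K := maxn (size lam) (size mu).
have lK : (size lam <= K.+1)%N by rewrite leqW // leq_maxl.
have mK : (size mu <= K)%N by rewrite leq_maxr.
rewrite addn_minr leq_min (colsumE c lK); apply/andP; split; last first.
  rewrite (colsumE c mK) big_ord_recl [X in (_ <= X)%N]addnC.
  apply: leq_add; first exact: geq_minr.
  by apply: leq_sum => i _; have [_] := h i; rewrite lift0; lia.
rewrite (colsumE c (leqW mK)) (sumn_nth lK) (sumn_nth (leqW mK)).
rewrite -sumnB => [|i _]; last by case: (h i).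
rewrite -big_split; apply: leq_sum => i _; have [] := h i.
by rewrite /=; lia.
Qed.

Lemma kostka_colsum_le lam al : kostka lam al != 0%N -> colsum_le lam al.
Proof.
elim: al lam => [|a al IH] lam /=; first by case: (lam =P empty_part) => // -> _ c.
rewrite sum_nat_seq_eq0 -has_predC => /hasP[mu mun /=].
rewrite negb_imply => /andP[/andP[hs /eqP e] nz] c.
have mE := kostka_sumn nz.
apply: leq_trans (hstrip_colsum c hs) _; rewrite e mE addnK addnC.
rewrite [colsum (a :: al) c]big_cons leq_add2l.
exact: IH.
Qed.
End KostkaTriangular.

Section Tableaux.

Definition tab n (s : seq nat) (T : {ffun 'I_n -> nat}) r c : nat :=
  if insub (flatten_index s r c) is Some k then T k else 0%N.

Lemma tabE (s : seq nat) (T : {ffun 'I_(sumn s) -> nat}) (k : 'I_(sumn s)) :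
  tab s T (box_row s k) (box_col s k) = T k.
Proof.
rewrite /tab /box_row /box_col reshape_indexK.
by case: insubP => [l _ e|]; [congr (T _); apply/val_inj | rewrite ltn_ord].
Qed.

Lemma tab_ffun (s : seq nat) (t : nat -> nat -> nat) r c : (c < nth 0 s r)%N ->
  tab s [ffun k : 'I_(sumn s) => t (box_row s k) (box_col s k)] r c = t r c.
Proof.
move=> cr; rewrite /tab; case: insubP => [l _ e|]; last by rewrite flatten_indexP.
by rewrite ffunE /box_row /box_col e flatten_indexKl // flatten_indexKr.
Qed.

Definition sst (s : seq nat) (t : nat -> nat -> nat) : Prop :=
  (forall r c c', (c < c')%N -> (c' < nth 0 s r)%N -> (t r c <= t r c')%N) /\
  (forall r r' c, (r < r')%N -> (c < nth 0 s r')%N -> (t r c < t r' c)%N).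

Lemma box_exists (s : seq nat) r c : (c < nth 0 s r)%N ->
  exists k : 'I_(sumn s), box_row s k = r /\ box_col s k = c.
Proof.
move=> cr; exists (Ordinal (flatten_indexP cr)).
by rewrite /box_row /box_col /= flatten_indexKl // flatten_indexKr.
Qed.

Lemma semistandardE (lam : intpart) (T : {ffun 'I_(sumn lam) -> nat}) :
  semistandard T <-> sst lam (tab lam T).
Proof.
split=> [[h1 h2]|[h1 h2]]; split.
- move=> r c c' cc' cr'; have [k' [rk' ck']] := box_exists cr'.
  have [k [rk ck]] := box_exists (ltn_trans cc' cr').
  by rewrite -{1}rk -{1}rk' -ck -ck' !tabE; apply: h1; rewrite ?rk ?rk' ?ck ?ck'.
- move=> r r' c rr' cr'; have [k' [rk' ck']] := box_exists cr'.
  have cr : (c < nth 0 lam r)%N by apply: leq_trans cr' (nth_intpart_le _ (ltnW rr')).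
  have [k [rk ck]] := box_exists cr.
  rewrite -{1}rk -{1}rk' -{1}ck -ck' !tabE; apply: h2; rewrite ?rk ?rk' ?ck ?ck' //.
- move=> k l rkl ckl; rewrite -!tabE rkl; apply: h1 => //.
  by apply: box_col_lt.
- move=> k l ckl rkl; rewrite -!tabE ckl; apply: h2 => //.
  by apply: box_col_lt.
Qed.

Lemma count_boxes (s : seq nat) K (T : {ffun 'I_(sumn s) -> nat}) (P : pred nat) :
  (size s <= K)%N -> #|[set k | P (T k)]| =
  (\sum_(i < K) count (fun j => P (tab s T i j)) (iota 0 (nth 0 s i)))%N.
Proof.
move=> sK.
have -> : (\sum_(i < K) count (fun j => P (tab s T i j)) (iota 0 (nth 0 s i)) =
   \sum_(i < size s) count (fun j => P (tab s T i j)) (iota 0 (nth 0 s i)))%N.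
  rewrite (big_ord_widen K (fun i => count (fun j => P (tab s T i j)) (iota 0 (nth 0 s i))) sK).
  rewrite [RHS]big_mkcond; apply: eq_bigr => i _; case: ltnP => // si.
  by rewrite nth_default.
rewrite -sum1dep_card big_mkcond /=.
transitivity (\sum_(k < sumn s) P (tab s T (box_row s k) (box_col s k)))%N.
  by apply: eq_bigr => k _; rewrite tabE; case: (P _).
rewrite -(big_mkord xpredT (fun k => P (tab s T (box_row s k) (box_col s k)) : nat)).
rewrite (sum_boxes s (fun i j => P (tab s T i j) : nat)) big_mkord.
by apply: eq_bigr => i _; rewrite sum_mem_nat.
Qed.

Lemma count_iota_down (P : pred nat) L c :
  (forall i j, (i <= j)%N -> (j < L)%N -> P j -> P i) -> (c < L)%N ->
  P c = (c < count P (iota 0 L))%N.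
Proof.
elim: L => // L IH down; rewrite ltnS => cL.
rewrite -[L.+1]addn1 iotaD count_cat /= add0n addn0.
have dL : forall i j, (i <= j)%N -> (j < L)%N -> P j -> P i.
  by move=> i j ij jL; apply: down => //; apply: ltnW.
have le : (count P (iota 0 L) <= L)%N by rewrite (leq_trans (count_size _ _)) ?size_iota.
case PL : (P L).
  have Pc : P c by apply: down PL.
  have -> : count P (iota 0 L) = L.
    rewrite -[RHS](size_iota 0 L); apply/eqP; rewrite -all_count; apply/allP => i.
    by rewrite mem_iota /= => iL; apply: down PL; rewrite // ltnW.
  by rewrite Pc addn1 ltnS cL.
rewrite addn0; move: cL; rewrite leq_eqVlt => /orP[/eqP ->|cL]; last exact: IH.
by rewrite PL; apply/esym/negbTE; rewrite -leqNgt.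
Qed.

Variables (B : nat) (m : nat -> nat).
Local Notation fill lam := {ffun 'I_(sumn (parts lam)) -> 'I_B.+1}.
Implicit Types (lam ka : intpart).

Definition vals lam (T : fill lam) : {ffun 'I_(sumn lam) -> nat} := [ffun k => T k : nat].

Definition good lam N (T : fill lam) : bool :=
  [&& `[< semistandard (vals T) >], [forall k, T k < N]%N &
   [forall v : 'I_B.+1, (v < N)%N ==> (#|[set k | T k == v]| == m v)]].

Definition exps N : seq nat := [seq m i | i <- rev (iota 0 N)].

Lemma expsS N : exps N.+1 = m N :: exps N.
Proof. by rewrite /exps -addn1 iotaD rev_cat. Qed.

Definition subshape lam N (T : fill lam) : intpart :=
  to_intpart (mkseq (fun i => count (fun j => tab lam (vals T) i j < N)%N
    (iota 0 (nth 0 lam i))) (size lam)).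

Section Peel.
Variables (lam : intpart) (N : nat) (T : fill lam).
Hypotheses (NB : (N < B.+1)%N) (gT : good N.+1 T).
Let t := tab lam (vals T).

Lemma good_sst : sst lam t.
Proof. by have /and3P[/asboolP/semistandardE] := gT. Qed.

Lemma good_le r c : (c < nth 0 lam r)%N -> (t r c <= N)%N.
Proof.
move=> /box_exists[k [<- <-]]; rewrite /t tabE ffunE.
by have /and3P[_ /forallP/(_ k)] := gT.
Qed.

Lemma good_row r c c' : (c <= c')%N -> (c' < nth 0 lam r)%N -> (t r c <= t r c')%N.
Proof. by rewrite leq_eqVlt => /orP[/eqP ->|] //; case: good_sst => h _; apply: h. Qed.

Lemma nth_subshape i : nth 0%N (subshape N T) i =
  count (fun j => t i j < N)%N (iota 0 (nth 0%N lam i)).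
Proof.
rewrite /subshape (nth_mkpart (f := fun i => count (fun j => t i j < N)%N
  (iota 0 (nth 0 lam i)))) //; last by rewrite nth_default.
move=> j; have le := nth_intpart_le lam (leqnSn j).
have -> : iota 0 (nth 0 lam j) = iota 0 (nth 0 lam j.+1) ++
    iota (0 + nth 0 lam j.+1) (nth 0 lam j - nth 0 lam j.+1).
  by rewrite -iotaD subnKC.
rewrite count_cat.
apply: leq_trans (leq_addr _ _); rewrite -!size_filter.
apply: uniq_leq_size; first exact/filter_uniq/iota_uniq.
move=> c; rewrite !mem_filter mem_iota /= => /andP[tc cl]; rewrite cl andbT.
by apply: ltn_trans tc; case: good_sst => _; apply.
Qed.

Lemma lt_subshape r c : (c < nth 0 lam r)%N ->
  (t r c < N)%N = (c < nth 0%N (subshape N T) r)%N.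
Proof.
move=> cr; rewrite nth_subshape.
apply: (@count_iota_down (fun c => (t r c < N)%N)) => // i j ij jl.
by apply: leq_ltn_trans; apply: good_row.
Qed.

Lemma subshape_le r : (nth 0 (subshape N T) r <= nth 0 lam r)%N.
Proof. by rewrite nth_subshape (leq_trans (count_size _ _)) ?size_iota. Qed.

Lemma hstrip_subshape : hstrip lam (subshape N T).
Proof.
apply/hstripP => i; split; first exact: subshape_le.
case l0 : (nth 0%N lam i.+1) => [//|l].
have ll : (l < nth 0 lam i.+1)%N by rewrite l0.
rewrite -lt_subshape; last by apply: leq_trans ll (nth_intpart_le _ (leqnSn i)).
have [_ h] := good_sst; apply: leq_trans (h _ i.+1 _ (leqnn _) ll) _.
exact: good_le.
Qed.

Lemma sumn_subshape : sumn lam = (m N + sumn (subshape N T))%N.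
Proof.
have sz : (size (subshape N T) <= size lam)%N.
  rewrite leqNgt -nth_intpart_gt0 -leqNgt leqn0 -leqn0.
  by apply: leq_trans (subshape_le _) _; rewrite nth_default.
rewrite (sumn_nth (leqnn _)) (sumn_nth sz).
have <- : #|[set k | T k == inord N]| = m N.
  have /and3P[_ _ /forallP/(_ (inord N))] := gT.
  by rewrite inordK // leqnn => /eqP.
have -> : #|[set k | T k == inord N]| = #|[set k | vals T k == N]|.
  by apply: eq_card => k; rewrite !inE ffunE -val_eqE /= inordK.
rewrite (@count_boxes lam _ (vals T) (fun v => v == N) (leqnn _)) -big_split /=.
apply: eq_bigr => i _; rewrite nth_subshape addnC -[LHS](size_iota 0).
rewrite -(count_predC (fun j => t i j < N)%N); congr addn.
apply: eq_in_count => j; rewrite mem_iota /= => /good_le.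
by rewrite -/t -leqNgt eqn_leq => ->.
Qed.
End Peel.

Definition restr lam ka (T : fill lam) : fill ka :=
  [ffun k : 'I_(sumn ka) =>
    inord (tab lam (vals T) (box_row ka k) (box_col ka k))].
Definition extend lam ka N (T : fill ka) : fill lam :=
  [ffun k : 'I_(sumn lam) => if (box_col lam k < nth 0 ka (box_row lam k))%N
     then inord (tab ka (vals T) (box_row lam k) (box_col lam k)) else inord N].

Lemma tab_lt lam (T : fill lam) r c : (tab lam (vals T) r c < B.+1)%N.
Proof. by rewrite /tab; case: insubP => // k _ _; rewrite ffunE. Qed.

Lemma tab_restr lam ka (T : fill lam) r c : (c < nth 0 ka r)%N ->
  tab ka (vals (restr ka T)) r c = tab lam (vals T) r c.
Proof.
move=> cr; rewrite -(tab_ffun (tab lam (vals T)) cr); congr (tab ka _ r c).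
by apply/ffunP => k; rewrite !ffunE inordK // tab_lt.
Qed.

Lemma tab_extend lam ka N (T : fill ka) r c : (N < B.+1)%N -> (c < nth 0 lam r)%N ->
  tab lam (vals (extend lam N T)) r c =
  if (c < nth 0 ka r)%N then tab ka (vals T) r c else N.
Proof.
move=> NB cr.
rewrite -(tab_ffun (fun r c => if (c < nth 0 ka r)%N then tab ka (vals T) r c else N) cr).
congr (tab lam _ r c); apply/ffunP => k; rewrite !ffunE.
by case: ifP => _; rewrite inordK // tab_lt.
Qed.

Lemma restrK lam N (T : fill lam) : (N < B.+1)%N -> good N.+1 T ->
  extend lam N (restr (subshape N T) T) = T.
Proof.
move=> NB gT; apply/ffunP => k; rewrite ffunE.
have cl := @box_col_lt lam k (ltn_ord k).
have Tk : tab lam (vals T) (box_row lam k) (box_col lam k) = T k by rewrite tabE ffunE.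
rewrite -lt_subshape // Tk; case: ltnP => h.
  by rewrite tab_restr -?lt_subshape ?Tk // inord_val.
apply/val_inj; rewrite /= inordK //; apply/eqP; rewrite eqn_leq h.
by have := good_le gT cl; rewrite Tk.
Qed.

Lemma extendK lam ka N (T : fill ka) : (N < B.+1)%N -> hstrip lam ka ->
  restr ka (extend lam N T) = T.
Proof.
move=> NB /hstripP hs; apply/ffunP => k; rewrite ffunE.
have cl := @box_col_lt ka k (ltn_ord k).
have cl' : (box_col ka k < nth 0 lam (box_row ka k))%N.
  by apply: leq_trans cl _; case: (hs (box_row ka k)).
rewrite tab_extend // cl tabE ffunE; apply/val_inj.
by rewrite /= inordK.
Qed.

Lemma good_restr lam N (T : fill lam) : (N < B.+1)%N -> good N.+1 T ->
  good N (restr (subshape N T) T).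
Proof.
move=> NB gT; set ka := subshape N T.
have lt r c : (c < nth 0 ka r)%N -> (c < nth 0 lam r)%N.
  by move=> h; apply: leq_trans h (subshape_le gT _).
have e r c : (c < nth 0 ka r)%N -> (tab lam (vals T) r c < N)%N.
  by move=> h; rewrite lt_subshape // lt.
apply/and3P; split.
- apply/asboolP/semistandardE; have [h1 h2] := good_sst gT; split=> [r c c' cc' c'r|r r' c rr' cr].
    by rewrite !tab_restr // ?(ltn_trans cc' c'r) //; apply: h1 => //; apply: lt.
  have cr1 : (c < nth 0 ka r)%N := leq_trans cr (nth_intpart_le ka (ltnW rr')).
  by rewrite !tab_restr //; apply: h2 => //; apply: lt.
- apply/forallP => k.
  have := e _ _ (@box_col_lt ka k (ltn_ord k)).
  by rewrite ffunE; rewrite inordK ?tab_lt.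
apply/forallP => v; apply/implyP => vN.
have /and3P[_ _ /forallP/(_ v)] := gT; rewrite ltnS ltnW // => /eqP <-.
have tr (l : intpart) (U : fill l) : #|[set k | U k == v]| = #|[set k | vals U k == v]|.
  by apply: eq_card => k; rewrite !inE ffunE.
have sz : (size ka <= size lam)%N.
  rewrite leqNgt -nth_intpart_gt0 -leqNgt leqn0 -leqn0.
  by apply: leq_trans (subshape_le gT _) _; rewrite nth_default.
rewrite !tr (@count_boxes ka (size lam) _ (fun x => x == v)) //.
rewrite (@count_boxes lam (size lam) _ (fun x => x == v)) //.
apply/eqP/eq_bigr => i _; rewrite -[in RHS](subnKC (subshape_le gT i)) iotaD count_cat.
rewrite [X in _ = (_ + X)%N](_ : _ = 0%N) ?addn0.
  apply: eq_in_count => j; rewrite mem_iota /= => ji.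
  by rewrite tab_restr.
apply/eqP; rewrite -leqn0 leqNgt -has_count -all_predC; apply/allP => j.
rewrite mem_iota add0n (subnKC (subshape_le gT i)) => /andP[kj jl] /=.
apply: contraTneq vN => et; rewrite -leqNgt -et.
by rewrite leqNgt lt_subshape // -leqNgt.
Qed.

Lemma good_extend lam ka N (T : fill ka) : (N < B.+1)%N -> hstrip lam ka ->
  sumn lam = (m N + sumn ka)%N -> good N T -> good N.+1 (extend lam N T).
Proof.
move=> NB /hstripP hs sl gT.
have [gs gl gc] : [/\ sst ka (tab ka (vals T)), forall k, (T k < N)%N &
    forall v : 'I_B.+1, (v < N)%N -> #|[set k | T k == v]| = m v].
  have /and3P[/asboolP/semistandardE gs /forallP gl /forallP gc] := gT; split=> //.
  by move=> v vN; have := gc v; rewrite vN => /eqP.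
have tl r c : (c < nth 0 ka r)%N -> (tab ka (vals T) r c < N)%N.
  by move=> /box_exists[k [<- <-]]; rewrite tabE ffunE.
apply/and3P; split.
- apply/asboolP/semistandardE; have [h1 h2] := gs; split=> [r c c' cc' c'r|r r' c rr' cr].
    rewrite !tab_extend // ?(ltn_trans cc' c'r) //.
    case: (ltnP c' (nth 0 ka r)) => h; first by rewrite (ltn_trans cc' h) h1.
    by case: ltnP => // h'; apply/ltnW/tl.
  have c1 : (c < nth 0 ka r)%N.
    have [_ h] := hs r; apply: leq_trans h.
    by apply: leq_trans cr (nth_intpart_le _ rr').
  have c2 : (c < nth 0 lam r)%N by have [h _] := hs r; apply: leq_trans c1 h.
  rewrite !tab_extend // c1; case: (ltnP c (nth 0 ka r')) => h; first exact: h2.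
  exact: tl.
- apply/forallP => k; rewrite ltnS; have cl := @box_col_lt lam k (ltn_ord k).
  have := tab_extend T NB cl; rewrite tabE ffunE => ->.
  by case: ltnP => // /tl/ltnW.
apply/forallP => v; apply/implyP; rewrite ltnS leq_eqVlt => vN.
have tr (l : intpart) (U : fill l) : #|[set k | U k == v]| = #|[set k | vals U k == v]|.
  by apply: eq_card => k; rewrite !inE ffunE.
have sz : (size ka <= size lam)%N.
  rewrite leqNgt -nth_intpart_gt0 -leqNgt leqn0 -leqn0.
  by have [h _] := hs (size lam); apply: leq_trans h _; rewrite nth_default.
have cs (i : nat) : count (fun j => tab lam (vals (extend lam N T)) i j == v)
     (iota 0 (nth 0 lam i)) =
    (count (fun j => tab ka (vals T) i j == v) (iota 0 (nth 0%N ka i)) +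
     (v == N :> nat) * (nth 0%N lam i - nth 0%N ka i))%N.
  have [h _] := hs i; rewrite -{1}(subnKC h) iotaD count_cat add0n; congr addn.
    apply: eq_in_count => j; rewrite mem_iota /= => jk.
    by rewrite tab_extend // ?jk // (leq_trans jk).
  transitivity (count (fun=> v == N :> nat) (iota (nth 0%N ka i) (nth 0%N lam i - nth 0%N ka i))).
    apply: eq_in_count => j; rewrite mem_iota (subnKC h) => /andP[kj jl].
    by rewrite tab_extend // ltnNge kj eq_sym.
  by case: (v == N :> nat); rewrite ?count_predT ?count_pred0 ?size_iota ?mul1n ?mul0n.
rewrite tr (@count_boxes lam (size lam) _ (fun x => x == v)) //.
rewrite (eq_bigr _ (fun (i : 'I_(size lam)) _ => cs i)) big_split /= -(@count_boxes ka _ _ (fun x => x == v)) // -tr.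
case/orP: vN => [vN|vN]; last first.
  rewrite gc // big1 ?addn0 ?eqxx // => i _.
  by rewrite (ltn_eqF vN) mul0n.
rewrite (_ : #|_| = 0%N); last first.
  apply: eq_card0 => k; rewrite inE; apply/negbTE; rewrite -val_eqE /= (eqP vN).
  by rewrite ltn_eqF.
rewrite add0n (eq_bigr (fun i : 'I_(size lam) => nth 0 lam i - nth 0 ka i)%N); last first.
  by move=> i _; rewrite vN mul1n.
rewrite sumnB => [|i _]; last by case: (hs i).
by rewrite -(sumn_nth (leqnn _)) -(sumn_nth sz) sl addnK (eqP vN).
Qed.

Lemma subshape_extend lam ka N (T : fill ka) : (N < B.+1)%N -> hstrip lam ka ->
  sumn lam = (m N + sumn ka)%N -> good N T -> subshape N (extend lam N T) = ka.
Proof.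
move=> NB hs sl gT; have gE := good_extend NB hs sl gT.
apply: intpart_eq => i; rewrite nth_subshape //.
move/hstripP: hs => hs; have [h _] := hs i.
rewrite -(subnKC h) iotaD count_cat add0n.
rewrite (_ : count _ (iota 0 _) = nth 0%N ka i); last first.
  rewrite -[RHS](size_iota 0); apply/eqP; rewrite -all_count; apply/allP => j.
  rewrite mem_iota /= => jk; rewrite tab_extend //; last exact: leq_trans jk h.
  rewrite jk; have [k [<- <-]] := box_exists jk; rewrite tabE ffunE.
  by have /and3P[_ /forallP] := gT.
apply/eqP; rewrite -[X in _ == X]addn0 eqn_add2l -leqn0 leqNgt -has_count -all_predC.
apply/allP => j; rewrite mem_iota (subnKC h) => /andP[kj jl] /=.
by rewrite tab_extend // [(j < _)%N]ltnNge kj /= ltnn.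
Qed.

Lemma count_good lam N : (N <= B.+1)%N ->
  (\sum_(T : fill lam | good N T) 1)%N = kostka lam (exps N).
Proof.
elim: N lam => [|N IH] lam NB.
  rewrite /=; have [l0|ne] := eqVneq lam empty_part.
    subst lam; rewrite (eq_bigl xpredT); first by rewrite sum1_card card_ffun !card_ord expn0.
    move=> T; apply/and3P; split; last by apply/forallP.
      by apply/asboolP; split=> -[].
    by apply/forallP => -[].
  have l0 : (0 < sumn lam)%N by rewrite lt0n; apply: contraNneq ne => /sumn_eq0 ->.
  rewrite big_pred0 // => T; apply/negP => /and3P[_ /forallP/(_ (Ordinal l0))].
  by [].
rewrite expsS (kostka_cons _ _ (leqnn _)).
transitivity (\sum_(ka <- ptnle (sumn lam)) \sum_(T : fill lam | good N.+1 T && (subshape N T == ka)) 1)%N.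
  under [RHS]eq_bigr do rewrite big_mkcondr.
  rewrite exchange_big; apply: eq_bigr => T gT /=.
  rewrite -big_mkcond (eq_bigl (fun ka => ka == subshape N T)); last by move=> ka; rewrite eq_sym.
  rewrite (@sum_delta _ nat) ?ptnle_uniq // mem_ptnle (sumn_subshape NB gT).
  by rewrite leq_addl.
rewrite [RHS]big_mkcond; apply: eq_bigr => ka _.
have [/andP[hs /eqP sl]|ncond] := boolP (hstrip lam ka && (sumn lam == m N + sumn ka)%N).
  rewrite -IH; last exact: ltnW.
  rewrite (reindex_onto (extend lam N) (restr ka)) /=; last first.
    by move=> T /andP[gT /eqP <-]; apply: restrK.
  apply: eq_bigl => T; rewrite extendK // eqxx andbT.
  apply/andP/idP => [[gE /eqP se]|gT]; last first.
    by rewrite good_extend // subshape_extend.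
  by have := good_restr NB gE; rewrite se extendK.
rewrite big_pred0 // => T; apply: contraNF ncond => /andP[gT /eqP <-].
by rewrite hstrip_subshape // {1}(sumn_subshape NB gT) eqxx.
Qed.

End Tableaux.

(** * Power series and the Pieri rule *)

Section Monomials.
Implicit Types (m a b : cmonom nat) (F G H : mseries).

Lemma cm_eq m a : (forall i, m i = a i) -> m = a.
Proof. by move=> e; apply/eqP/cmP. Qed.

Lemma expcmnE m k i : expcmn m k i = (k * m i)%N.
Proof.
rewrite /expcmn; case: k => [|k]; first by rewrite onecmE.
elim: k => [|k IH] /=; first by rewrite mul1n.
by rewrite mulcmE IH mulSn.
Qed.

Definition cmbound N m := forall i, (N <= i)%N -> m i = 0%N.

Lemma cmbound_exists m : exists N, cmbound N m.
Proof.
exists (\max_(i <- finsupp m) i).+1 => i Ni; apply/eqP; rewrite cmE_eq0.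
by apply: contraL Ni => im; rewrite -ltnNge ltnS; apply: leq_bigmax_seq.
Qed.

Lemma cmboundW N N' m : (N <= N')%N -> cmbound N m -> cmbound N' m.
Proof. by move=> NN' b i Ni; apply: b; apply: leq_trans Ni. Qed.

Definition cmfun N (f : nat -> nat) : cmonom nat :=
  \big[mmul/mone]_(j < N) expcmn (ucm (j : nat)) (f j).

Lemma cmfunE N f i : cmfun N f i = if (i < N)%N then f i else 0%N.
Proof.
rewrite /cmfun (big_morph (fun m => m i) (fun a b => cmM i a b) (cm1 i)).
case: ltnP => iN; last first.
  rewrite big1 // => j _; rewrite expcmnE ucmE; case: eqP => [ji|]; last by rewrite muln0.
  by have := ltn_ord j; rewrite ji ltnNge iN.
rewrite (bigD1 (Ordinal iN)) //= expcmnE ucmE eqxx muln1 big1 ?addn0 //.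
move=> j ne; rewrite expcmnE ucmE; case: eqP => [ji|]; last by rewrite muln0.
by case/eqP: ne; apply/val_inj.
Qed.

Lemma cmfun_bound N f : cmbound N (cmfun N f).
Proof. by move=> i Ni; rewrite cmfunE ltnNge Ni. Qed.

Lemma cmfunK N m : cmbound N m -> cmfun N m = m.
Proof. by move=> b; apply: cm_eq => i; rewrite cmfunE; case: ltnP => // /b. Qed.

Lemma mdeg_exp m k : mdeg (expcmn m k) = (k * mdeg m)%N.
Proof.
rewrite /expcmn; case: k => [|k]; first exact: mdeg1.
elim: k => [|k IH] /=; first by rewrite mul1n.
by rewrite -/(mmul _ _) mdegM IH mulSn.
Qed.

Lemma mdeg_bound N m : cmbound N m -> mdeg m = (\sum_(i < N) m i)%N.
Proof.
move=> b; rewrite -[in LHS](cmfunK b) mdeg_prod; apply: eq_bigr => i _.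
by rewrite mdeg_exp mdegU muln1.
Qed.

Lemma divcmK m a : a \in cm_divisors m -> mmul a (divcm m a) = m.
Proof.
by move=> /mem_cm_divisors am; apply: cm_eq => i; rewrite cmM divcmE subnKC.
Qed.

Lemma divcm_divisor m a : divcm m a \in cm_divisors m.
Proof. by apply/mem_cm_divisors => i; rewrite divcmE leq_subr. Qed.

Lemma divcmMl m a : divcm (mmul m a) m = a.
Proof. by apply: cm_eq => i; rewrite divcmE cmM addKn. Qed.

Lemma mmulI m : injective (mmul m).
Proof. by move=> a b e; rewrite -(divcmMl m a) e divcmMl. Qed.

Lemma mseriesME F G m :
  (F * G) m = \sum_(a <- cm_divisors m) F a * G (divcm m a).
Proof.
rewrite -[LHS]/(mseries_mul F G m) (@mseries_mulE (cm_divisors m)) //.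
apply: eq_big_seq => a am.
rewrite -big_mkcond (eq_bigl (fun b => b == divcm m a)); last first.
  move=> b /=; apply/eqP/eqP => [<-|->]; first by rewrite divcmMl.
  exact: divcmK.
rewrite (@sum_delta _ rat (cm_divisors m) (divcm m a) (fun b => F a * G b)) ?fset_uniq //.
by rewrite divcm_divisor.
Qed.

Lemma mseriesDE F G m : (F + G) m = F m + G m. Proof. by []. Qed.
Lemma mseriesZE (c : rat) F m : (c *: F) m = c * F m. Proof. by []. Qed.
Lemma mseries1E m : (1 : mseries) m = (m == mone)%:R. Proof. by []. Qed.
Lemma mseries_sumE I (r : seq I) (P : pred I) (F : I -> mseries) m :
  (\sum_(i <- r | P i) F i) m = \sum_(i <- r | P i) F i m.
Proof. exact: (big_morph (fun f : mseries => f m)). Qed.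

Definition mX m : mseries := fun a => (a == m)%:R.

Lemma mX1 : mX mone = 1. Proof. by []. Qed.

Lemma mXME m F a : (mX m * F) (mmul m a) = F a.
Proof.
rewrite mseriesME (eq_bigr (fun b => if b == m then F (divcm (mmul m a) b) else 0)).
  rewrite -big_mkcond sum_delta ?fset_uniq // divcmMl.
  by rewrite (cm_divisorsMl (erefl _)).
by move=> b _; rewrite /mX; case: eqP; rewrite ?mul1r ?mul0r.
Qed.

Lemma mXME0 m F b : m \notin cm_divisors b -> (mX m * F) b = 0.
Proof.
move=> mb; rewrite mseriesME big_seq big1 // => a ab; rewrite /mX.
by case: eqP mb ab => [<- /negPf ->|]; rewrite ?mul0r.
Qed.

Lemma mXM m a : mX (mmul m a) = mX m * mX a.
Proof.
apply: funext => b; have [mb|mb] := boolP (m \in cm_divisors b).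
  by rewrite -(divcmK mb) mXME /mX (inj_eq (@mmulI m)).
rewrite mXME0 // /mX; case: eqP mb => // ->.
by rewrite (cm_divisorsMl (erefl _)).
Qed.

Lemma mX_prod I (r : seq I) (P : pred I) (f : I -> cmonom nat) :
  \prod_(i <- r | P i) mX (f i) = mX (\big[mmul/mone]_(i <- r | P i) f i).
Proof. by apply/esym/(big_morph _ mXM mX1). Qed.

Lemma mX_exp m k : mX m ^+ k = mX (expcmn m k).
Proof.
have -> : expcmn m k = \big[mmul/mone]_(i < k) m.
  apply: cm_eq => i; rewrite expcmnE (big_morph (fun m => m i) (fun a b => cmM i a b) (cm1 i)).
  by rewrite sum_nat_const card_ord.
by rewrite -mX_prod prodr_const card_ord.
Qed.

Definition below N F G := forall m, cmbound N m -> F m = G m.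

Lemma cmbound_div N m a : cmbound N m -> a \in cm_divisors m -> cmbound N a.
Proof.
move=> b /mem_cm_divisors am i Ni; apply/eqP; rewrite -leqn0 -[X in (_ <= X)%N](b i Ni).
exact: am.
Qed.

Lemma below_mul N F F' G G' : below N F F' -> below N G G' ->
  below N (F * G) (F' * G').
Proof.
move=> hF hG m b; rewrite !mseriesME; apply: eq_big_seq => a am.
by rewrite hF ?hG //; [apply: cmbound_div b _; apply: divcm_divisor
                      | apply: cmbound_div am].
Qed.

Lemma below_prod N I (r : seq I) (F F' : I -> mseries) :
  (forall i, below N (F i) (F' i)) -> below N (\prod_(i <- r) F i) (\prod_(i <- r) F' i).
Proof.
move=> h; elim: r => [|i r IH]; first by rewrite !big_nil.
by rewrite !big_cons; apply: below_mul.
Qed.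

Lemma psumE k N m : (0 < k)%N -> cmbound N m ->
  psum k m = \sum_(i < N) mX (expcmn (ucm (i : nat)) k) m.
Proof.
move=> k0 b; rewrite /psum.
rewrite (fsbigE [seq i <- iota 0 N | expcmn (ucm i) k == m]).
- rewrite big_filter_cond big_mkcond -/(index_iota 0 N) -{1}[N]subn0 -/(index_iota 0 N) big_mkord.
  apply: eq_bigr => i _; rewrite /mX eq_sym; case: eqP => //= e.
  by rewrite mem_set.
- exact/filter_uniq/iota_uniq.
- by move=> i /=; rewrite mem_filter => /andP[/eqP].
move=> i /= e; rewrite mem_filter e eqxx mem_iota /= -leqNgt => Ni; have := b i Ni.
by rewrite -e expcmnE ucmE eqxx muln1 => k0'; rewrite k0' in k0.
Qed.

Lemma psum_below k N : (0 < k)%N ->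
  below N (psum k) (\sum_(i < N) mX (ucm (i : nat)) ^+ k).
Proof.
move=> k0 m b; rewrite (psumE k0 b) mseries_sumE.
by apply: eq_bigr => i _; rewrite mX_exp.
Qed.

End Monomials.

Section SchurSeries.
Implicit Types (m a b : cmonom nat) (lam th ka : intpart).

Lemma tableau_weightE n (T : {ffun 'I_n -> nat}) i :
  tableau_weight T i = #|[set k | T k == i]|.
Proof.
rewrite /tableau_weight (big_morph (fun m => m i) (fun a b => cmM i a b) (cm1 i)).
rewrite -sum1dep_card [RHS]big_mkcond; apply: eq_bigr => k _.
by rewrite ucmE; case: eqP.
Qed.

Lemma schur_kostka lam m N : cmbound N m -> schur lam m = (kostka lam (exps m N))%:R.
Proof.
move=> b; rewrite -(@count_good N m lam N (leqnSn N)) /schur.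
pose r := [seq vals T | T <- enum [pred T : {ffun 'I_(sumn lam) -> 'I_N.+1} | good m N T]].
have rP U : reflect (exists2 T, good m N T & U = @vals N lam T) (U \in r).
  apply: (iffP mapP) => [[T]|[T gT ->]]; first by rewrite mem_enum => gT ->; exists T.
  by exists T; rewrite ?mem_enum.
have goodP (T : {ffun 'I_(sumn lam) -> 'I_N.+1}) :
    good m N T <-> semistandard (vals T) /\ tableau_weight (vals T) = m.
  have wt v : tableau_weight (vals T) (v : 'I_N.+1) = #|[set k | T k == v]|.
    by rewrite tableau_weightE; apply: eq_card => k; rewrite !inE ffunE.
  split=> [/and3P[/asboolP ss /forallP lt /forallP wv]|[ss w]].
    split=> //; apply: cm_eq => i; have [iN|Ni] := ltnP i N.
      have := wv (inord i); rewrite inordK ?ltnS ?(ltnW iN) // iN /= => /eqP <-.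
      by rewrite -wt inordK // ltnS ltnW.
    rewrite b // tableau_weightE; apply: eq_card0 => k; rewrite inE ffunE.
    by apply: contraTF Ni => /eqP <-; rewrite -ltnNge.
  apply/and3P; split; first exact/asboolP.
    apply/forallP => k; rewrite ltnNge; apply/negP => Nk.
    have := b _ Nk; rewrite -w tableau_weightE => /eqP; rewrite cards_eq0.
    by apply/negP/set0Pn; exists k; rewrite inE ffunE.
  by apply/forallP => v; apply/implyP => _; rewrite -wt w.
rewrite (fsbigE r).
- rewrite big_map big_enum_cond /= natr_sum [LHS]big_mkcond [RHS]big_mkcond.
  apply: eq_bigr => T _; rewrite inE; case: (boolP (good m N T)) => //= gT.
  by rewrite mem_set //; apply/goodP.
- rewrite map_inj_uniq ?enum_uniq // => T T' e; apply/ffunP => k; apply/val_inj.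
  by have := congr1 (fun U : {ffun _ -> nat} => U k) e; rewrite !ffunE.
- by move=> U /= /rP[T gT ->]; apply/goodP.
move=> U [ss w] /negP[]; apply/rP.
have lt k : (U k < N)%N.
  rewrite ltnNge; apply/negP => Nk; have := b _ Nk; rewrite -w tableau_weightE => /eqP.
  by rewrite cards_eq0; apply/negP/set0Pn; exists k; rewrite inE.
have UE : U = vals [ffun k => inord (U k) : 'I_N.+1].
  by apply/ffunP => k; rewrite !ffunE inordK // ltnS ltnW.
by exists [ffun k => inord (U k) : 'I_N.+1] => //; apply/goodP; rewrite -UE.
Qed.

Lemma sumn_exps m N : cmbound N m -> sumn (exps m N) = mdeg m.
Proof.
move=> b; rewrite (mdeg_bound b) {b}; elim: N => [|N IH]; first by rewrite big_ord0.
by rewrite expsS /= IH big_ord_recr /= addnC.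
Qed.

Lemma schur_homog lam m : schur lam m != 0 -> mdeg m = sumn lam.
Proof.
have [N b] := cmbound_exists m; rewrite (schur_kostka _ b) pnatr_eq0.
by move=> /kostka_sumn ->; rewrite (sumn_exps b).
Qed.

Lemma schur_homog0 lam m : mdeg m != sumn lam -> schur lam m = 0.
Proof. by move=> ne; apply/eqP; apply: contraNT ne => /schur_homog ->. Qed.

Lemma sum_cm_divisors N m (F : seq nat -> nat) : cmbound N m ->
  (\sum_(a <- cm_divisors m) F (exps a N))%N = sum_le (exps m N) F.
Proof.
elim: N m F => [|N IH] m F b.
  rewrite /= (perm_big [:: (mone : cmonom nat)]) /=; first by rewrite big_seq1.
  apply: uniq_perm; rewrite ?fset_uniq // => a; rewrite inE.
  apply/mem_cm_divisors/eqP => [h|-> i]; last by rewrite cm1.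
  by apply: cm_eq => i; apply/eqP; rewrite cm1 -leqn0 -[X in (_ <= X)%N](b i (leq0n i)).
rewrite expsS sum_le_cons.
pose m' := cmfun N m; have b' : cmbound N m' by exact: cmfun_bound.
have em : exps m N = exps m' N.
  apply/eq_in_map => i; rewrite mem_rev mem_iota /= => iN.
  by rewrite cmfunE iN.
pose X k := expcmn (ucm N) k : cmonom nat.
have XE k i : X k i = if i == N then k else 0%N.
  by rewrite expcmnE ucmE eq_sym; case: eqP; rewrite ?muln1 ?muln0.
rewrite (perm_big [seq mmul a (X k) | k <- iota 0 (m N).+1, a <- cm_divisors m']).
  rewrite big_allpairs_dep -[X in iota 0 X]subn0 -/(index_iota 0 (m N).+1) big_mkord.
  apply: eq_bigr => k _; rewrite em -IH //; apply: eq_big_seq => a am.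
  have aN : a N = 0%N by apply: (cmbound_div b' am).
  rewrite expsS cmM XE eqxx aN add0n; congr (F (_ :: _)).
  apply/eq_in_map => i; rewrite mem_rev mem_iota /= => iN.
  by rewrite cmM XE (ltn_eqF iN) addn0.
apply: uniq_perm; rewrite ?fset_uniq //.
  apply: allpairs_uniq; rewrite ?iota_uniq ?fset_uniq //.
  move=> u v /allpairsP[u' [_ ua ->]] /allpairsP[v' [_ va ->]].
  case: u' v' ua va => [k a] [k' a'] /= am am' e.
  have aN c : c \in cm_divisors m' -> c N = 0%N by move=> cm; apply: (cmbound_div b' cm).
  have kk := congr1 (fun c : cmonom nat => c N) e.
  rewrite !cmM !XE !eqxx !aN // !add0n in kk; rewrite kk in e *; congr (_, _).
  by move: e; rewrite mulmC [RHS]mulmC => /mmulI.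
move=> a; apply/mem_cm_divisors/allpairsP => [am|[[k c] [kl cm ->]] i].
  exists (a N, cmfun N a); split.
  - by rewrite mem_iota add0n ltnS; apply: am.
  - by apply/mem_cm_divisors => i; rewrite !cmfunE; case: ifP.
  apply: cm_eq => i; rewrite /= cmM XE cmfunE; case: ltngtP => [iN|Ni|->]; rewrite ?addn0 ?add0n //.
  by apply/eqP; rewrite -leqn0 -[X in (_ <= X)%N](b i Ni).
rewrite /= cmM XE; move/mem_cm_divisors/(_ i): cm; rewrite cmfunE.
rewrite mem_iota add0n ltnS /= in kl; case: eqP => [->|_]; first by rewrite ltnn leqn0 => /eqP ->.
by rewrite addn0; case: ifP => // _; rewrite leqn0 => /eqP ->.
Qed.

Definition hone : mseries := fun=> 1.
Definition hgr d : mseries := fun m => (mdeg m == d)%:R.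

Lemma pieri th m : (hone * schur th) m =
  \sum_(ka <- ptn (mdeg m) | hstrip ka th) schur ka m.
Proof.
have [N b] := cmbound_exists m.
rewrite mulrC mseriesME (eq_big_seq (fun a => (kostka th (exps a N))%:R : rat)); last first.
  by move=> a am; rewrite /hone mulr1; apply: schur_kostka; apply: cmbound_div am.
rewrite -natr_sum sum_cm_divisors // -pieri_kostka natr_sum (sumn_exps b).
by apply: eq_bigr => ka _; rewrite (schur_kostka _ b).
Qed.

Lemma pieri_gr d th : hgr d * schur th =
  \sum_(ka <- ptn (d + sumn th)%N | hstrip ka th) schur ka.
Proof.
apply: funext => m; rewrite mseries_sumE mulrC mseriesME.
have [e|ne] := eqVneq (mdeg m) (d + sumn th)%N.
  rewrite -e -pieri mulrC mseriesME; apply: eq_big_seq => a am.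
  have [->|nz] := eqVneq (schur th a) 0; first by rewrite !mul0r.
  rewrite /hone /hgr; have := congr1 (@mdeg _) (divcmK am).
  by rewrite mdegM e (schur_homog nz) addnC => /addIn ->; rewrite eqxx.
rewrite [RHS]big_seq_cond [RHS]big1 => [|ka]; last first.
  by rewrite mem_ptn => /andP[/eqP e _]; apply: schur_homog0; rewrite e.
rewrite big_seq big1 // => a am.
have [->|nz] := eqVneq (schur th a) 0; first by rewrite !mul0r.
rewrite /hgr; case: eqP => [da|]; last by rewrite mulr0.
case/eqP: ne; have := congr1 (@mdeg _) (divcmK am).
by rewrite mdegM da (schur_homog nz) addnC => ->.
Qed.

End SchurSeries.

(** * The Frobenius character formula *)

Lemma mseries_scaleAl (c : rat) (F G : mseries) : c *: (F * G) = (c *: F) * G.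
Proof.
apply: funext => m; rewrite mseriesZE !mseriesME mulr_sumr.
by apply: eq_bigr => a _; rewrite mseriesZE mulrA.
Qed.

HB.instance Definition _ := GRing.Lmodule_isLalgebra.Build rat mseries mseries_scaleAl.
HB.instance Definition _ := GRing.Lalgebra_isComAlgebra.Build rat mseries.

Section MonomialOf.
Variable B : nat.
Implicit Types (f : 'I_B -> nat).

Definition cmof f : cmonom nat := \big[mmul/mone]_(j < B) expcmn (ucm (j : nat)) (f j).

Lemma cmof_fun f : cmof f = cmfun B (fun i => if insub i is Some j then f j else 0%N).
Proof. by rewrite /cmfun; apply: eq_bigr => j _; rewrite valK. Qed.

Lemma cmofE f (i : 'I_B) : cmof f i = f i.
Proof. by rewrite cmof_fun cmfunE ltn_ord valK. Qed.

Lemma cmof_bound f : cmbound B (cmof f).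
Proof. by rewrite cmof_fun; exact: cmfun_bound. Qed.

Lemma cmbound_eq m m' : cmbound B m -> cmbound B m' ->
  (m == m') = [forall i : 'I_B, m i == m' i].
Proof.
move=> b b'; apply/eqP/forallP => [-> //|h]; apply: cm_eq => i.
by case: (ltnP i B) => [iB|Bi]; [exact/eqP/(h (Ordinal iB)) | rewrite b // b'].
Qed.

Lemma cm_prodE I (r : seq I) (P : pred I) (F : I -> cmonom nat) i :
  (\big[mmul/mone]_(j <- r | P j) F j) i = (\sum_(j <- r | P j) F j i)%N.
Proof. exact: (big_morph (fun m : cmonom nat => m i) (fun a b => cmM i a b) (cm1 i)). Qed.
End MonomialOf.

Section Words.
Variables (n : nat) (T : finType).
Implicit Types (z : {ffun 'I_n -> T}) (w g : 'S_n).

Definition wact z w : {ffun 'I_n -> T} := [ffun k => z (w k)].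

Definition content z : {ffun T -> 'I_n.+1} := [ffun t => inord #|[set k | z k == t]|].

Lemma card_count (P : pred 'I_n) : #|[set k | P k]| = count P (enum 'I_n).
Proof. by rewrite -sum1_count big_enum_cond sum1dep_card. Qed.

Lemma contentE z t : content z t = #|[set k | z k == t]| :> nat.
Proof. by rewrite ffunE inordK // ltnS -[X in (_ <= X)%N]card_ord max_card. Qed.

Lemma wactM z w g : wact (wact z w) g = wact z (g * w)%g.
Proof. by apply/ffunP => k; rewrite !ffunE permM. Qed.

Lemma content_wact z w : content (wact z w) = content z.
Proof.
apply/ffunP => t; apply: ord_inj; rewrite !contentE.
rewrite -(card_imset _ (@perm_inj _ w)); apply: eq_card => k; rewrite !inE.
apply/imsetP/eqP => [[l]|zk]; first by rewrite inE ffunE => /eqP <- ->.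
by exists (w^-1%g k); rewrite ?permKV // inE ffunE permKV zk.
Qed.

Lemma content_sum z : (\sum_t content z t = n)%N.
Proof.
transitivity (\sum_t \sum_(k : 'I_n) (z k == t : nat))%N.
  apply: eq_bigr => t _; rewrite contentE -sum1dep_card big_mkcond.
  by apply: eq_bigr => k _; case: eqP.
rewrite exchange_big /= -[RHS]card_ord -sum1_card; apply: eq_bigr => k _.
by rewrite (bigD1 (z k)) //= eqxx big1 // => t; rewrite eq_sym => /negPf ->.
Qed.

Lemma content_perm z z' : content z = content z' -> exists g, z' = wact z g.
Proof.
move=> e; have /tuple_permP[g gE] :
    perm_eq [tuple z' k | k < n] [tuple z k | k < n].
  apply/allP => t _ /=; rewrite !count_map.
  have := congr1 (fun c : {ffun T -> 'I_n.+1} => nat_of_ord (c t)) e.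
  by rewrite !contentE !card_count -enumT => /eqP; rewrite eq_sym.
exists g; apply/ffunP => k; rewrite ffunE.
have := congr1 (fun s => nth (z' k) s k) gE.
by rewrite -!tnth_nth !tnth_mktuple.
Qed.

Lemma content_exists (c : {ffun T -> 'I_n.+1}) : (\sum_t c t = n)%N ->
  exists z, content z = c.
Proof.
move=> sc; pose s := flatten [seq nseq (c t) t | t <- enum T].
have ss : size s == n.
  rewrite size_flatten /shape -map_comp sumnE big_map big_enum /= -[X in _ == X]sc.
  by apply/eqP/eq_bigr => t _; rewrite /= size_nseq.
exists [ffun k => tnth (Tuple ss) k]; apply/ffunP => t; apply: ord_inj; rewrite contentE card_count.
transitivity (count (pred1 t) s).
  transitivity (count (pred1 t) (map (tnth (Tuple ss)) (enum 'I_n))); last first.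
    by rewrite map_tnth_enum.
  by rewrite count_map; apply: eq_count => k /=; rewrite ffunE.
rewrite count_flatten -map_comp sumnE big_map big_enum (bigD1 t) //= count_nseq /= eqxx mul1n.
by rewrite big1 ?addn0 // => u /negPf ut; rewrite count_nseq /= ut.
Qed.

Lemma sum_wact (V : nmodType) z (F : {ffun 'I_n -> T} -> V) :
  \sum_g F (wact z g) =
  (\sum_(z' | content z' == content z) F z') *+ #|[set g | wact z g == z]|.
Proof.
rewrite (partition_big (wact z) (fun z' => content z' == content z)) /=; last first.
  by move=> g _; rewrite content_wact.
rewrite -sumrMnl; apply: eq_bigr => z' /eqP /esym /content_perm[h hE].
rewrite (eq_bigr (fun=> F z')); last by move=> g /eqP ->.
rewrite sumr_const; congr (_ *+ _); rewrite hE.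
rewrite -(card_imset _ (mulgI h^-1%g)); apply: eq_card => g; rewrite !inE.
apply/imsetP/eqP => [[k ke ->]|e].
  have {}ke : wact z k = wact z h by apply/eqP.
  have := congr1 (wact ^~ h^-1%g) ke; rewrite !wactM => ->.
  by apply/ffunP => i; rewrite ffunE mulVg perm1.
exists (h * g)%g; last by rewrite mulKg.
by apply/eqP; rewrite -wactM e.
Qed.

Lemma burnside (V : nmodType) (G : {ffun T -> 'I_n.+1} -> V) :
  \sum_w \sum_(z | wact z w == z) G (content z) =
  (\sum_(c : {ffun T -> 'I_n.+1} | (\sum_t c t)%N == n) G c) *+ n`!.
Proof.
under eq_bigr do rewrite big_mkcond.
rewrite exchange_big /= (partition_big content (fun c => (\sum_t c t)%N == n)) /=; last first.
  by move=> z _; rewrite content_sum.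
rewrite -sumrMnl; apply: eq_bigr => c /eqP /content_exists[z0 z0c].
rewrite -card_Sn -sumr_const -{1}z0c.
transitivity (\sum_(z | content z == content z0) \sum_w (if wact z0 w == z then G c else 0)).
  apply: eq_bigr => z /eqP cz; have [h hE] := content_perm (esym cz).
  rewrite (reindex_inj (mulIg h^-1%g)) /=; apply: eq_bigr => w _.
  by rewrite {1}hE wactM mulgKV cz z0c.
rewrite exchange_big /=; apply: eq_bigr => w _.
rewrite -big_mkcondr /= (big_pred1 (wact z0 w)) // => z.
by rewrite andbC /= [RHS]eq_sym; case: eqP => //= <-; rewrite content_wact eqxx.
Qed.

End Words.

Definition psump (rho : seq nat) : mseries := \prod_(k <- rho) psum k.

Section WordSeries.
Variables (n B : nat).
Implicit Types (z : {ffun 'I_n -> 'I_B}) (w : 'S_n) (al be : cmonom nat).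

Definition cmwt z : cmonom nat := cmof (fun j => content z j : nat).

Lemma cmwtE z : cmwt z = \big[mmul/mone]_k ucm (z k : nat).
Proof.
apply: cm_eq => i; rewrite [RHS]cm_prodE.
have [iB|Bi] := ltnP i B; last first.
  rewrite [LHS]cmof_bound // big1 // => k _; rewrite ucmE; case: eqP => // zi.
  by have := ltn_ord (z k); rewrite zi ltnNge Bi.
rewrite [LHS](cmofE _ (Ordinal iB)) contentE -sum1dep_card big_mkcond; apply: eq_bigr => k _.
by rewrite ucmE -val_eqE /=; case: eqP.
Qed.

Lemma psump_words w al : cmbound B al ->
  psump (cyc w) al = \sum_(z | wact z w == z) (cmwt z == al)%:R.
Proof.
move=> b; pose M (a c : 'I_B) : mseries := if a == c then mX (ucm (a : nat)) else 0.
have wM k a : walk M k a a = mX (ucm (a : nat)) ^+ k.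
  have : forall c, walk M k a c = (a == c)%:R * mX (ucm (a : nat)) ^+ k.
    elim: k => [|k IH] c /=; first by rewrite expr0 mulr1.
    rewrite (bigD1 a) //= big1 ?addr0 => [|d ne]; last by rewrite /M eq_sym (negPf ne) mul0r.
    by rewrite /M eqxx IH exprS mulrCA.
  by move=> ->; rewrite eqxx mul1r.
have := sum_prod_cyc M w => e.
transitivity ((\prod_(k <- parts (cyc w)) \sum_a walk M k a a) al).
  have gt0 : all (fun k => 0 < k)%N (parts (cyc w)) by apply/allP => k; exact: intpart_gt0.
  rewrite /psump; elim: (parts (cyc w)) gt0 al b => [|k s IH] /=; first by rewrite !big_nil.
  move=> /andP[k0 sg] al b; rewrite !big_cons.
  apply: (below_mul (N := B)) (b) => [m mb|]; last exact: IH.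
  by rewrite (psum_below k0 mb) !mseries_sumE; apply: eq_bigr => a _; rewrite wM.
rewrite -e mseries_sumE [RHS]big_mkcond; apply: eq_bigr => z _.
case: ifP => [/eqP|/eqP] h.
  rewrite (eq_bigr (fun k => mX (ucm (z k : nat)))); last first.
    by move=> k _; rewrite /M; have := congr1 (fun y : {ffun _ -> _} => y k) h; rewrite ffunE => ->; rewrite eqxx.
  by rewrite mX_prod -cmwtE /mX eq_sym.
have [k kP] : exists k, z k != z (w k).
  apply: contrapT => nh; apply: h; apply/ffunP => k; rewrite ffunE.
  by apply/eqP; apply: contrapT => /negP hk; apply: nh; exists k; rewrite eq_sym.
by rewrite (bigD1 k) //= /M (negPf kP) mul0r.
Qed.

End WordSeries.

Section Cauchy.
Variables (n B : nat).
Implicit Types (al be : cmonom nat) (lam mu : intpart).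

Lemma cmwt_eq (z : {ffun 'I_n -> 'I_B}) al : cmbound B al ->
  (cmwt z == al) = [forall i : 'I_B, content z i == al i :> nat].
Proof.
move=> b; rewrite (cmbound_eq (@cmof_bound _ _) b).
by apply: eq_forallb => i; rewrite cmofE.
Qed.

Definition margins al be (c : {ffun 'I_B * 'I_B -> 'I_n.+1}) : bool :=
  [forall i : 'I_B, (\sum_j c (i, j) == al i)%N] &&
  [forall j : 'I_B, (\sum_i c (i, j) == be j)%N].

Lemma psump_cauchy al be : cmbound B al -> cmbound B be -> mdeg al = n ->
  \sum_(w : 'S_n) psump (cyc w) al * psump (cyc w) be =
  (n`!)%:R * #|[set c | margins al be c]|%:R.
Proof.
move=> ba bb da.
pose pr (Z : {ffun 'I_n -> 'I_B * 'I_B}) :=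
  ([ffun k => (Z k).1] : {ffun 'I_n -> 'I_B}, [ffun k => (Z k).2] : {ffun 'I_n -> 'I_B}).
have m1 Z i : content (pr Z).1 i = (\sum_j content Z (i, j))%N :> nat.
  rewrite contentE -sum1dep_card big_mkcond; under [RHS]eq_bigr do rewrite contentE -sum1dep_card big_mkcond.
  rewrite exchange_big; apply: eq_bigr => k _; rewrite ffunE (bigD1 (Z k).2) //= big1 ?addn0.
    by rewrite -pair_eqE /= eqxx andbT.
  by move=> j ne; rewrite -pair_eqE /= [_ == j]eq_sym (negPf ne) andbF.
have m2 Z j : content (pr Z).2 j = (\sum_i content Z (i, j))%N :> nat.
  rewrite contentE -sum1dep_card big_mkcond; under [RHS]eq_bigr do rewrite contentE -sum1dep_card big_mkcond.
  rewrite exchange_big; apply: eq_bigr => k _; rewrite ffunE (bigD1 (Z k).1) //= big1 ?addn0.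
    by rewrite -pair_eqE /= eqxx.
  by move=> i ne; rewrite -pair_eqE /= [_ == i]eq_sym (negPf ne).
transitivity (\sum_(w : 'S_n) \sum_(Z : {ffun 'I_n -> 'I_B * 'I_B} | wact Z w == Z)
    (margins al be (content Z))%:R : rat).
  apply: eq_bigr => w _; rewrite (psump_words w ba) (psump_words w bb) mulr_suml.
  under eq_bigr do rewrite mulr_sumr.
  rewrite pair_big /= (reindex pr) /=; last first.
    exists (fun u : {ffun 'I_n -> 'I_B} * {ffun 'I_n -> 'I_B} =>
              [ffun k => (u.1 k, u.2 k)]) => [Z _|[z z'] _].
      by apply/ffunP => k; rewrite !ffunE; case: (Z k).
    by congr (_, _); apply/ffunP => k; rewrite !ffunE.
  apply: eq_big => [Z|Z _].
    apply/andP/eqP => [[/eqP e1 /eqP e2]|e].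
      apply/ffunP => k; have := congr1 (fun z : {ffun _ -> _} => z k) e1.
      have := congr1 (fun z : {ffun _ -> _} => z k) e2; rewrite !ffunE.
      by case: (Z k) => a c; case: (Z (w k)) => a' c' /= -> ->.
    by split; apply/eqP/ffunP => k; have := congr1 (fun z : {ffun _ -> _} => z k) e; rewrite !ffunE => ->.
  rewrite -natrM mulnb !cmwt_eq // /margins; congr ((_ && _)%:R);
    by apply: eq_forallb => i; rewrite -?m1 -?m2.
rewrite (burnside (fun c => (margins al be c)%:R : rat)) -[_ *+ n`!]mulr_natl; congr (_ * _).
rewrite -sum1_card natr_sum [RHS](eq_bigl (margins al be)) => [|c]; last by rewrite inE.
rewrite [RHS]big_mkcond [LHS]big_mkcond; apply: eq_bigr => c _.
case: (boolP (margins al be c)) => h; rewrite ?if_same // (_ : (_ == n) = true) //.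
apply/eqP; case/andP: h => /forallP h _; rewrite -[RHS]da (mdeg_bound ba).
rewrite -[RHS](eq_bigr _ (fun i _ => eqP (h i))) pair_big.
by apply: eq_bigr => -[].
Qed.

Lemma hgr_below d : (d <= n)%N ->
  below B (hgr d) (\sum_(c : {ffun 'I_B -> 'I_n.+1})
    (\sum_i c i == d)%N%:R *: mX (cmof (fun j => c j : nat))).
Proof.
move=> dn m b; rewrite mseries_sumE /hgr.
have cE (c : {ffun 'I_B -> 'I_n.+1}) :
   (m == cmof (fun j => c j : nat)) = [forall i : 'I_B, m i == c i].
  rewrite (cmbound_eq b (@cmof_bound _ _)).
  by apply: eq_forallb => i; rewrite cmofE.
under eq_bigr do rewrite mseriesZE /mX cE -natrM mulnb.
have [e|ne] := eqVneq; last first.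
  rewrite big1 // => c _; case: eqP => //= sc; case: forallP => // h.
  by case/eqP: ne; rewrite (mdeg_bound b) -sc; apply: eq_bigr => i _; apply/eqP.
have mi (i : 'I_B) : (m i < n.+1)%N.
  by rewrite ltnS (leq_trans _ dn) // -e (mdeg_bound b) (bigD1 i) //= leq_addr.
rewrite (bigD1 [ffun i : 'I_B => inord (m i)]) //= [X in _ + X]big1 ?addr0 => [|c ne].
  rewrite (eq_bigr (fun i : 'I_B => m i)) => [|i _]; last by rewrite ffunE inordK.
  rewrite -(mdeg_bound b) e eqxx.
  by rewrite (_ : [forall i, _] = true) //; apply/forallP => i; rewrite ffunE inordK.
case: forallP => [h|]; last by rewrite andbF.
by case/eqP: ne; apply/ffunP => i; apply: ord_inj; rewrite ffunE inordK // (eqP (h i)).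
Qed.

Lemma hgr_cauchy al be : cmbound B al -> cmbound B be -> mdeg be = n ->
  (\prod_(j < B) hgr (be j)) al = #|[set c | margins al be c]|%:R.
Proof.
move=> ba bb db.
have bn (j : 'I_B) : (be j <= n)%N by rewrite -db (mdeg_bound bb) (bigD1 j) //= leq_addr.
rewrite (below_prod (F' := fun j : 'I_B => _) _ (fun j => hgr_below (bn j)) ba).
rewrite bigA_distr_bigA mseries_sumE /=.
rewrite (reindex (fun c : {ffun 'I_B * 'I_B -> 'I_n.+1} =>
   [ffun j => [ffun i => c (i, j)]])) /=; last first.
  exists (fun f : {ffun 'I_B -> {ffun 'I_B -> 'I_n.+1}} => [ffun p => f p.2 p.1]) => [c _|f _].
    by apply/ffunP => -[i j]; rewrite !ffunE.
  by apply/ffunP => j; apply/ffunP => i; rewrite !ffunE.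
rewrite -sum1_card natr_sum [RHS](eq_bigl (margins al be)) => [|c]; last by rewrite inE.
rewrite [RHS]big_mkcond; apply: eq_bigr => c _.
rewrite scaler_prod mseriesZE mX_prod /mX /margins andbC.
rewrite (_ : \prod_(j < B) _ = [forall j : 'I_B, (\sum_i c (i, j) == be j)%N]%:R); last first.
  case: forallP => [h|h].
    apply: big1 => j _; rewrite (eq_bigr (fun i : 'I_B => c (i, j) : nat)) ?(eqP (h j)) ?eqxx // => i _.
    by rewrite !ffunE.
  have [j hj] : exists j : 'I_B, ((\sum_i c (i, j))%N != be j).
    by apply: contrapT => nh; apply: h => j; apply: contrapT => /negP hj; apply: nh; exists j.
  rewrite (bigD1 j) //= (eq_bigr (fun i : 'I_B => c (i, j) : nat)) => [|i _]; last by rewrite !ffunE.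
  by rewrite (negPf hj) mul0r.
case: (boolP [forall j, _]) => _; rewrite ?mul0r // mul1r /=.
rewrite (_ : (al == _) = [forall i : 'I_B, (\sum_j c (i, j))%N == al i]); first by case: ifP.
rewrite (cmbound_eq ba); last by move=> i Bi; rewrite cm_prodE big1 // => j _; rewrite cmof_bound.
apply: eq_forallb => i; rewrite cm_prodE eq_sym; congr (_ == _).
by apply: eq_bigr => j _; rewrite cmofE !ffunE.
Qed.

End Cauchy.

Lemma schur_empty : schur empty_part = 1.
Proof.
apply: funext => m; rewrite mseries1E; have [->|ne] := eqVneq m mone.
  by rewrite (@schur_kostka _ _ 0) // => i _; rewrite cm1.
rewrite schur_homog0 // /= ; apply: contraNneq ne => d0; apply/eqP/cm_eq => i.
by have [N b] := cmbound_exists m; move/eqP: d0; rewrite mdeg_eq0 => /eqP ->.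
Qed.

Lemma prod_hgr (al : seq nat) :
  \prod_(d <- al) hgr d = \sum_(lam <- ptn (sumn al)) (kostka lam al)%:R *: schur lam.
Proof.
elim: al => [|a al IH].
  rewrite big_nil (bigD1_seq empty_part) ?ptn_uniq ?mem_ptn //= schur_empty scale1r big1 ?addr0 //.
  by move=> lam /negPf ->; rewrite scale0r.
rewrite big_cons IH mulr_sumr.
rewrite (eq_big_seq (fun mu : intpart => \sum_(lam <- ptn (a + sumn al)%N | hstrip lam mu) (kostka mu al)%:R *: schur lam)).
  under eq_bigr do rewrite big_mkcond.
  rewrite exchange_big; apply: eq_big_seq => lam; rewrite mem_ptn => /eqP e /=.
  rewrite natr_sum scaler_suml [RHS]big_mkcond; apply: eq_bigr => mu _.
  by rewrite e eqxx andbT.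
move=> mu; rewrite mem_ptn => /eqP e.
by rewrite -scalerAr pieri_gr e scaler_sumr.
Qed.

Section Frobenius.
Variable n : nat.
Implicit Types (al be : cmonom nat) (lam mu : intpart).

Definition frob lam al : rat := \sum_(w : 'S_n) specht_idem lam w * psump (cyc w) al.

Lemma cauchy al be : mdeg al = n -> mdeg be = n ->
  \sum_(lam <- ptn n) schur lam al * schur lam be =
  (n`!)%:R^-1 * \sum_(w : 'S_n) psump (cyc w) al * psump (cyc w) be.
Proof.
move=> da db; have [N bN] := cmbound_exists al; have [N' bN'] := cmbound_exists be.
pose B := maxn N N'.
have ba : cmbound B al by apply: cmboundW bN; exact: leq_maxl.
have bb : cmbound B be by apply: cmboundW bN'; exact: leq_maxr.
rewrite (psump_cauchy ba bb da) mulKf; last by rewrite pnatr_eq0 -lt0n fact_gt0.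
rewrite -(hgr_cauchy ba bb db).
have -> : \prod_(j < B) hgr (be j) = \prod_(d <- exps be B) hgr d.
  rewrite /exps big_map (perm_big (iota 0 B)) ?perm_rev //=.
  by rewrite -[X in iota 0 X]subn0 -/(index_iota 0 B) big_mkord.
rewrite prod_hgr mseries_sumE (sumn_exps bb) db; apply: eq_bigr => lam _.
by rewrite mseriesZE (schur_kostka lam bb) mulrC.
Qed.

Lemma sum_idem_cyc lam (F : intpart -> rat) :
  \sum_(w : 'S_n) specht_idem lam w * F (cyc w) =
  \sum_(rho <- ptn n) idem_at n lam rho * F rho.
Proof.
rewrite sum_cyc; apply: eq_bigr => rho _; rewrite mulr_suml.
by apply: eq_bigr => w /eqP <-.
Qed.

Lemma sum_chi_cyc lam (F : intpart -> rat) :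
  \sum_(w : 'S_n) specht_idem lam w * F (cyc w) =
  (n`!)%:R^-1 * \sum_(w : 'S_n) chi lam w * F (cyc w).
Proof.
rewrite sum_idem_cyc sum_cyc mulr_sumr; apply: eq_bigr => rho _.
rewrite (eq_bigr (fun=> chi_at n lam rho * F rho)); last by move=> w /eqP <-; rewrite chi_atE.
rewrite sumr_const (_ : #|_| = cyc_count n rho); last by rewrite /cyc_count cardsE.
rewrite -[_ *+ cyc_count n rho]mulr_natl [_%:R * (_ * _)]mulrA -idem_at_chi !mulrA mulVf ?mul1r //.
by rewrite pnatr_eq0 -lt0n fact_gt0.
Qed.

Lemma psump_frob w al : psump (cyc w) al = \sum_(lam <- ptn n) frob lam al * chi (n := n) lam w.
Proof.
rewrite (@class_fun_expand n rat (fun w => psump (cyc w) al)); last by move=> g h ->.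
have ratrE (x : rat) : ratr x = x by rewrite /ratr divq_num_den.
apply: eq_bigr => lam _; rewrite ratrE; congr (_ * _).
by apply: eq_bigr => h _; rewrite ratrE.
Qed.

Lemma frob_cauchy al be : 
  \sum_(lam <- ptn n) frob lam al * frob lam be =
  (n`!)%:R^-1 * \sum_(w : 'S_n) psump (cyc w) al * psump (cyc w) be.
Proof.
under [X in _ * X]eq_bigr do rewrite psump_frob mulr_suml.
rewrite exchange_big mulr_sumr; apply: eq_bigr => lam _ /=.
rewrite /frob (sum_chi_cyc lam (fun rho => psump rho be)) mulrCA mulr_sumr; congr (_ * _).
by apply: eq_bigr => w _; rewrite mulrA.
Qed.

Definition shape_cm (s : seq nat) : cmonom nat := cmfun (size s) (nth 0%N s).

Lemma shape_cm_bound s : cmbound (size s) (shape_cm s). Proof. exact: cmfun_bound. Qed.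

Lemma mdeg_shape_cm s : mdeg (shape_cm s) = sumn s.
Proof.
rewrite (mdeg_bound (@shape_cm_bound s)) (@sumn_nth s (size s)) //.
by apply: eq_bigr => i _; rewrite cmfunE ltn_ord.
Qed.

Lemma colsum_exps s c : colsum (exps (shape_cm s) (size s)) c = colsum s c.
Proof.
rewrite /colsum /exps big_map (perm_big (iota 0 (size s))) ?perm_rev //=.
rewrite -[X in iota 0 X]subn0 -/(index_iota 0 (size s)) [RHS](big_nth 0%N).
by apply: eq_big_nat => i /andP[_ il]; rewrite cmfunE il.
Qed.

Lemma schur_shape0 lam mu : ~ colsum_le lam mu -> schur lam (shape_cm mu) = 0.
Proof.
move=> h; rewrite (schur_kostka _ (@shape_cm_bound mu)); apply/eqP; rewrite pnatr_eq0.
apply/eqP; apply: contrapT => /eqP /kostka_colsum_le k; apply: h => c.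
by rewrite -(colsum_exps mu); apply: k.
Qed.

Lemma psump_shape mu w : sumn mu = n ->
  psump (cyc w) (shape_cm mu) *+ #|row_group n mu| =
  \sum_(z : 'S_n) ((z^-1 * w * z)%g \in row_group n mu)%:R.
Proof.
move=> mn; have lt (k : 'I_n) : (box_row mu k < size mu)%N by apply: box_row_lt; rewrite mn.
pose z0 : {ffun 'I_n -> 'I_(size mu)} := [ffun k => Ordinal (lt k)].
have st g : (wact z0 g == z0) = (g^-1%g \in row_group n mu).
  rewrite row_groupV; apply/eqP/mem_row_group => [e k|e].
    by have := congr1 (fun z : {ffun _ -> _} => nat_of_ord (z k)) e; rewrite !ffunE.
  by apply/ffunP => k; apply: ord_inj; rewrite !ffunE /= e.
have z0c z : (cmwt z == shape_cm mu) = (content z == content z0).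
  rewrite (cmwt_eq _ (@shape_cm_bound mu)).
  have cE (i : 'I_(size mu)) : shape_cm mu i = content z0 i.
    rewrite cmfunE ltn_ord contentE -(row_card mn); apply: eq_card => k.
    by rewrite !inE ffunE -val_eqE.
  apply/forallP/eqP => [h|-> i]; last by rewrite cE.
  by apply/ffunP => i; apply: ord_inj; rewrite -cE; apply/eqP/h.
rewrite (psump_words w (@shape_cm_bound mu)).
under eq_bigr do rewrite z0c.
have -> : #|row_group n mu| = #|[set g | wact z0 g == z0]|.
  rewrite -(card_imset _ (@invg_inj _)); apply: eq_card => g; rewrite !inE st.
  apply/imsetP/idP => [[h hr ->]|h]; first by rewrite invgK.
  by exists g^-1%g; rewrite ?invgK.
transitivity ((\sum_(z | content z == content z0) ((wact z w == z)%:R : rat)) *+ #|[set g | wact z0 g == z0]|).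
  congr (_ *+ _); rewrite big_mkcond [RHS]big_mkcond; apply: eq_bigr => z _.
  by case: (wact z w == z); case: (content z == _).
rewrite -(sum_wact z0 (fun z => (wact z w == z)%:R)); apply: eq_bigr => z _.
rewrite wactM (_ : _ == _ = ((z^-1 * w * z)%g \in row_group n mu)) //.
rewrite -[RHS]row_groupV -st -mulgA -[in RHS]wactM.
apply/eqP/eqP => [->|e]; first by rewrite wactM mulVg; apply/ffunP => k; rewrite ffunE perm1.
by rewrite -[in RHS]e wactM mulgV; apply/ffunP => k; rewrite [in RHS]ffunE perm1.
Qed.

Lemma frob_shape lam mu : sumn lam = n -> sumn mu = n ->
  frob lam (shape_cm mu) *+ #|row_group n mu| =
  gtrace (rowsum mu : galg 'S_n) (specht_idem lam).
Proof.
move=> ln mn; rewrite gtraceC gtraceE exchange_big /= /frob -sumrMnl.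
apply: eq_bigr => w _; rewrite -mulrnAr psump_shape // mulr_sumr.
apply: eq_bigr => z _.
by rewrite /rowsum -[in RHS]row_groupV !invMg !invgK mulgA.
Qed.

Lemma row_group_gt0 mu : (0 < #|row_group n mu|)%N.
Proof. by apply/card_gt0P; exists 1%g; apply/mem_row_group => k; rewrite perm1. Qed.

Lemma frob_shape1 lam : sumn lam = n -> frob lam (shape_cm lam) = 1.
Proof.
move=> ln; have := frob_shape ln ln; rewrite gtrace_rowsum //.
have nz : #|row_group n lam|%:R != 0 :> rat by rewrite pnatr_eq0 -lt0n row_group_gt0.
by move=> e; apply: (mulIf nz); rewrite mul1r mulr_natr.
Qed.

Lemma frob_shape0 lam mu : sumn lam = n -> sumn mu = n -> ~ colsum_le lam mu ->
  frob lam (shape_cm mu) = 0.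
Proof.
move=> ln mn h; have := frob_shape ln mn; rewrite gtrace_rowsum0 // => /eqP.
by rewrite mulrn_eq0 (gtn_eqF (row_group_gt0 mu)) /= => /eqP.
Qed.

(* Both families are upper unitriangular square roots of the same Gram matrix. *)
Lemma schur_frob_shape lam : sumn lam = n ->
  (forall be, mdeg be = n -> frob lam be = schur lam be) /\
  schur lam (shape_cm lam) = 1.
Proof.
have [r] := ubnP (colsum_rank lam); elim: r lam => // r IH lam; rewrite ltnS => lr ln.
have gram be : mdeg be = n ->
    frob lam be = schur lam (shape_cm lam) * schur lam be.
  move=> db; have dl : mdeg (shape_cm lam) = n by rewrite mdeg_shape_cm.
  have := cauchy dl db; rewrite -frob_cauchy.
  have lm : lam \in ptn n by rewrite mem_ptn ln.
  rewrite !(bigD1_seq lam lm) ?ptn_uniq //= frob_shape1 // mul1r.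
  set S := (X in _ + X = _ -> _); set S' := (X in _ = _ + X -> _).
  suff -> : S = S' by move/addIr => <-.
  rewrite {}/S {}/S' [LHS]big_seq_cond [RHS]big_seq_cond.
  apply: eq_bigr => mu /andP[]; rewrite mem_ptn => /eqP mn ne.
  have [le|nle] := pselect (colsum_le mu lam); last first.
    by rewrite schur_shape0 // frob_shape0 // !mul0r.
  have [|lt] := colsum_le_rank (etrans mn (esym ln)) le; first by move/eqP: ne.
  by have [e _] := IH mu (leq_trans lt lr) mn; rewrite !e.
suff s1 : schur lam (shape_cm lam) = 1.
  by split=> // be db; rewrite gram // s1 mul1r.
have := gram (shape_cm lam); rewrite mdeg_shape_cm => /(_ ln).
rewrite frob_shape1 // (schur_kostka _ (@shape_cm_bound lam)) -natrM => /eqP.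
by rewrite eq_sym pnatr_eq1 muln_eq1 => /andP[/eqP -> _].
Qed.

Lemma schur_shape1 lam : sumn lam = n -> schur lam (shape_cm lam) = 1.
Proof. by case/schur_frob_shape. Qed.

Lemma psum_homog k al : (0 < k)%N -> psum k al != 0 -> mdeg al = k.
Proof.
move=> k0; have [N b] := cmbound_exists al; rewrite (psumE k0 b) => nz.
have [i hi] : exists i : 'I_N, mX (expcmn (ucm (i : nat)) k) al != 0.
  apply: contrapT => h; case/eqP: nz; apply: big1 => i _; apply/eqP.
  by apply: contrapT => /negP hi; apply: h; exists i.
move: hi; rewrite /mX; case: (al =P _) => [-> _|]; last by rewrite eqxx.
by rewrite mdeg_exp mdegU muln1.
Qed.

Lemma psump_homog (s : seq nat) al : all (fun k => 0 < k)%N s ->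
  psump s al != 0 -> mdeg al = sumn s.
Proof.
rewrite /psump; elim: s al => [|k s IH] al /=.
  by rewrite big_nil mseries1E => _; case: (al =P _) => [->|]; rewrite ?mdeg1 ?eqxx.
move=> /andP[k0 sg]; rewrite big_cons mseriesME => nz.
have [a aD] : exists2 a, a \in cm_divisors al &
    psum k a * (\prod_(k <- s) psum k) (divcm al a) != 0.
  apply: contrapT => h; case/eqP: nz; rewrite big_seq big1 // => a aD; apply/eqP.
  by apply: contrapT => /negP hi; apply: h; exists a.
rewrite mulf_eq0 negb_or => /andP[/(psum_homog k0) da /(IH _ sg) db].
by rewrite -(divcmK aD) mdegM da db.
Qed.

Lemma psump_homog0 (rho : intpart) al : mdeg al != sumn rho -> psump rho al = 0.
Proof.
move=> ne; apply/eqP; apply: contraNT ne => nz; apply/eqP; apply: psump_homog nz.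
by apply/allP => k; exact: intpart_gt0.
Qed.

Lemma schur_frob lam : sumn lam = n -> frob lam = schur lam.
Proof.
move=> ln; apply: funext => be; have [db|ne] := eqVneq (mdeg be) n.
  by have [-> //] := schur_frob_shape ln.
rewrite schur_homog0 ?ln // /frob big1 // => w _.
by rewrite psump_homog0 ?sumn_cyc ?mulr0.
Qed.

Lemma schur_psump lam : sumn lam = n ->
  schur lam = \sum_(rho <- ptn n) idem_at n lam rho *: psump rho.
Proof.
move=> ln; rewrite -schur_frob //; apply: funext => al; rewrite mseries_sumE /frob.
by rewrite (sum_idem_cyc lam (fun rho => psump rho al)).
Qed.

Lemma psump_schur (rho : intpart) : sumn rho = n ->
  psump rho = \sum_(lam <- ptn n) chi_at n lam rho *: schur lam.
Proof.
move=> rn; have rm : rho \in ptn n by rewrite mem_ptn rn.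
have [w <-] := cyc_surj rm; apply: funext => al; rewrite mseries_sumE psump_frob.
apply: eq_big_seq => lam; rewrite mem_ptn => /eqP ln.
by rewrite schur_frob // mseriesZE chi_atE mulrC.
Qed.

(* By unitriangularity of the Kostka matrix. *)
Lemma schur_free (c : intpart -> rat) :
  (forall al, mdeg al = n -> \sum_(lam <- ptn n) c lam * schur lam al = 0) ->
  {in ptn n, forall lam, c lam = 0}.
Proof.
move=> h lam; rewrite mem_ptn => /eqP ln.
have [r] := ubnP (colsum_rank lam); elim: r lam ln => // r IH lam ln; rewrite ltnS => lr.
have := h (shape_cm lam); rewrite mdeg_shape_cm => /(_ ln).
rewrite (bigD1_seq lam) ?ptn_uniq ?mem_ptn ?ln //= schur_shape1 // mulr1.
rewrite big_seq_cond big1 ?addr0 // => mu /andP[]; rewrite mem_ptn => /eqP mn ne.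
have [le|nle] := pselect (colsum_le mu lam); last by rewrite schur_shape0 ?mulr0.
have [|lt] := colsum_le_rank (etrans mn (esym ln)) le; first by move/eqP: ne.
by rewrite IH ?mul0r // (leq_trans lt lr).
Qed.

Lemma psump_free (c : intpart -> rat) :
  (forall al, mdeg al = n -> \sum_(rho <- ptn n) c rho * psump rho al = 0) ->
  {in ptn n, forall rho, c rho = 0}.
Proof.
move=> h rho rn.
have k0 : {in ptn n, forall lam, \sum_(rho <- ptn n) c rho * chi_at n lam rho = 0}.
  apply: schur_free => al da; rewrite -[RHS](h al da).
  under eq_bigr do rewrite mulr_suml.
  rewrite exchange_big; apply: eq_big_seq => si; rewrite mem_ptn => /eqP sn /=.
  rewrite (psump_schur sn) mseries_sumE mulr_sumr; apply: eq_bigr => lam _.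
  by rewrite mseriesZE mulrA.
transitivity (\sum_(lam <- ptn n) (\sum_(si <- ptn n) c si * chi_at n lam si) * idem_at n lam rho).
  under eq_bigr do rewrite mulr_suml.
  rewrite exchange_big /= (eq_big_seq (fun si => c si * (rho == si)%:R)); last first.
    move=> si sn; rewrite -(@idem_at_orth n) // mulr_sumr; apply: eq_bigr => lam _.
    by rewrite -mulrA [chi_at _ _ _ * _]mulrC.
  rewrite (bigD1_seq rho) ?ptn_uniq //= eqxx mulr1 big1 ?addr0 // => si.
  by rewrite eq_sym => /negPf ->; rewrite mulr0.
by rewrite big_seq big1 // => lam ln; rewrite k0 // mul0r.
Qed.

End Frobenius.

(** * Power sums as variables *)

Lemma big_finsupp (R : Type) (idx : R) (op : Monoid.com_law idx) (m : cmonom nat) N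
    (F : nat -> R) : cmbound N m -> (forall i, m i = 0%N -> F i = idx) ->
  \big[op/idx]_(i <- finsupp m) F i = \big[op/idx]_(i < N) F i.
Proof.
move=> b F0; rewrite -(big_mkord xpredT) /index_iota subn0.
rewrite -(@big_rmcond _ _ op _ (iota 0 N) (fun i => i \in finsupp m)); last first.
  by move=> i; rewrite -cmE_neq0 negbK => /eqP /F0.
rewrite -[RHS]big_filter; apply: perm_big; apply: uniq_perm.
- exact: fset_uniq.
- exact/filter_uniq/iota_uniq.
move=> i; rewrite mem_filter mem_iota /= add0n andbC.
by case: (ltnP i N) => //= /b /eqP; rewrite cmE_eq0 => /negPf.
Qed.

Section PowerSumMonomials.
Implicit Types (m a b : cmonom nat) (F G H : mseries) (rho si : intpart).

(* The variable of index d stands for p_d; the variable of index 0 is unused. *)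
Definition mono (s : seq nat) : cmonom nat := \big[mmul/mone]_(k <- s) ucm k.

Lemma mono_cons k s : mono (k :: s) = mmul (ucm k) (mono s).
Proof. by rewrite /mono big_cons. Qed.

Lemma mono_cat s t : mono (s ++ t) = mmul (mono s) (mono t).
Proof. by rewrite /mono big_cat. Qed.

Lemma monoE s i : mono s i = count_mem i s.
Proof.
rewrite cm_prodE -sum1_count [RHS]big_mkcond; apply: eq_bigr => k _.
by rewrite ucmE /=; case: eqP.
Qed.

Lemma mono0 rho : mono rho 0%N = 0%N.
Proof. by rewrite monoE; apply/count_memPn; case: rho => s /= /andP[]. Qed.

Lemma mono_part_inj rho si : mono rho = mono si -> rho = si.
Proof.
move=> e; apply: val_inj; apply: (sorted_eq geq_trans).
- by move=> i j /andP[/= h1 h2]; apply/eqP; rewrite eqn_leq h1 h2.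
- exact: intpart_sorted.
- exact: intpart_sorted.
apply/allP => i _ /=; rewrite -!monoE; apply/eqP.
by have := congr1 (fun m : cmonom nat => m i) e.
Qed.

Definition wdeg m := (\sum_(i <- finsupp m) i * m i)%N.

Lemma wdegE N m : cmbound N m -> wdeg m = (\sum_(i < N) i * m i)%N.
Proof. by move=> b; apply: big_finsupp => // i ->; rewrite muln0. Qed.

Lemma wdegM m a : wdeg (mmul m a) = (wdeg m + wdeg a)%N.
Proof.
have [N1 b1] := cmbound_exists m; have [N2 b2] := cmbound_exists a.
pose N := maxn N1 N2.
have bm : cmbound N m by apply: cmboundW b1; rewrite leq_maxl.
have ba : cmbound N a by apply: cmboundW b2; rewrite leq_maxr.
rewrite (wdegE bm) (wdegE ba) (@wdegE N); last by move=> i Ni; rewrite cmM bm // ba.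
by rewrite -big_split; apply: eq_bigr => i _; rewrite cmM mulnDr.
Qed.

Lemma wdeg1 : wdeg mone = 0%N.
Proof. by rewrite (@wdegE 0) ?big_ord0 // => i _; rewrite cm1. Qed.

Lemma wdegU k : wdeg (ucm k) = k.
Proof.
rewrite (@wdegE k.+1); last by move=> i ki; rewrite ucmE; case: eqP ki => // ->; rewrite ltnn.
rewrite (bigD1 ord_max) //= ucmE eqxx muln1 big1 ?addn0 // => i ne.
rewrite ucmE; case: eqP => [e|]; last by rewrite muln0.
by case/eqP: ne; apply: ord_inj; rewrite -e.
Qed.

Lemma wdeg_mono s : wdeg (mono s) = sumn s.
Proof.
by elim: s => [|k s IH]; rewrite ?mono_cons ?wdegM ?wdegU ?IH // /mono big_nil wdeg1.
Qed.

Lemma mono_surj m : m 0%N = 0%N -> exists rho, mono rho = m.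
Proof.
move=> m0; pose s := flatten [seq nseq (m i) i | i <- finsupp m].
have s0 : 0%N \notin s.
  apply/negP => /flattenP[_ /mapP[i _ ->]]; rewrite mem_nseq => /andP[mi /eqP i0].
  by rewrite -i0 m0 in mi.
have ss : all (fun k => 0 < k)%N (sort geq s).
  by apply/allP => k; rewrite mem_sort lt0n => ks; apply: contraNneq s0 => <-.
exists (to_intpart (sort geq s)); apply: cm_eq => i; rewrite monoE.
rewrite to_intpartE; last by apply: sort_sorted => x y; exact: leq_total.
rewrite (all_filterP ss) count_sort count_flatten -map_comp sumnE big_map.
have [mi|mi] := boolP (i \in finsupp m).
  rewrite (bigD1_seq i) ?fset_uniq //= count_nseq /= eqxx mul1n big1 ?addn0 // => j ji.
  by rewrite count_nseq /= (negPf ji).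
move: (mi); rewrite -cmE_neq0 negbK => /eqP ->; rewrite big_seq big1 // => j jm.
rewrite /= count_nseq /=; case: eqP => // ji; by rewrite -ji jm in mi.
Qed.

Definition mons n : seq (cmonom nat) := [seq mono rho | rho <- ptnle n].

Lemma mons_uniq n : uniq (mons n).
Proof. by rewrite map_inj_uniq ?ptnle_uniq //; exact: mono_part_inj. Qed.

Lemma mem_mons n m : (m \in mons n) = (m 0%N == 0%N) && (wdeg m <= n)%N.
Proof.
apply/mapP/andP => [[rho rn ->]|[/eqP m0 wm]].
  by rewrite mono0 eqxx wdeg_mono -mem_ptnle.
by have [rho e] := mono_surj m0; exists rho; rewrite // mem_ptnle -wdeg_mono e.
Qed.

Lemma sum_mons (V : nmodType) n (F : cmonom nat -> V) :
  \sum_(m <- mons n) F m = \sum_(rho <- ptnle n) F (mono rho).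
Proof. by rewrite big_map. Qed.

Lemma sum_mons_shift (V : nmodType) n d (F : cmonom nat -> V) : (0 < d <= n)%N ->
  \sum_(m <- mons n | ucm d \in cm_divisors m) F m =
  \sum_(m <- mons (n - d)) F (mmul (ucm d) m).
Proof.
move=> /andP[d0 dn]; rewrite -big_filter -(big_map (mmul (ucm d)) xpredT).
apply: perm_big; apply: uniq_perm.
- exact/filter_uniq/mons_uniq.
- by rewrite map_inj_uniq ?mons_uniq //; exact: mmulI.
have u0 : (ucm d : cmonom nat) 0%N = 0%N by rewrite ucmE; case: d d0 {dn}.
move=> m; rewrite mem_filter; apply/andP/mapP => [[dm]|[a]].
  rewrite -(divcmK dm) mem_mons cmM u0 wdegM wdegU => /andP[m0 wm].
  exists (divcm m (ucm d)) => //; rewrite mem_mons; apply/andP; split => //.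
  by lia.
rewrite mem_mons => /andP[/eqP a0 wa] ->; split; first exact: cm_divisorsMl (erefl _).
by rewrite mem_mons cmM u0 a0 wdegM wdegU; apply/andP; split => //; lia.
Qed.

Definition ev F : mseries := fun al =>
  \sum_(rho <- ptn (mdeg al)) F (mono rho) * psump rho al.

Lemma ev_ptnle n F al : (mdeg al <= n)%N ->
  ev F al = \sum_(rho <- ptnle n) F (mono rho) * psump rho al.
Proof.
move=> an; rewrite /ev -(sum_ptnle _ an) big_mkcond; apply: eq_bigr => rho _.
by case: eqP => // /eqP ne; rewrite psump_homog0 ?mulr0 // eq_sym.
Qed.

Lemma psump_mono rho s : mono s = mono rho -> psump rho = psump s.
Proof.
move=> e; apply: perm_big; apply/allP => i _ /=; rewrite -!monoE.
by have := congr1 (fun m : cmonom nat => m i) e => ->.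
Qed.

Lemma evM F G : ev (F * G) = ev F * ev G.
Proof.
apply: funext => al; set n := mdeg al.
transitivity (\sum_(rho <- ptnle n) \sum_(si <- ptnle n)
  F (mono rho) * G (mono si) * psump (rho ++ si) al); last first.
  rewrite mseriesME; transitivity (\sum_(a <- cm_divisors al)
     \sum_(rho <- ptnle n) \sum_(si <- ptnle n) F (mono rho) * G (mono si) *
      (psump rho a * psump si (divcm al a))).
    rewrite [RHS]exchange_big /=; apply: eq_bigr => rho _; rewrite [RHS]exchange_big /=.
    apply: eq_bigr => si _; rewrite -mulr_sumr -mseriesME; congr (_ * _ al).
    by rewrite /psump big_cat.
  apply: eq_big_seq => a aD.
  have an : (mdeg a <= n)%N by rewrite /n -(divcmK aD) mdegM leq_addr.
  have bn : (mdeg (divcm al a) <= n)%N by rewrite /n -[in leqRHS](divcmK aD) mdegM leq_addl.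
  rewrite (ev_ptnle _ an) (ev_ptnle _ bn) mulr_suml; apply: eq_bigr => rho _.
  by rewrite mulr_sumr; apply: eq_bigr => si _; ring.
transitivity (\sum_(tau <- ptn n) \sum_(rho <- ptnle n) \sum_(si <- ptnle n)
   if mono tau == mmul (mono rho) (mono si) then
     F (mono rho) * G (mono si) * psump (rho ++ si) al else 0).
  apply: eq_big_seq => tau; rewrite mem_ptn => /eqP tn.
  rewrite mseriesME mulr_suml.
  transitivity (\sum_(a <- mons n | a \in cm_divisors (mono tau))
      F a * G (divcm (mono tau) a) * psump tau al).
    rewrite -[RHS]big_filter; apply: perm_big; apply: uniq_perm.
    - exact: fset_uniq.
    - exact/filter_uniq/mons_uniq.
    move=> a; rewrite mem_filter mem_mons; case: (boolP (a \in _)) => //= aD.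
    have := congr1 wdeg (divcmK aD); rewrite wdegM wdeg_mono => e.
    move/mem_cm_divisors: aD => /(_ 0%N); rewrite mono0 leqn0 => ->.
    by apply/esym; rewrite /=; lia.
  rewrite big_mkcond sum_mons; apply: eq_bigr => rho _.
  case: ifP => [rD|rD]; last first.
    rewrite big1 // => si _; case: eqP => // e.
    by rewrite (cm_divisorsMl (esym e)) in rD.
  rewrite -big_mkcond.
  have d0 : divcm (mono tau) (mono rho) 0%N = 0%N by rewrite divcmE mono0.
  have [si0 se] := mono_surj d0.
  rewrite (eq_bigl (fun si => si == si0)) => [|si].
    rewrite sum_delta ?ptnle_uniq // mem_ptnle.
    have e : mmul (mono rho) (mono si0) = mono tau by rewrite se divcmK.
    have := congr1 wdeg e; rewrite wdegM !wdeg_mono tn => sn.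
    rewrite (_ : (_ <= _)%N = true); last by lia.
    by rewrite se (@psump_mono tau (rho ++ si0)) // mono_cat.
  rewrite -{1}(divcmK rD) (inj_eq (@mmulI _)) -se eq_sym; apply/eqP/eqP => [|-> //].
  exact: mono_part_inj.
rewrite exchange_big; apply: eq_bigr => rho _; rewrite exchange_big; apply: eq_bigr => si _ /=.
have s0 : mmul (mono rho) (mono si) 0%N = 0%N by rewrite cmM !mono0.
have [tau te] := mono_surj s0; rewrite -te -big_mkcond.
rewrite (eq_bigl (fun t => t == tau)) => [|t]; last first.
  by apply/eqP/eqP => [|-> //]; exact: mono_part_inj.
rewrite sum_delta ?ptn_uniq // mem_ptn; case: eqP => // ne.
rewrite -(@psump_mono tau (rho ++ si)) ?mono_cat // psump_homog0 ?mulr0 //.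
by rewrite -/n eq_sym; apply/eqP.
Qed.

Lemma evD F G : ev (F + G) = ev F + ev G.
Proof.
apply: funext => al; rewrite mseriesDE -big_split; apply: eq_bigr => rho _.
by rewrite mseriesDE mulrDl.
Qed.

Lemma evZ (c : rat) F : ev (c *: F) = c *: ev F.
Proof.
apply: funext => al; rewrite mseriesZE mulr_sumr; apply: eq_bigr => rho _.
by rewrite mulrA.
Qed.

Lemma ev_mono rho : ev (mX (mono rho)) = psump rho.
Proof.
apply: funext => al; rewrite /ev.
rewrite (eq_bigr (fun si => if si == rho then psump rho al else 0)) => [|si _].
  rewrite -big_mkcond sum_delta ?ptn_uniq // mem_ptn; case: eqP => // /eqP ne.
  by rewrite psump_homog0 // eq_sym.
rewrite /mX (_ : (mono si == mono rho) = (si == rho)); last first.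
  by apply/eqP/eqP => [|-> //]; exact: mono_part_inj.
by case: eqP => [->|]; rewrite ?mul1r ?mul0r.
Qed.

Lemma ev1 : ev 1 = 1.
Proof.
have -> : (1 : mseries) = mX (mono empty_part) by rewrite /mono big_nil.
by rewrite ev_mono /psump /= /mono !big_nil.
Qed.

Lemma ev_sum I (r : seq I) (P : pred I) (F : I -> mseries) :
  ev (\sum_(i <- r | P i) F i) = \sum_(i <- r | P i) ev (F i).
Proof.
apply: (big_morph ev evD); apply: funext => al.
by rewrite /ev big1 // => rho _; rewrite mul0r.
Qed.

Lemma ev_prod I (r : seq I) (P : pred I) (F : I -> mseries) :
  ev (\prod_(i <- r | P i) F i) = \prod_(i <- r | P i) ev (F i).
Proof. exact: (big_morph ev evM ev1). Qed.

Definition pvar d : mseries := mX (ucm d).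

Lemma ev_pvar d : (0 < d)%N -> ev (pvar d) = psum d.
Proof.
move=> d0; have ds : sorted geq [:: d] by [].
have e : parts (to_intpart [:: d]) = [:: d] by rewrite to_intpartE //= d0.
have -> : pvar d = mX (mono (to_intpart [:: d])).
  by rewrite e mono_cons /mono big_nil mulm1.
by rewrite ev_mono e /psump big_seq1.
Qed.

End PowerSumMonomials.

Section Newton.
Implicit Types (m a b : cmonom nat) (F G H : mseries) (rho si ka : intpart).

Definition zof m : rat := \prod_(i <- finsupp m) (i ^ m i * (m i)`!)%:R.

Lemma zofE N m : cmbound N m -> zof m = \prod_(i < N) (i ^ m i * (m i)`!)%:R.
Proof. by move=> b; apply: big_finsupp => // i ->. Qed.

Lemma zof_shift d m : zof (mmul (ucm d) m) = (d * (m d).+1)%:R * zof m.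
Proof.
have [N1 b1] := cmbound_exists m; pose N := maxn N1 d.+1.
have bm : cmbound N m by apply: cmboundW b1; rewrite leq_maxl.
have dN : (d < N)%N by rewrite leq_maxr.
have bd : cmbound N (mmul (ucm d) m).
  move=> i Ni; rewrite cmM ucmE bm // addn0; case: eqP => // e.
  by rewrite -e leqNgt dN in Ni.
rewrite (zofE bm) (zofE bd) (bigD1 (Ordinal dN)) //= [in RHS](bigD1 (Ordinal dN)) //= mulrA.
congr (_ * _); first by rewrite cmM ucmE eqxx add1n expnS factS -natrM mulnACA.
apply: eq_bigr => i ne; rewrite cmM ucmE; case: eqP => // e.
by case/eqP: ne; apply: ord_inj; rewrite -e.
Qed.

Lemma zof_gt0 rho : 0 < zof (mono rho).
Proof.
apply: prodr_gt0 => i; rewrite ltr0n muln_gt0 fact_gt0 andbT expn_gt0.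
by case: i => [|i]; rewrite ?mono0 ?eqxx ?orbT.
Qed.

(* 1 + h_1 + h_2 + ..., since h_n is the sum of p_rho / z_rho over |rho| = n. *)
Definition Hs : mseries := fun m => (zof m)^-1.

Lemma Hs_pvar d m : (0 < d)%N -> (d * m d)%:R * Hs m = (pvar d * Hs) m.
Proof.
move=> d0; have [dm|dm] := boolP (ucm d \in cm_divisors m).
  rewrite -(divcmK dm) mXME cmM ucmE eqxx add1n /Hs zof_shift invfM mulrA divff ?mul1r //.
  by rewrite pnatr_eq0 muln_eq0 negb_or -lt0n d0.
rewrite mXME0 // (_ : m d = 0%N) ?muln0 ?mul0r //; apply/eqP; rewrite -leqn0 leqNgt.
apply: contra dm => md; apply/mem_cm_divisors => i; rewrite ucmE.
by case: eqP => // <-.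
Qed.

Lemma psumME k G al N : (0 < k)%N -> cmbound N al ->
  (psum k * G) al = \sum_(j < N) if (k <= al j)%N
    then G (divcm al (expcmn (ucm (j : nat)) k)) else 0.
Proof.
move=> k0 b; rewrite (below_mul (psum_below k0) (fun m _ => erefl) b) mulr_suml mseries_sumE.
apply: eq_bigr => j _; rewrite mX_exp.
have dE : (expcmn (ucm (j : nat)) k \in cm_divisors al) = (k <= al j)%N.
  apply/mem_cm_divisors/idP => [/(_ (j : nat))|h i]; first by rewrite expcmnE ucmE eqxx muln1.
  by rewrite expcmnE ucmE; case: eqP => [<-|]; rewrite ?muln1 ?muln0.
case: ifP => [kj|/negP kj]; last by rewrite mXME0 // dE; apply/negP.
by rewrite -{1}(divcmK (etrans dE kj)) mXME.
Qed.

Lemma newton_ev al :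
  (mdeg al)%:R * ev Hs al = \sum_(i < mdeg al) (psum i.+1 * ev Hs) al.
Proof.
under eq_bigr do rewrite -ev_pvar // -evM.
rewrite /ev mulr_sumr exchange_big /=; apply: eq_big_seq => rho; rewrite mem_ptn => /eqP rn.
rewrite -mulr_suml mulrA; congr (_ * _).
under eq_bigr do rewrite -Hs_pvar //.
rewrite -mulr_suml -natr_sum; congr (_%:R * _).
rewrite -[LHS]rn -wdeg_mono (@wdegE (mdeg al).+1).
  by rewrite big_ord_recl mul0n add0n.
move=> i ni; rewrite monoE; apply/count_memPn; apply: contraL ni => ir.
rewrite -leqNgt -rn; have := nth_le_sumn rho (index i rho).
by rewrite nth_index.
Qed.

Lemma newton_hone al : (mdeg al)%:R = \sum_(i < mdeg al) (psum i.+1 * hone) al.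
Proof.
have [N b] := cmbound_exists al.
under eq_bigr do rewrite (psumME _ _ b) //.
rewrite exchange_big {1}(mdeg_bound b) natr_sum; apply: eq_bigr => j _ /=.
have jd : (al j <= mdeg al)%N by rewrite (mdeg_bound b) (bigD1 j) //= leq_addr.
rewrite -big_mkcond /= /hone sumr_const; congr (_%:R).
rewrite -sum1_card -(big_mkord (fun i => i < al j)%N (fun=> 1%N)) big_mkcond.
rewrite (big_cat_nat (leq0n _) jd) /= [X in (_ + X)%N]big_nat_cond [X in (_ + X)%N]big1; last first.
  by move=> i /andP[/andP[h _] _]; rewrite ltnNge h.
rewrite addn0 (eq_big_nat _ _ (F2 := fun=> 1%N)) ?sum_nat_const_nat ?subn0 ?muln1 //.
by move=> i /andP[_ ->].
Qed.

Lemma ev_Hs : ev Hs = hone.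
Proof.
apply: funext => al; have [n] := ubnP (mdeg al); elim: n al => // n IH al.
rewrite ltnS => an; have [a0|apos] := posnP (mdeg al).
  have -> : al = mone.
    apply: cm_eq => i; move/eqP: a0; rewrite mdeg_eq0 => /eqP ->; by rewrite cm1.
  rewrite /ev mdeg1 (_ : ptn 0 = [:: empty_part]).
    rewrite big_seq1 /psump /mono !big_nil mseries1E eqxx mulr1 /Hs (@zofE 0) ?big_ord0 ?invr1 //.
    by move=> i _; rewrite cm1.
  apply/perm_small_eq => //; apply: uniq_perm => //; first exact: ptn_uniq.
  by move=> ka; rewrite mem_ptn inE; apply/eqP/eqP => [/sumn_eq0|->].
have nz : (mdeg al)%:R != 0 :> rat by rewrite pnatr_eq0 -lt0n.
apply: (mulfI nz); rewrite newton_ev /hone mulr1 newton_hone; apply: eq_bigr => i _.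
have [N b] := cmbound_exists al; rewrite !(psumME _ _ b) //.
apply: eq_bigr => j _; case: ifP => // ij; apply: IH.
apply: leq_trans an; have : expcmn (ucm (j : nat)) i.+1 \in cm_divisors al.
  apply/mem_cm_divisors => k; rewrite expcmnE ucmE.
  by case: eqP => [<-|]; rewrite ?muln1 ?muln0.
by move=> /divcmK/(congr1 (@mdeg _)); rewrite mdegM mdeg_exp mdegU; lia.
Qed.

Lemma sum_psump_cyc n al : mdeg al = n -> \sum_(w : 'S_n) psump (cyc w) al = (n`!)%:R.
Proof.
move=> an; have [B b] := cmbound_exists al.
under eq_bigr do rewrite (psump_words _ b).
rewrite (burnside (fun c : {ffun 'I_B -> 'I_n.+1} => (cmof (fun j => c j : nat) == al)%:R : rat)).
rewrite -[LHS]mulr_natr -[RHS]mul1r; congr (_ * _).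
have ale (i : 'I_B) : (al i < n.+1)%N by rewrite ltnS -an (mdeg_bound b) (bigD1 i) //= leq_addr.
rewrite (bigD1 [ffun i : 'I_B => inord (al i)]) /=; last first.
  rewrite -[X in _ == X]an (mdeg_bound b); apply/eqP/eq_bigr => i _.
  by rewrite ffunE inordK.
rewrite (cmbound_eq (@cmof_bound _ _) b) (_ : [forall i, _] = true); last first.
  by apply/forallP => i; rewrite cmofE ffunE inordK.
rewrite [X in _ + X]big1 ?addr0 // => c /andP[_ ne].
rewrite (cmbound_eq (@cmof_bound _ _) b); case: forallP => // h.
case/eqP: ne; apply/ffunP => i; apply: ord_inj; rewrite ffunE inordK //.
by have /eqP := h i; rewrite cmofE.
Qed.

Lemma cyc_count_zof n rho : rho \in ptn n ->
  (cyc_count n rho)%:R / (n`!)%:R = (zof (mono rho))^-1.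
Proof.
move=> rn; apply/eqP; rewrite -subr_eq0; apply/eqP; move: rho rn.
apply: psump_free => al an.
under eq_bigr do rewrite mulrBl; rewrite sumrB; apply/eqP; rewrite subr_eq0; apply/eqP.
transitivity (ev Hs al); last by rewrite /ev an.
rewrite ev_Hs /hone.
have nz : (n`!)%:R != 0 :> rat by rewrite pnatr_eq0 -lt0n fact_gt0.
apply: (mulfI nz); rewrite mulr1 -[RHS](sum_psump_cyc an) sum_cyc mulr_sumr; apply: eq_bigr => rho _.
rewrite [RHS](eq_bigr (fun=> psump rho al)) => [|w /eqP -> //].
rewrite [RHS]sumr_const (_ : #|_| = cyc_count n rho); last by rewrite /cyc_count cardsE.
by rewrite -[RHS]mulr_natl !mulrA [_ * _%:R]mulrC mulfK.
Qed.

Lemma idem_at_zof n lam rho : rho \in ptn n ->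
  idem_at n lam rho = chi_at n lam rho / zof (mono rho).
Proof.
move=> rn; rewrite -(cyc_count_zof rn) mulrA [_ * _%:R]mulrC -idem_at_chi [RHS]mulrC mulKf //.
by rewrite pnatr_eq0 -lt0n fact_gt0.
Qed.

Definition schur_coef F ka : rat :=
  \sum_(rho <- ptn (sumn ka)) F (mono rho) * chi_at (sumn ka) ka rho.

Lemma ev_schur F al :
  ev F al = \sum_(ka <- ptn (mdeg al)) schur_coef F ka * schur ka al.
Proof.
rewrite (eq_big_seq (fun ka => \sum_(rho <- ptn (mdeg al))
    F (mono rho) * chi_at (mdeg al) ka rho * schur ka al)); last first.
  by move=> ka; rewrite mem_ptn => /eqP e; rewrite /schur_coef e mulr_suml.
rewrite exchange_big; apply: eq_big_seq => rho; rewrite mem_ptn => /eqP rn /=.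
rewrite (psump_schur rn) mseries_sumE mulr_sumr; apply: eq_bigr => ka _.
by rewrite mseriesZE mulrA.
Qed.

Lemma schur_sum_eq (c c' : intpart -> rat) :
  (forall al, \sum_(ka <- ptn (mdeg al)) c ka * schur ka al =
     \sum_(ka <- ptn (mdeg al)) c' ka * schur ka al) -> c = c'.
Proof.
move=> h; apply: funext => ka; apply/eqP; rewrite -subr_eq0; apply/eqP.
apply: (@schur_free (sumn ka) (fun ka => c ka - c' ka)); last by rewrite mem_ptn.
move=> al an; under eq_bigr do rewrite mulrBl.
by rewrite sumrB -an h subrr.
Qed.

Lemma fsum_schur (c : intpart -> rat) al :
  \sum_(lam \in [set: intpart]%classic) c lam * schur lam al =
  \sum_(lam <- ptn (mdeg al)) c lam * schur lam al.
Proof.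
rewrite (fsbigE (ptn (mdeg al))) ?ptn_uniq //.
  by apply: eq_bigl => lam; rewrite in_setT.
by move=> lam _; rewrite mem_ptn => ne; rewrite schur_homog0 ?mulr0 // eq_sym.
Qed.

Lemma hall_schur_ev mu F : hall_schur mu (ev F) = schur_coef F mu.
Proof.
rewrite /hall_schur; case: xgetP => [c _ cP|/(_ (schur_coef F))[]].
  congr (_ mu); apply: schur_sum_eq => al.
  by rewrite -ev_schur -fsum_schur; apply/esym/cP.
by move=> al; rewrite fsum_schur ev_schur.
Qed.

Lemma plethysm_schur mu g : plethysm (schur mu) g =
  \sum_(rho <- ptn (sumn mu)) idem_at (sumn mu) mu rho *:
     \prod_(k <- parts rho) psum_plethysm k g.
Proof.
pose n := sumn mu; pose c0 rho := if sumn rho == n then idem_at n mu rho else 0.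
have ex : is_psum_expansion (schur mu) c0.
  have fs : finite_set [set rho : intpart | sumn rho = n]%classic.
    by apply: sub_finite_set (finite_intpart n) => rho /= ->.
  split; first by apply: sub_finite_set fs => rho /=; rewrite /c0; case: (sumn rho =P n) => // _; rewrite eqxx.
  move=> m; rewrite (schur_psump (erefl n)) mseries_sumE.
  rewrite (fsbigE (ptn n)) ?ptn_uniq //.
    rewrite [RHS]big_mkcond; apply: eq_big_seq => rho; rewrite mem_ptn => /eqP e.
    by rewrite in_setT /c0 e eqxx.
  by move=> rho _; rewrite mem_ptn /c0 => /negPf ->; rewrite mul0r.
have cE : xget (fun=> 0) [set c | is_psum_expansion (schur mu) c]%classic = c0.
  case: xgetP => [c _ [fc cP]|/(_ c0)[] //]; apply: funext => rho.
  have cE d al : mdeg al = d -> \sum_(rho <- ptn d) (c rho - c0 rho) * psump rho al = 0.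
    move=> ad; under eq_bigr do rewrite mulrBl.
    rewrite sumrB; apply/eqP; rewrite subr_eq0; apply/eqP.
    have sE (e : intpart -> rat) : \sum_(rho \in [set: intpart]%classic) e rho * (\prod_(k <- parts rho) psum k) al =
        \sum_(rho <- ptn d) e rho * psump rho al.
      rewrite (fsbigE (ptn d)) ?ptn_uniq //; first by apply: eq_bigl => r; rewrite in_setT.
      move=> r _; rewrite mem_ptn -ad => ne; rewrite -/(psump r) psump_homog0 ?mulr0 //.
      by rewrite eq_sym.
    by rewrite -!sE -cP; case: ex.
  apply/eqP; rewrite -subr_eq0; apply/eqP.
  by apply: (@psump_free (sumn rho) (fun rho => c rho - c0 rho) (cE _)); rewrite mem_ptn.
apply: funext => m; rewrite /plethysm cE mseries_sumE.
rewrite (fsbigE (ptn n)) ?ptn_uniq //.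
  rewrite [LHS]big_mkcond; apply: eq_big_seq => rho; rewrite mem_ptn => /eqP e.
  by rewrite in_setT /c0 e eqxx.
by move=> rho _; rewrite mem_ptn /c0 => /negPf ->; rewrite mul0r.
Qed.

End Newton.

(** * Lyndon series as a dual family *)

Section Moebius.
Local Open Scope nat_scope.

Lemma mobius_dvd_sq p e : prime p -> p ^ 2 %| e -> 0 < e -> mobius e = 0%R.
Proof.
move=> pp pe e0; rewrite /mobius; case: allP => // h.
have pl : 2 <= logn p e by rewrite -pfactor_dvdn.
have pm : p \in primes e by rewrite mem_primes pp e0 -[p]expn1 (dvdn_trans _ pe) // dvdn_exp2l.
by have /eqP e1 := h p pm; rewrite e1 in pl.
Qed.

Lemma mobius_prime_mul p e : prime p -> ~~ (p %| e) -> 0 < e -> mobius (p * e) = (- mobius e)%R.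
Proof.
move=> pp npe e0; have p0 := prime_gt0 pp.
have pr : perm_eq (primes (p * e)) (p :: primes e).
  apply: uniq_perm; rewrite ?primes_uniq //=.
    by rewrite primes_uniq mem_primes pp e0 /= npe.
  by move=> q; rewrite primesM // primes_prime // !inE.
have lE q : q \in primes e -> logn q (p * e) = logn q e.
  move=> qe; rewrite lognM // logn_prime //; have [qp|//] := eqVneq q p.
  by move: qe; rewrite qp mem_primes (negPf npe) !andbF.
rewrite /mobius (perm_all _ pr) (perm_size pr) /= lognM // logn_prime // eqxx.
rewrite lognE (negPf npe) !andbF addn0 eqxx /=.
rewrite (eq_in_all (a2 := fun q => logn q e == 1)); last by move=> q /lE ->.
by case: ifP => _; rewrite ?exprS ?mulN1r ?oppr0.
Qed.

Lemma sum_mobius n : 0 < n -> (\sum_(d <- divisors n) mobius d = (n == 1)%:R)%R.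
Proof.
move=> n0; have [->|n1] := eqVneq n 1.
  by rewrite (_ : divisors 1 = [:: 1]) // big_seq1 /mobius.
have n2 : 1 < n by rewrite ltn_neqAle eq_sym n1.
have pp := pdiv_prime n2; set p := pdiv n in pp.
have pn : p %| n by exact: pdiv_dvd.
have p0 := prime_gt0 pp.
rewrite (bigID (fun d => p %| d)) /= addrC.
rewrite [X in (_ + X)%R](bigID (fun d => p ^ 2 %| d)) /= [X in (_ + (X + _))%R]big_seq_cond.
rewrite [X in (_ + (X + _))%R]big1 => [|d /andP[]]; last first.
  rewrite -dvdn_divisors // => dn /andP[_ pd]; apply: mobius_dvd_sq pp pd _.
  exact: dvdn_gt0 dn.
rewrite add0r -[X in (_ + X)%R]big_filter.
rewrite [X in (_ + X)%R](perm_big [seq p * d | d <- divisors n & ~~ (p %| d)]) /=.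
  rewrite big_map big_filter -big_split /= big_seq_cond big1 // => d /andP[].
  rewrite -dvdn_divisors // => dn npd; rewrite mobius_prime_mul ?subrr //.
  exact: dvdn_gt0 dn.
apply: uniq_perm.
- exact/filter_uniq/divisors_uniq.
- rewrite map_inj_uniq; first exact/filter_uniq/divisors_uniq.
  by move=> a b /eqP; rewrite eqn_pmul2l // => /eqP.
move=> d; rewrite mem_filter; apply/andP/mapP => [[/andP[pd np2] dn]|[e]].
  rewrite -dvdn_divisors // in dn; move: pd dn np2 => /dvdnP[e ->].
  rewrite mulnC expnS expn1 dvdn_pmul2l // => dn npe.
  exists e => //; rewrite mem_filter npe -dvdn_divisors //.
  by apply: dvdn_trans dn; exact: dvdn_mull.
rewrite mem_filter => /andP[npe]; rewrite -dvdn_divisors // => en ->.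
rewrite expnS expn1 dvdn_pmul2l // dvdn_mulr //= npe -dvdn_divisors //; split => //.
by rewrite Gauss_dvd ?pn // prime_coprime.
Qed.
End Moebius.

Section Derivations.
Implicit Types (m a b : cmonom nat) (F G H : mseries) (rho si ka : intpart).

Definition diag (f : cmonom nat -> rat) F : mseries := fun m => f m * F m.

Lemma diagM f F G : (forall a b, f (mmul a b) = f a + f b) ->
  diag f (F * G) = diag f F * G + F * diag f G.
Proof.
move=> fM; apply: funext => m; rewrite /diag mseriesDE !mseriesME mulr_sumr -big_split.
by apply: eq_big_seq => a am /=; rewrite -{1}(divcmK am) fM; ring.
Qed.

Definition weight k m := (\sum_(d <- divisors k) d * m d)%N.
Definition Dop k F : mseries := diag (fun m => (weight k m)%:R) F.
Definition pvars k : mseries := \sum_(d <- divisors k) pvar d.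
(* Hs * Qs u is the sum over rho of prod_(k in u) Fix(w^k) p_rho / z_rho, with w
   of cycle type rho: it encodes the tensor powers of permutation modules. *)
Definition Qs (u : seq nat) : mseries := foldr (fun k F => Dop k F + pvars k * F) 1 u.

Lemma weightM k a b : weight k (mmul a b) = (weight k a + weight k b)%N.
Proof. by rewrite /weight -big_split; apply: eq_bigr => d _; rewrite cmM mulnDr. Qed.

Lemma DopM k F G : Dop k (F * G) = Dop k F * G + F * Dop k G.
Proof. by apply: diagM => a b; rewrite weightM natrD. Qed.

Lemma Dop_Hs k : (0 < k)%N -> Dop k Hs = pvars k * Hs.
Proof.
move=> k0; apply: funext => m; rewrite /Dop /diag /weight /pvars mulr_suml mseries_sumE.
rewrite natr_sum mulr_suml; apply: eq_big_seq => d dk.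
by rewrite Hs_pvar //; apply: dvdn_gt0 (k0) _; rewrite dvdn_divisors.
Qed.

Lemma Hs_Qs (u : seq nat) m : all (fun k => 0 < k)%N u ->
  (Hs * Qs u) m = (\prod_(k <- u) weight k m)%:R * Hs m.
Proof.
elim: u => [|k u IH] /=; first by rewrite big_nil mulr1 mul1r.
move=> /andP[k0 ug]; rewrite mulrDr mulrCA mulrA -Dop_Hs // addrC -DopM.
by rewrite /Dop /diag IH // big_cons natrM mulrA.
Qed.

Definition pder d F : mseries := fun m => (m d).+1%:R * F (mmul (ucm d) m).

Lemma pvar_pder d F : pvar d * pder d F = diag (fun m => (m d)%:R) F.
Proof.
apply: funext => m; rewrite /diag; have [dm|dm] := boolP (ucm d \in cm_divisors m).
  by rewrite -(divcmK dm) mXME /pder cmM ucmE eqxx.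
rewrite mXME0 // (_ : m d = 0%N) ?mul0r //; apply/eqP; rewrite -leqn0 leqNgt.
apply: contra dm => md; apply/mem_cm_divisors => i; rewrite ucmE.
by case: eqP => // <-.
Qed.

Lemma pderM d F G : pder d (F * G) = pder d F * G + F * pder d G.
Proof.
have e : pvar d * pder d (F * G) = pvar d * (pder d F * G + F * pder d G).
  rewrite mulrDr mulrA [pvar d * (F * _)]mulrCA !pvar_pder.
  by apply: diagM => a b; rewrite cmM natrD.
apply: funext => m; have := congr1 (fun F : mseries => F (mmul (ucm d) m)) e.
by rewrite !mXME.
Qed.

Lemma mul1DE F G m : ((1 + F) * G) m = G m + (F * G) m.
Proof. by rewrite mulrDl mul1r mseriesDE. Qed.

Definition Eop k F : mseries := \sum_(d <- divisors k) d%:R *: ((1 + pvar d) * pder d F).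

Lemma EopM k F G : Eop k (F * G) = Eop k F * G + F * Eop k G.
Proof.
rewrite /Eop mulr_suml mulr_sumr -big_split; apply: eq_bigr => d _ /=.
rewrite pderM mulrDr scalerDr -scalerAl -scalerAr; congr (_ *: _ + _ *: _).
  by rewrite mulrA.
by rewrite mulrCA.
Qed.

Definition pairing N F G : rat := \sum_(m <- mons N) zof m * F m * G m.

Lemma pairing_pvar N d F G : (0 < d)%N ->
  (forall m, (N < d + wdeg m)%N -> G m = 0) ->
  pairing N F (pvar d * G) = pairing N (d%:R *: pder d F) G.
Proof.
move=> d0 G0; rewrite /pairing; have [dN|Nd] := leqP d N; last first.
  have -> : G = 0 by apply: funext => m; rewrite G0 // ltn_addr.
  by rewrite mulr0 [RHS]big1 ?big1 // => m _; exact: mulr0.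
transitivity (\sum_(m <- mons (N - d)) zof m * (d%:R *: pder d F) m * G m).
  transitivity (\sum_(m <- mons N | ucm d \in cm_divisors m) zof m * F m * (pvar d * G) m).
    rewrite [RHS]big_mkcond; apply: eq_bigr => m _; case: ifP => // /negbT h.
    by rewrite mXME0 // mulr0.
  rewrite sum_mons_shift ?d0 //; apply: eq_bigr => m _.
  by rewrite mXME zof_shift mseriesZE /pder natrM; ring.
transitivity (\sum_(m <- mons N | (wdeg m <= N - d)%N) zof m * (d%:R *: pder d F) m * G m).
  rewrite -[RHS]big_filter; apply: perm_big; apply: uniq_perm.
  - exact: mons_uniq.
  - exact/filter_uniq/mons_uniq.
  by move=> m; rewrite mem_filter !mem_mons; case: eqP => //=; lia.
rewrite big_mkcond; apply: eq_bigr => m _; case: leqP => // h.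
by rewrite G0 ?mulr0 //; lia.
Qed.

Lemma pairingDr N F G G' : pairing N F (G + G') = pairing N F G + pairing N F G'.
Proof. by rewrite -big_split; apply: eq_bigr => m _; rewrite mseriesDE mulrDr. Qed.

Lemma pairing_adj N k F G : (0 < k)%N ->
  (forall m, (N < k + wdeg m)%N -> G m = 0) ->
  pairing N F (Dop k G + pvars k * G) = pairing N (Eop k F) G.
Proof.
move=> k0 G0.
rewrite pairingDr.
have -> : pairing N F (pvars k * G) = \sum_(d <- divisors k) pairing N F (pvar d * G).
  rewrite /pairing exchange_big; apply: eq_bigr => m _ /=.
  by rewrite /pvars mulr_suml mseries_sumE mulr_sumr.
rewrite (eq_big_seq (fun d => pairing N (d%:R *: pder d F) G)); last first.
  move=> d; rewrite -dvdn_divisors // => dk; apply: pairing_pvar; first exact: dvdn_gt0 dk.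
  by move=> m h; apply: G0; apply: leq_trans h _; rewrite leq_add2r dvdn_leq.
rewrite /pairing [X in _ + X]exchange_big -big_split; apply: eq_bigr => m _ /=.
rewrite /Dop /diag /weight natr_sum /Eop mseries_sumE !mulr_suml mulr_sumr mulr_sumr mulr_suml -big_split.
apply: eq_bigr => d _ /=.
rewrite [in RHS]mseriesZE mul1DE pvar_pder mseriesZE /diag natrM.
by move: (zof m) (F m) (G m) (pder d F m) => z f g f'; ring.
Qed.

Lemma Qs_support (u : seq nat) m : all (fun k => 0 < k)%N u -> (sumn u < wdeg m)%N -> Qs u m = 0.
Proof.
elim: u m => [|k u IH] m /=.
  by rewrite mseries1E; case: (m =P mone) => // ->; rewrite wdeg1.
move=> /andP[k0 ug] lt; rewrite mseriesDE /Dop /diag IH ?mulr0 ?add0r //; last first.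
  by apply: leq_ltn_trans lt; exact: leq_addl.
rewrite /pvars mulr_suml mseries_sumE big_seq big1 // => d.
rewrite -dvdn_divisors // => dk.
have [dm|dm] := boolP (ucm d \in cm_divisors m); last by rewrite mXME0.
rewrite -(divcmK dm) mXME IH //; have := dvdn_leq k0 dk.
by have := congr1 wdeg (divcmK dm); rewrite wdegM wdegU; move: lt; lia.
Qed.

End Derivations.

Section LyndonSeries.
Implicit Types (m a b : cmonom nat) (F G H : mseries) (rho si ka : intpart) (e : rat).

Definition pure c m := m == expcmn (ucm c) (m c).

(* The logarithm of 1 / (1 - e p_c), divided by e. *)
Definition logser e c : mseries := fun m =>
  if (0 < m c)%N && pure c m then e ^+ (m c).-1 / (m c)%:R else 0.
Definition geoser e c : mseries := fun m => if pure c m then e ^+ m c else 0.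

(* [lynser 1 j] represents L_1 + L_2 + ... evaluated at the j-th powers. *)
Definition lynser e j : mseries := fun m =>
  \sum_(d < wdeg m) (mobius d.+1)%:~R / d.+1%:R * logser e (j * d.+1) m.

Lemma pure_shift c m : pure c (mmul (ucm c) m) = pure c m.
Proof.
rewrite /pure cmM ucmE eqxx add1n.
have -> : expcmn (ucm c) (m c).+1 = mmul (ucm c) (expcmn (ucm c) (m c)).
  by apply: cm_eq => i; rewrite cmM !expcmnE; lia.
by rewrite (inj_eq (@mmulI _)).
Qed.

Lemma wdeg_pure c m : pure c m -> wdeg m = (c * m c)%N.
Proof.
move=> /eqP e; rewrite [in LHS]e; move: (m c) => r {e m}.
elim: r => [|r IH]; first by rewrite muln0; exact: wdeg1.
have -> : expcmn (ucm c) r.+1 = mmul (ucm c) (expcmn (ucm c) r).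
  by apply: cm_eq => i; rewrite cmM !expcmnE; lia.
by rewrite wdegM wdegU IH mulnS.
Qed.

Lemma logser_large e c m : (0 < c)%N -> (wdeg m < c)%N -> logser e c m = 0.
Proof.
move=> c0 lt; rewrite /logser; case: ifP => // /andP[m0 /wdeg_pure w].
by move: lt; rewrite w ltnNge leq_pmulr.
Qed.

Lemma lynserE N e j m : (0 < j)%N -> (wdeg m <= N)%N ->
  lynser e j m = \sum_(d < N) (mobius d.+1)%:~R / d.+1%:R * logser e (j * d.+1) m.
Proof.
move=> j0 mN; rewrite /lynser (big_ord_widen N (fun d => (mobius d.+1)%:~R / d.+1%:R * logser e (j * d.+1) m)) //.
rewrite big_mkcond; apply: eq_bigr => d _; case: ltnP => // h.
rewrite logser_large ?mulr0 ?muln_gt0 ?j0 //.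
by apply: leq_trans (_ : d.+1 <= _)%N; rewrite ?leq_pmull.
Qed.

Lemma pder_logser e c d : pder d (logser e c) = (c == d)%:R *: geoser e c.
Proof.
apply: funext => m; rewrite mseriesZE /pder /logser /geoser.
have [->|ne] := eqVneq c d.
  rewrite pure_shift cmM ucmE eqxx add1n /= mul1r; case: ifP => _; last by rewrite mulr0.
  by rewrite mulrC divfK // pnatr_eq0.
rewrite mul0r; case: ifP => [/andP[_ /eqP h]|]; last by rewrite mulr0.
have := congr1 (fun m : cmonom nat => m d) h.
rewrite cmM ucmE eqxx expcmnE cmM !ucmE (negPf ne) muln0; lia.
Qed.

Lemma geoser_inv c : (1 + pvar c) * geoser (-1) c = 1.
Proof.
apply: funext => m; rewrite mul1DE mseries1E.
have [cm|cm] := boolP (ucm c \in cm_divisors m).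
  rewrite -(divcmK cm) mXME /geoser pure_shift cmM ucmE eqxx add1n exprS mulN1r.
  rewrite (_ : (_ == mone) = false); last first.
    apply/eqP => h; have := congr1 (fun m : cmonom nat => m c) h.
    by rewrite cmM ucmE eqxx cm1.
  by case: ifP; rewrite ?addNr ?addr0.
rewrite mXME0 // addr0 /geoser /pure.
have -> : m c = 0%N.
  apply/eqP; rewrite -leqn0 leqNgt; apply: contra cm => mc.
  by apply/mem_cm_divisors => i; rewrite ucmE; case: eqP => // <-.
by rewrite (_ : expcmn _ 0 = mone) // expr0; case: eqP.
Qed.

Lemma pder_lynser e j d : (0 < j)%N -> (0 < d)%N -> pder d (lynser e j) =
  (if (j %| d)%N then (mobius (d %/ j))%:~R / (d %/ j)%:R else 0) *: geoser e d.
Proof.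
move=> j0 d0; apply: funext => m; rewrite mseriesZE {1}/pder.
rewrite (@lynserE (wdeg (mmul (ucm d) m)) e j) // mulr_sumr.
transitivity (\sum_(i < wdeg (mmul (ucm d) m))
   if (j * i.+1 == d)%N then (mobius i.+1)%:~R / i.+1%:R * geoser e d m else 0).
  apply: eq_bigr => i _; rewrite mulrCA -[_.+1%:R * _]/(pder d (logser e (j * i.+1)) m).
  rewrite pder_logser mseriesZE; case: eqP => [->|]; rewrite ?mul1r // mul0r mulr0 //.
case: ifP => [/dvdnP[q dq]|ndv]; last first.
  rewrite mul0r big1 // => i _; case: eqP => // h.
  by rewrite -h dvdn_mulr in ndv.
have q0 : (0 < q)%N by move: d0; rewrite dq muln_gt0 => /andP[].
have ql : (q.-1 < wdeg (mmul (ucm d) m))%N.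
  rewrite prednK // wdegM wdegU dq (leq_trans _ (leq_addr _ _)) //.
  exact: leq_pmulr.
have djq : (d %/ j)%N = q by rewrite dq mulnK.
rewrite (bigD1 (Ordinal ql)) //= prednK // [(j * q)%N]mulnC -dq eqxx djq big1 ?addr0 // => i ne.
case: eqP => // h; case/eqP: ne; apply: ord_inj => /=.
by move: h; rewrite [RHS]dq mulnC => /eqP; rewrite eqn_pmul2r // => /eqP <-.
Qed.

Lemma Eop_lynser k j : (0 < k)%N -> (0 < j)%N ->
  Eop k (lynser (-1) j) = (if j == k then k%:R else 0)%:A.
Proof.
move=> k0 j0; rewrite /Eop.
transitivity ((\sum_(d <- divisors k) (if (j %| d)%N then (j%:R * (mobius (d %/ j))%:~R : rat) else 0))%:A : mseries).
  rewrite scaler_suml; apply: eq_big_seq => d; rewrite -dvdn_divisors // => dk.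
  have d0 : (0 < d)%N by exact: dvdn_gt0 dk.
  rewrite pder_lynser // -scalerAr geoser_inv scalerA; congr (_ *: _).
  case: ifP => [jd|]; last by rewrite mulr0.
  rewrite -{1}(divnK jd) natrM; field; rewrite pnatr_eq0 -lt0n divn_gt0 //.
  exact: dvdn_leq jd.
congr (_ *: _); rewrite -big_mkcond /=.
have [jk|njk] := boolP (j %| k)%N; last first.
  rewrite big_seq_cond big1 => [|d /andP[]]; last first.
    by rewrite -dvdn_divisors // => dk jd; rewrite (dvdn_trans jd dk) in njk.
  by case: eqP => // e; rewrite e dvdnn in njk.
have kj0 : (0 < k %/ j)%N by rewrite divn_gt0 // dvdn_leq.
rewrite -big_filter (perm_big [seq (j * q)%N | q <- divisors (k %/ j)]) /=; last first.
  apply: uniq_perm.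
  - exact/filter_uniq/divisors_uniq.
  - rewrite map_inj_uniq ?divisors_uniq // => a b /eqP.
    by rewrite eqn_pmul2l // => /eqP.
  move=> d; rewrite mem_filter; apply/andP/mapP => [[/dvdnP[q ->]]|[q]].
    rewrite -dvdn_divisors // => qk; exists q; last by rewrite mulnC.
    by rewrite -dvdn_divisors // dvdn_divRL.
  rewrite -dvdn_divisors // dvdn_divRL // => qk ->.
  by rewrite dvdn_mulr // -dvdn_divisors // mulnC.
rewrite big_map -mulr_sumr.
under eq_bigr do rewrite mulKn //.
rewrite -rmorph_sum /= sum_mobius //.
have [->|ne] := eqVneq j k; first by rewrite divnn k0 /= mulr1.
rewrite (_ : (k %/ j == 1)%N = false) ?mulr0 //; apply/eqP => h.
by case/eqP: ne; rewrite -[RHS](divnK jk) h mul1n.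
Qed.

Definition lynprod e (v : seq nat) : mseries := \prod_(j <- v) lynser e j.

Lemma Eop_lynprod k (v : seq nat) : (0 < k)%N -> all (fun j => 0 < j)%N v ->
  Eop k (lynprod (-1) v) = (k * count_mem k v)%:R *: lynprod (-1) (rem k v).
Proof.
move=> k0; rewrite /lynprod; elim: v => [|j v IH] /=.
  rewrite muln0 scale0r !big_nil /Eop big1 // => d _.
  apply: funext => m; rewrite mseriesZE mseriesME big1 ?mulr0 // => a _.
  rewrite /pder mseries1E (_ : (_ == mone) = false) ?mulr0 //.
  apply/eqP => h; have := congr1 (fun m : cmonom nat => m d) h.
  by rewrite cmM ucmE eqxx cm1.
move=> /andP[j0 vg]; rewrite big_cons EopM Eop_lynser // IH //.
have [<-|ne] := eqVneq j k; last first.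
  by rewrite scale0r mul0r !add0r add0n big_cons -scalerAr.
rewrite -scalerAl mul1r -scalerAr mulnDr muln1 natrD scalerDl; congr (_ + _).
have [jv|njv] := boolP (j \in v); last by rewrite (count_memPn njv) muln0 !scale0r.
by congr (_ *: _); rewrite [RHS](perm_big _ (perm_to_rem jv)) big_cons.
Qed.

Lemma pairing_lynprod N (u v : seq nat) : all (fun j => 0 < j)%N u ->
  all (fun j => 0 < j)%N v -> (sumn u <= N)%N ->
  pairing N (lynprod (-1) v) (Qs u) = (perm_eq u v)%:R * zof (mono u).
Proof.
elim: u v => [|k u IH] v /=.
  move=> _ vg _; rewrite /pairing.
  rewrite (eq_bigr (fun m => if m == mone then zof m * lynprod (-1) v m else 0)); last first.
    by move=> m _; rewrite mseries1E; case: eqP; rewrite ?mulr1 ?mulr0.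
  rewrite -big_mkcond sum_delta ?mons_uniq // mem_mons cm1 wdeg1 /= mulrC /mono big_nil; congr (_ * _).
  case: v vg => [|j v]; rewrite /lynprod; first by rewrite big_nil mseries1E eqxx.
  rewrite big_cons => _; rewrite mseriesME big_seq big1 //.
    by rewrite (_ : perm_eq _ _ = false) //; apply/negP => /perm_size.
  move=> a /mem_cm_divisors am.
  have -> : a = mone by apply: cm_eq => i; have := am i; rewrite cm1 leqn0 => /eqP.
  by rewrite /lynser wdeg1 big_ord0 mul0r.
move=> /andP[k0 ug] vg kuN; rewrite pairing_adj //; last first.
  by move=> m h; apply: Qs_support => //; lia.
rewrite Eop_lynprod //.
have -> : pairing N ((k * count_mem k v)%:R *: lynprod (-1) (rem k v)) (Qs u) =
   (k * count_mem k v)%:R * pairing N (lynprod (-1) (rem k v)) (Qs u).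
  by rewrite /pairing mulr_sumr; apply: eq_bigr => m _; rewrite mseriesZE; ring.
rewrite IH //; last 2 first.
- by apply/allP => x /mem_rem /(allP vg).
- by apply: leq_trans kuN; exact: leq_addl.
rewrite mono_cons zof_shift monoE.
have [kv|nkv] := boolP (k \in v); last first.
  rewrite (count_memPn nkv) muln0 mul0r (_ : perm_eq _ v = false) ?mul0r //.
  by apply/negP => /perm_mem /(_ k); rewrite inE eqxx (negPf nkv).
have pv := perm_to_rem kv.
have -> : perm_eq (k :: u) v = perm_eq u (rem k v).
  by rewrite (permPr pv) perm_cons.
case: (boolP (perm_eq u (rem k v))) => [pu|_]; last by rewrite !mul0r mulr0.
have /seq.permP/(_ (pred1 k)) /= := pv; rewrite eqxx => ->.
by have /seq.permP/(_ (pred1 k)) -> := pu; rewrite !mul1r add1n.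
Qed.

Definition twist F : mseries := fun m => (-1) ^+ mdeg m * F m.

Lemma twistM F G : twist (F * G) = twist F * twist G.
Proof.
apply: funext => m; rewrite /twist !mseriesME mulr_sumr; apply: eq_big_seq => a am.
by rewrite -{1}(divcmK am) mdegM exprD mulrACA.
Qed.

Lemma lynser_twist j : lynser (-1) j = - twist (lynser 1 j).
Proof.
apply: funext => m; rewrite -[RHS]mulN1r -[RHS]/((-1) * twist (lynser 1 j) m) /twist.
rewrite /lynser !mulr_sumr; apply: eq_bigr => d _; rewrite /logser.
case: ifP => [/andP[m0 /eqP e]|]; last by rewrite !mulr0.
have -> : mdeg m = m (j * d.+1)%N by rewrite {1}e mdeg_exp mdegU muln1.
case: (m _) m0 => // r _; rewrite expr1n exprS /=; ring.
Qed.

Lemma lynprod_twist (v : seq nat) m :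
  lynprod (-1) v m = (-1) ^+ size v * (-1) ^+ mdeg m * lynprod 1 v m.
Proof.
rewrite -mulrA -[_ * lynprod 1 v m]/(twist (lynprod 1 v) m).
rewrite -mseriesZE; congr (_ m); rewrite /lynprod; elim: v => [|j v IH] /=.
  rewrite !big_nil expr0 scale1r; apply: funext => a; rewrite /twist mseries1E.
  by case: (a =P mone) => [->|]; rewrite ?mdeg1 ?mulr0 ?mulr1.
rewrite !big_cons IH lynser_twist twistM -scalerAr exprS mulN1r scaleNr mulNr scalerN //.
Qed.

End LyndonSeries.

Lemma sum_divisors (V : nmodType) n m (F : nat -> V) : (0 < m <= n)%N ->
  \sum_(d <- divisors m) F d = \sum_(d < n | (d.+1 %| m)%N) F d.+1.
Proof.
move=> /andP[m0 mn].
rewrite -(big_mkord (fun d => d.+1 %| m)%N (fun d => F d.+1)) -big_filter.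
rewrite -[RHS](big_map succn xpredT F); apply: perm_big; apply: uniq_perm.
- exact: divisors_uniq.
- by rewrite map_inj_uniq ?filter_uniq ?iota_uniq // => i j [].
move=> d; rewrite -dvdn_divisors //; apply/idP/mapP => [dm|[e]]; last first.
  by rewrite mem_filter => /andP[h _ ->].
have d0 := dvdn_gt0 m0 dm; exists d.-1; rewrite ?prednK //.
by rewrite mem_filter prednK // dm mem_index_iota /= prednK // (leq_trans (dvdn_leq m0 dm)).
Qed.

Section LyndonPlethysm.
Implicit Types (m a b al : cmonom nat) (F G H : mseries).

Lemma expcmn_inj k : (0 < k)%N -> injective (fun m : cmonom nat => expcmn m k).
Proof.
move=> k0 a b e; apply: cm_eq => i.
have /eqP := congr1 (fun m : cmonom nat => m i) e.
by rewrite !expcmnE eqn_pmul2l // => /eqP.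
Qed.

Lemma psum_plethysmE k g a : (0 < k)%N -> psum_plethysm k g (expcmn a k) = g a.
Proof.
move=> k0; rewrite /psum_plethysm (fsbigE [:: a]) //.
- by rewrite big_mkcond big_seq1 mem_set.
- by move=> b /=; rewrite inE => /eqP ->.
by move=> b /= /(expcmn_inj k0) ->; rewrite inE eqxx.
Qed.

Lemma psum_plethysm0 k g al : (forall a, expcmn a k <> al) -> psum_plethysm k g al = 0.
Proof.
move=> h; rewrite /psum_plethysm (fsbigE [::]) ?big_nil //.
by move=> b /= /h.
Qed.

Lemma psum_expE d r N al : (0 < d)%N -> cmbound N al ->
  (psum d ^+ r) al = \sum_(f : {ffun 'I_r -> 'I_N})
    (al == \big[mmul/mone]_i expcmn (ucm (f i : nat)) d)%:R.
Proof.
move=> d0 b; rewrite -[r in LHS]card_ord -prodr_const.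
rewrite (below_prod (F' := fun _ : 'I_r => _) _ (fun _ => psum_below d0) b).
rewrite bigA_distr_bigA mseries_sumE; apply: eq_bigr => f _.
by under eq_bigr do rewrite mX_exp; rewrite mX_prod.
Qed.

Lemma expcmn_prod (I : Type) (s : seq I) (f : I -> cmonom nat) j :
  \big[mmul/mone]_(i <- s) expcmn (f i) j = expcmn (\big[mmul/mone]_(i <- s) f i) j.
Proof.
apply: cm_eq => x; rewrite expcmnE !cm_prodE big_distrr.
by apply: eq_bigr => i _; rewrite expcmnE.
Qed.

Lemma expcmnM a i j : expcmn a (i * j) = expcmn (expcmn a j) i.
Proof. by apply: cm_eq => x; rewrite !expcmnE mulnA. Qed.

Lemma psum_power j d r a : (0 < j)%N -> (0 < d)%N ->
  (psum (j * d) ^+ r) (expcmn a j) = (psum d ^+ r) a.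
Proof.
move=> j0 d0; have [N b] := cmbound_exists a.
have b' : cmbound N (expcmn a j) by move=> i Ni; rewrite expcmnE b ?muln0.
rewrite (psum_expE _ _ b) // (psum_expE _ _ b') ?muln_gt0 ?j0 //.
apply: eq_bigr => f _; under eq_bigr do rewrite expcmnM.
by rewrite expcmn_prod (inj_eq (expcmn_inj j0)).
Qed.

Lemma psum_power0 j d r al : (0 < j)%N -> (0 < d)%N -> (forall a, expcmn a j <> al) ->
  (psum (j * d) ^+ r) al = 0.
Proof.
move=> j0 d0 h; have [N b] := cmbound_exists al.
rewrite (psum_expE _ _ b) ?muln_gt0 ?j0 // big1 // => f _.
under eq_bigr do rewrite expcmnM.
by rewrite expcmn_prod; case: eqP => // e; case: (h _ (esym e)).
Qed.

Lemma psump_nseq d r : psump (nseq r d) = psum d ^+ r.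
Proof.
elim: r => [|r IH]; first by rewrite /psump big_nil expr0.
by rewrite exprS -IH /psump big_cons.
Qed.

Lemma psum_exp_homog0 d r al : (0 < d)%N -> mdeg al != (d * r)%N -> (psum d ^+ r) al = 0.
Proof.
move=> d0 ne; apply/eqP; apply: contraNT ne => nz; apply/eqP.
have -> : (d * r)%N = sumn (nseq r d) by rewrite sumn_nseq.
by apply: psump_homog; rewrite ?all_nseq ?d0 ?orbT // psump_nseq.
Qed.

Lemma lyndonE (m : nat) a : (0 < m)%N -> lyndon m a =
  \sum_(d <- divisors m) (mobius d)%:~R / m%:R * (psum d ^+ (m %/ d)) a.
Proof.
move=> m0; rewrite /lyndon mseriesZE mseries_sumE mulr_sumr; apply: eq_bigr => d _.
by rewrite mseriesZE mulrA [_^-1 * _]mulrC.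
Qed.

Lemma lyndon_seriesE a : lyndon_series a = if (0 < mdeg a)%N then lyndon (mdeg a) a else 0.
Proof.
rewrite /lyndon_series (fsbigE (if (0 < mdeg a)%N then [:: mdeg a] else [::])).
- by case: ifP => a0; rewrite ?big_nil // big_mkcond big_seq1 mem_set.
- by case: ifP.
- by move=> i /=; case: ifP => // a0; rewrite inE => /eqP ->.
move=> i /= i0 ni; rewrite lyndonE // big_seq big1 // => d; rewrite -dvdn_divisors // => di.
rewrite psum_exp_homog0 ?mulr0 //; first exact: dvdn_gt0 di.
rewrite mulnC divnK //; apply: contraNneq ni => e; by rewrite e i0 inE eqxx.
Qed.

Lemma ev_logser c al : (0 < c)%N -> ev (logser 1 c) al =
  if (0 < mdeg al)%N && (c %| mdeg al)%N
  then (mdeg al %/ c)%:R^-1 * (psum c ^+ (mdeg al %/ c)) al else 0.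
Proof.
move=> c0; have mc r : expcmn (ucm c) r = mono (nseq r c).
  by apply: cm_eq => i; rewrite monoE expcmnE ucmE count_nseq /= mulnC.
case: ifP => [/andP[a0 /dvdnP[r ar]]|ndv].
  rewrite {1 2}ar mulnK //; have r0 : (0 < r)%N by move: a0; rewrite ar muln_gt0 => /andP[].
  have nz : (expcmn (ucm c) r : cmonom nat) 0%N = 0%N by rewrite expcmnE ucmE (gtn_eqF c0) muln0.
  have [rho re] := mono_surj nz.
  have rn : rho \in ptn (mdeg al).
    by rewrite mem_ptn -wdeg_mono re mc wdeg_mono sumn_nseq ar mulnC.
  rewrite /ev (bigD1_seq rho) ?ptn_uniq //= [X in _ + X]big1_seq ?addr0; last first.
    move=> si /andP[/eqP ne]; rewrite mem_ptn => /eqP sn.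
    rewrite /logser; case: ifP => [/andP[_ /eqP e]|]; last by rewrite mul0r.
    have er : mono si = mono rho.
      rewrite re e; congr expcmn.
      have := congr1 wdeg e; rewrite wdeg_mono sn mc wdeg_mono sumn_nseq ar mulnC => /eqP.
      by rewrite eqn_pmul2l // => /eqP.
    by have := ne (mono_part_inj er).
  rewrite (psump_mono (esym (etrans re (mc r)))) psump_nseq re /logser /pure mc.
  by rewrite monoE count_nseq /= eqxx mul1n r0 -mc eqxx expr1n mul1r.
rewrite /ev big_seq big1 // => rho; rewrite mem_ptn => /eqP rn.
rewrite /logser; case: ifP => [/andP[m0 /wdeg_pure w]|]; last by rewrite mul0r.
move: ndv; rewrite -rn -wdeg_mono w dvdn_mulr // andbT muln_gt0 c0 m0 //.
Qed.

Lemma ev_lynser j : (0 < j)%N -> ev (lynser 1 j) = psum_plethysm j lyndon_series.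
Proof.
move=> j0; apply: funext => al; set n := mdeg al.
transitivity (\sum_(d < n) (mobius d.+1)%:~R / d.+1%:R * ev (logser 1 (j * d.+1)) al).
  rewrite /ev; under [RHS]eq_bigr do rewrite mulr_sumr.
  rewrite exchange_big; apply: eq_big_seq => rho; rewrite mem_ptn => /eqP rn.
  rewrite (@lynserE n) //; last by rewrite wdeg_mono rn.
  by rewrite mulr_suml; apply: eq_bigr => d _; rewrite mulrA.
have [[a ae]|h] := pselect (exists a, expcmn a j = al); last first.
  rewrite psum_plethysm0; last by move=> a ae; apply: h; exists a.
  rewrite big1 // => d _; rewrite ev_logser ?muln_gt0 ?j0 //; case: ifP; rewrite ?mulr0 // => _.
  by rewrite psum_power0 ?mulr0 // => a ae; apply: h; exists a.
rewrite -ae psum_plethysmE // lyndon_seriesE.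
have ns : n = (j * mdeg a)%N by rewrite /n -ae mdeg_exp.
have [a0|apos] := posnP (mdeg a).
  by move: ns; rewrite a0 muln0 => ->; rewrite big_ord0.
have an : (0 < mdeg a <= n)%N by rewrite apos ns leq_pmull.
rewrite lyndonE // (sum_divisors (fun d => (mobius d)%:~R / (mdeg a)%:R * (psum d ^+ (mdeg a %/ d)) a) an) [RHS]big_mkcond.
apply: eq_bigr => d _; rewrite ev_logser ?muln_gt0 ?j0 //.
rewrite mdeg_exp muln_gt0 j0 apos /= dvdn_pmul2l //; case: ifP => [dd|]; last by rewrite mulr0.
rewrite divnMl // psum_power // mulrA; congr (_ * _).
by rewrite -mulrA -invfM -natrM mulnC divnK.
Qed.

End LyndonPlethysm.

Section Transpose.
Implicit Types (lam mu rho : intpart).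

Lemma nth_transpose lam j : nth 0%N (transpose lam) j = count (fun x => j < x)%N lam.
Proof.
rewrite /transpose /= /transpose_seq; have [jl|lj] := ltnP j (head 0%N lam).
  by rewrite (nth_map 0%N) ?size_iota // nth_iota.
rewrite nth_default ?size_map ?size_iota //; apply/esym/eqP; rewrite -leqn0 leqNgt -has_count.
apply/hasPn => x xl; rewrite -leqNgt; apply: leq_trans lj.
by have := @nth_intpart_le lam 0 (index x lam) (leq0n _); rewrite nth_index // nth0.
Qed.

Lemma lt_transpose lam i j : (i < nth 0 (transpose lam) j)%N = (j < nth 0 lam i)%N.
Proof.
rewrite nth_transpose; pose L := maxn i.+1 (size lam).
have -> : count (fun x => j < x)%N lam = count (fun i => j < nth 0 lam i)%N (iota 0 L).
  have -> : iota 0 L = iota 0 (size lam) ++ iota (size lam) (L - size lam).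
    by rewrite -iotaD subnKC // leq_maxr.
  rewrite count_cat [X in (_ + X)%N](_ : _ = 0%N) ?addn0; last first.
    apply/eqP; rewrite -leqn0 leqNgt -has_count; apply/hasPn => x; rewrite mem_iota => /andP[xl _].
    by rewrite nth_default.
  by rewrite -[X in count _ X](mkseq_nth 0%N) count_map.
rewrite -(@count_iota_down (fun i => j < nth 0 lam i)%N L) ?leq_maxl //.
by move=> a b ab _ /leq_trans; apply; exact: nth_intpart_le.
Qed.

Lemma transposeK : involutive transpose.
Proof.
move=> lam; apply: intpart_eq => i.
have h k : (k < nth 0 (transpose (transpose lam)) i)%N = (k < nth 0 lam i)%N.
  by rewrite !lt_transpose.
by apply/eqP; rewrite eqn_leq; apply/andP; split; rewrite leqNgt; apply/negP;
  [rewrite h ltnn | rewrite -h ltnn].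
Qed.

Definition tbox lam k := flatten_index (transpose lam) (box_col lam k) (box_row lam k).

Lemma tboxP lam k : (k < sumn lam)%N ->
  [/\ (tbox lam k < sumn (transpose lam))%N,
      box_row (transpose lam) (tbox lam k) = box_col lam k
    & box_col (transpose lam) (tbox lam k) = box_row lam k].
Proof.
move=> /box_col_lt; rewrite -lt_transpose => lt; split; first exact: flatten_indexP.
  by rewrite /box_row /tbox flatten_indexKl.
by rewrite [LHS]/box_col /tbox flatten_indexKr.
Qed.

Lemma sumn_transpose lam : sumn (transpose lam) = sumn lam.
Proof.
have le mu : (sumn mu <= sumn (transpose mu))%N.
  rewrite -(size_iota 0 (sumn mu)) -(size_iota 0 (sumn (transpose mu))).
  apply: (size_le_inj (f := tbox mu)); rewrite ?iota_uniq //.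
    by move=> k; rewrite !mem_iota => /tboxP[].
  move=> k l; rewrite !mem_iota => /tboxP[_ r1 c1] /tboxP[_ r2 c2] e.
  by apply: (@box_inj mu); [rewrite -c1 -c2 e | rewrite -r1 -r2 e].
by apply/eqP; rewrite eqn_leq le andbT -{2}[lam]transposeK le.
Qed.

Section Twist.
Variables (n : nat) (lam : intpart).
Hypothesis lamn : sumn lam = n.

Lemma tbox_perm : exists t : 'S_n, forall k : 'I_n,
  box_row (transpose lam) (t k) = box_col lam k /\
  box_col (transpose lam) (t k) = box_row lam k.
Proof.
have lt (k : 'I_n) : (tbox lam k < n)%N.
  have [] := @tboxP lam k; first by rewrite lamn.
  by rewrite sumn_transpose lamn.
have inj : injective (fun k => Ordinal (lt k)).
  move=> k l e; have {}e : tbox lam k = tbox lam l by have := congr1 val e.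
  have [|_ r1 c1] := @tboxP lam k; first by rewrite lamn.
  have [|_ r2 c2] := @tboxP lam l; first by rewrite lamn.
  by apply: ord_inj; apply: (@box_inj lam); [rewrite -c1 -c2 e | rewrite -r1 -r2 e].
exists (perm inj) => k; rewrite permE /=.
by have [|] := @tboxP lam k; first by rewrite lamn.
Qed.

Lemma young_transpose (t g : 'S_n) :
  (forall k : 'I_n, box_row (transpose lam) (t k) = box_col lam k /\
    box_col (transpose lam) (t k) = box_row lam k) ->
  young (transpose lam) (g ^ t)%g = (-1) ^+ g * row_col lam g /\
  row_col (transpose lam) (g ^ t)%g = (-1) ^+ g * young lam g.
Proof.
move=> tP.
have rE q : (q ^ t)%g \in row_group n (transpose lam) = (q \in col_group n lam).
  apply/mem_row_group/mem_col_group => h k.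
    by have := h (t k); rewrite permJ !(tP _).1.
  by rewrite -[k](permKV t) permJ !(tP _).1.
have cE q : (q ^ t)%g \in col_group n (transpose lam) = (q \in row_group n lam).
  apply/mem_col_group/mem_row_group => h k.
    by have := h (t k); rewrite permJ !(tP _).2.
  by rewrite -[k](permKV t) permJ !(tP _).2.
have sJ (q : 'S_n) : (-1) ^+ (q ^ t)%g = (-1) ^+ q :> rat.
  by rewrite odd_permJ.
have rs q : rowsum (transpose lam) (q ^ t)%g = (-1) ^+ q * colsgn lam q :> rat.
  by rewrite /rowsum rE /colsgn mulrCA -signr_addb addbb mulr1.
have cs q : colsgn (transpose lam) (q ^ t)%g = (-1) ^+ q * rowsum lam q :> rat.
  by rewrite /colsgn cE sJ mulrC.
have sM (x y : 'S_n) : (-1) ^+ x * (-1) ^+ (x^-1 * y)%g = (-1) ^+ y :> rat.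
  by rewrite -signr_addb odd_permM odd_permV addbA addbb addFb.
split; rewrite /young /row_col !galgME mulr_sumr (reindex_inj (conjg_inj t)) /=; apply: eq_bigr => x _.
  by rewrite -conjVg -conjMg cs rs mulrACA sM.
by rewrite -conjVg -conjMg cs rs mulrACA sM.
Qed.

Lemma chi_transpose (g : 'S_n) : chi (transpose lam) g = (-1) ^+ g * chi lam g.
Proof.
have [t tP] := tbox_perm; have yE g' := young_transpose g' tP.
have cE : young_coef n (transpose lam) = young_coef n lam.
  rewrite /young_coef (reindex_inj (conjg_inj t)) /=; apply: eq_bigr => h _.
  have [-> ->] := yE h; rewrite mulrACA -signr_addb addbb mul1r.
  by rewrite -ginv_young /ginv mulrC.
have eE h : specht_idem (transpose lam) (h ^ t)%g = (-1) ^+ h * specht_idem lam h^-1%g.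
  rewrite /specht_idem cE !galgZE (yE h).1 mulrCA; congr (_ * (_ * _)).
  by rewrite -ginv_young /ginv invgK.
rewrite -[chi lam g]chiV /chi mulr_sumr (reindex_inj (mulIg t)) /=.
apply: eq_bigr => z _; rewrite (_ : _ * _ * _ = (g^-1 ^ z) ^ t)%g; last first.
  by rewrite !conjgE invMg !mulgA.
by rewrite eE odd_permJ odd_permV -conjVg conjgE mulgA.
Qed.

Lemma sgn_cyc (g : 'S_n) : (-1) ^+ g = (-1) ^+ (n + size (cyc g)) :> rat.
Proof.
rewrite /odd_perm card_ord (_ : #|porbits g| = size (cyc g)); last first.
  by rewrite parts_cyc size_sort size_map -cardE.
by rewrite -oddD signr_odd.
Qed.

Lemma chi_at_transpose rho : rho \in ptn n ->
  chi_at n (transpose lam) rho = (-1) ^+ (n + size rho) * chi_at n lam rho.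
Proof. by move=> /cyc_surj[w <-]; rewrite !chi_atE chi_transpose sgn_cyc. Qed.
End Twist.
End Transpose.

(** * Strips and the triangular matrices *)

Section Strips.
Implicit Types (lam mu nu th ka : intpart).

Definition vstrip (s t : seq nat) : bool :=
  all (fun i => nth 0 t i <= nth 0 s i <= (nth 0 t i).+1)%N (iota 0 (size s + size t)).

Lemma vstripP (s t : seq nat) : reflect (vertical_strip s t) (vstrip s t).
Proof.
apply: (iffP allP) => [h i|h i _]; last exact: h.
have [il|il] := ltnP i (size s + size t); first by apply: h; rewrite mem_iota.
by rewrite !nth_default // (leq_trans _ il) // ?leq_addr ?leq_addl.
Qed.

Lemma vstrip_sumn s t : vstrip s t -> (sumn t <= sumn s)%N.
Proof. by move=> /vstripP h; apply: leq_sumn_nth => i; case/andP: (h i). Qed.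

Section Toggle.
Variables (th th' : intpart) (i : nat).
Hypotheses (lo : (nth 0 th i.+1 <= nth 0 th' i)%N) (hi : (nth 0 th' i < nth 0 th i)%N).

Definition between ka := hstrip th ka && vstrip ka th'.

Definition toggle ka : intpart := to_intpart (mkseq (fun j =>
  if j == i then (nth 0 th' i).*2.+1 - nth 0 ka i else nth 0 ka j)%N (sumn ka + i).+2).

Lemma nth_toggle ka j : between ka -> nth 0%N (toggle ka) j =
  (if j == i then (nth 0 th' i).*2.+1 - nth 0 ka i else nth 0 ka j)%N.
Proof.
move=> /andP[/hstripP hs /vstripP vs]; rewrite /toggle.
rewrite (nth_mkpart (f := fun j => if j == i then ((nth 0 th' i).*2.+1 - nth 0 ka i)%N else nth 0%N ka j)) //.
  move=> k; case: (k.+1 =P i) => [e|_].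
    rewrite (_ : (k == i) = false); last by apply/eqP; lia.
    have := hs k; have := hs k.+1; have := vs k; have := vs k.+1; rewrite e; move: lo hi.
    have := @nth_intpart_le th' k i; have := @nth_intpart_le ka k i; lia.
  case: (k =P i) => [->|_].
    have := hs i; have := hs i.+1; have := vs i; move: lo hi; lia.
  exact: nth_intpart_le.
rewrite (_ : (_ == i) = false); last by apply/eqP; lia.
by rewrite nth_sumn_default // -!addnS leq_addr.
Qed.

Lemma between_toggle ka : between ka -> between (toggle ka).
Proof.
move=> b; have := b; move=> /andP[/hstripP hs /vstripP vs]; apply/andP; split.
  apply/hstripP => j; rewrite !nth_toggle //; have := hs j; have := hs j.+1; have := vs j.
  case: eqP => [->|_]; last by [].
  by move: lo hi (hs i) (vs i); lia.
apply/vstripP => j; rewrite !nth_toggle //; have := vs j.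
by case: eqP => // ->; lia.
Qed.

Lemma toggleK ka : between ka -> toggle (toggle ka) = ka.
Proof.
move=> b; apply: intpart_eq => j; rewrite nth_toggle ?between_toggle // !nth_toggle // eqxx.
by case: eqP => // ->; case/andP: b => _ /vstripP/(_ i); lia.
Qed.

Lemma sumn_toggle ka : between ka -> odd (sumn (toggle ka)) = ~~ odd (sumn ka).
Proof.
move=> b; have b' := between_toggle b; set K := (size ka + size (toggle ka) + i).+1.
rewrite (@sumn_nth (toggle ka) K) ?(@sumn_nth ka K); last 2 first.
- by rewrite /K; lia.
- by rewrite /K; lia.
have iK : (i < K)%N by rewrite /K; lia.
rewrite (bigD1 (Ordinal iK)) //= [in RHS](bigD1 (Ordinal iK)) //= !oddD.
rewrite nth_toggle // eqxx; set A := bigop _ _ _; set A' := bigop _ _ _.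
have -> : A = A'.
  by apply: eq_bigr => j ne; rewrite nth_toggle // -val_eqE /= in ne *; rewrite (negPf ne).
rewrite -addNb; congr (_ (+) _).
by case/andP: b => _ /vstripP/(_ i) h; rewrite oddB; [rewrite /= odd_double; case: (odd _) | lia].
Qed.
End Toggle.

Lemma toggle_exists th th' ka : between th th' ka -> th != th' ->
  exists i, (nth 0 th i.+1 <= nth 0 th' i)%N /\ (nth 0 th' i < nth 0 th i)%N.
Proof.
move=> /andP[/hstripP hs /vstripP vs] ne; apply: contrapT => h.
have dich i : nth 0%N th' i = nth 0%N th i \/
    (nth 0 th i.+1 = (nth 0 th' i).+1)%N.
  have := hs i; have := vs i.
  have [a|a] := leqP (nth 0%N th i.+1) (nth 0%N th' i); last by lia.
  have [c|c] := ltnP (nth 0%N th' i) (nth 0%N th i); last by lia.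
  by case: h; exists i.
have [i hi] : exists i, nth 0%N th' i <> nth 0%N th i.
  apply: contrapT => h'; case/eqP: ne; apply: intpart_eq => i.
  by apply: contrapT => hi; apply: h'; exists i => /esym.
have chain k : (0 < nth 0 th (i + k).+1)%N /\ nth 0%N th' (i + k) <> nth 0%N th (i + k).
  elim: k => [|k [IH1 IH2]]; first by rewrite addn0; case: (dich i) => // ->.
  rewrite addnS; case: (dich (i + k)%N) => // e.
  have le := @nth_intpart_le th' (i + k)%N (i + k)%N.+1 (leqnSn _).
  by case: (dich (i + k)%N.+1) => e'; split; lia.
by have [] := chain (sumn th); rewrite nth_sumn_default // leqW // leq_addl.
Qed.

(* Below [th] and above [th'], toggling one row reverses the sign. *)
Lemma sum_between N th th' : (sumn th <= N)%N ->
  \sum_(ka <- ptnle N | hstrip th ka && vstrip ka th') (-1) ^+ (sumn ka + sumn th') =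
  (th == th')%:R :> rat.
Proof.
move=> thN; have [<-|ne] := eqVneq th th'.
  rewrite (eq_bigl (fun ka => ka == th)) => [|ka].
    rewrite sum_delta ?ptnle_uniq // mem_ptnle thN -signr_odd addnn odd_double.
    by rewrite expr0.
  apply/andP/eqP => [[/hstripP hs /vstripP vs]|->].
    by apply: intpart_eq => i; have := hs i; have := vs i; lia.
  split; [apply/hstripP => i | apply/vstripP => i]; last by rewrite leqnn leqnSn.
  by split=> //; apply: nth_intpart_le.
set r := [seq ka : intpart <- ptnle N | hstrip th ka && vstrip ka th'].
rewrite -big_filter -/r; case rE : r => [|ka0 r0]; first by rewrite big_nil.
have b0 : between th th' ka0.
  have : ka0 \in r by rewrite rE inE eqxx.
  by rewrite mem_filter => /andP[].
rewrite -rE; have [i [lo hi]] := toggle_exists b0 ne.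
set S := bigop _ _ _; suff : S = - S by move: S => S; rewrite /= mulr0n; lra.
rewrite {1}/S (perm_big [seq toggle th' i ka | ka <- r]) /=.
  rewrite big_map /S -sumrN; apply: eq_big_seq => ka; rewrite mem_filter => /andP[b _].
  rewrite -signr_odd -[in RHS]signr_odd !oddD (sumn_toggle lo hi b).
  by rewrite addNb signrN.
have inr ka : ka \in r -> toggle th' i ka \in r.
  rewrite !mem_filter => /andP[b _]; have b' := between_toggle lo hi b.
  rewrite -/(between th th' _) b' mem_ptnle (leq_trans _ thN) //.
  by case/andP: b' => /hstrip_sumn.
have tK ka : ka \in r -> toggle th' i (toggle th' i ka) = ka.
  by rewrite mem_filter => /andP[b _]; exact: (toggleK lo hi b).
apply: uniq_perm.
- exact/filter_uniq/ptnle_uniq.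
- rewrite map_inj_in_uniq; first exact/filter_uniq/ptnle_uniq.
  by move=> ka ka' kr kr' e; rewrite -(tK _ kr) e tK.
move=> ka; apply/idP/mapP => [kr|[ka' kr ->]]; last exact: inr.
by exists (toggle th' i ka); rewrite ?tK // inr.
Qed.

End Strips.

Lemma sign_odd_eq (R : pzRingType) a b : odd a = odd b -> (-1) ^+ a = (-1) ^+ b :> R.
Proof. by move=> e; rewrite -signr_odd e signr_odd. Qed.

Section Inversion.
Implicit Types (lam mu nu th ka rho : intpart) (F G : mseries).

Lemma pairing_schur N F G :
  \sum_(th <- ptnle N) schur_coef F th * schur_coef G th = pairing N F G.
Proof.
have split_deg (f : intpart -> rat) :
    \sum_(th <- ptnle N) f th = \sum_(n < N.+1) \sum_(th <- ptn n) f th.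
  transitivity (\sum_(n < N.+1) \sum_(th <- ptnle N | sumn th == n) f th); last first.
    by apply: eq_bigr => n _; rewrite sum_ptnle // -ltnS.
  under [RHS]eq_bigr do rewrite big_mkcond.
  rewrite exchange_big; apply: eq_big_seq => th; rewrite mem_ptnle => tN /=.
  have tN' : (sumn th < N.+1)%N by rewrite ltnS.
  rewrite -big_mkcond /= (eq_bigl (fun n : 'I_N.+1 => n == Ordinal tN')) ?big_pred1_eq //.
  by move=> n; rewrite -val_eqE /= eq_sym.
rewrite /pairing sum_mons !split_deg; apply: eq_bigr => n _.
rewrite (eq_big_seq (fun th => \sum_(rho <- ptn n) \sum_(si <- ptn n)
   F (mono rho) * G (mono si) * zof (mono rho) * (idem_at n th rho * chi_at n th si))); last first.
  move=> th; rewrite mem_ptn => /eqP tn; rewrite /schur_coef tn mulr_suml.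
  apply: eq_big_seq => rho rn; rewrite mulr_sumr; apply: eq_bigr => si _.
  rewrite idem_at_zof //; have := zof_gt0 rho; move: (zof _) => z z0.
  by field; apply: lt0r_neq0.
rewrite exchange_big; apply: eq_big_seq => rho rn; rewrite exchange_big /=.
rewrite (eq_big_seq (fun si => if si == rho then F (mono rho) * G (mono si) * zof (mono rho) else 0)); last first.
  move=> si sn; rewrite -mulr_sumr idem_at_orth // eq_sym; case: eqP; rewrite ?mulr1 ?mulr0 //.
rewrite -big_mkcond sum_delta ?ptn_uniq // rn; ring.
Qed.

Definition Qsum lam : mseries :=
  \sum_(rho <- ptn (sumn lam)) idem_at (sumn lam) lam rho *: Qs rho.
Definition Lsum e lam : mseries :=
  \sum_(rho <- ptn (sumn lam)) idem_at (sumn lam) lam rho *: lynprod e rho.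

Lemma intpart_allgt0 lam : all (fun k => 0 < k)%N lam.
Proof. by apply/allP => k; exact: intpart_gt0. Qed.

Lemma intpart_perm lam mu : perm_eq lam mu = (lam == mu).
Proof.
apply/idP/eqP => [h|-> //]; apply: mono_part_inj; apply: cm_eq => i.
by rewrite !monoE; apply/seq.permP.
Qed.

Lemma pairing_LQ N lam mu : (sumn lam <= N)%N ->
  pairing N (Lsum (-1) mu) (Qsum lam) = (lam == mu)%:R.
Proof.
move=> lN.
transitivity (\sum_(si <- ptn (sumn mu)) \sum_(rho <- ptn (sumn lam))
   idem_at (sumn mu) mu si * idem_at (sumn lam) lam rho * ((rho == si)%:R * zof (mono rho))).
  transitivity (\sum_(si <- ptn (sumn mu)) \sum_(rho <- ptn (sumn lam))
     idem_at (sumn mu) mu si * idem_at (sumn lam) lam rho * pairing N (lynprod (-1) si) (Qs rho)).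
    rewrite /pairing; under [RHS]eq_bigr do under eq_bigr do rewrite mulr_sumr.
    under [RHS]eq_bigr do rewrite exchange_big.
    rewrite [RHS]exchange_big; apply: eq_bigr => m _ /=.
    rewrite /Lsum /Qsum !mseries_sumE [zof m * _]mulr_sumr mulr_suml; apply: eq_bigr => si _.
    rewrite mulr_sumr; apply: eq_bigr => rho _; rewrite !mseriesZE.
    by move: (zof m) (idem_at _ _ _) (idem_at _ _ _) (lynprod _ _ _) (Qs _ _) => *; ring.
  apply: eq_bigr => si _; apply: eq_big_seq => rho; rewrite mem_ptn => /eqP rn.
  by rewrite pairing_lynprod ?intpart_allgt0 // ?rn // intpart_perm.
have [e|ne] := eqVneq (sumn lam) (sumn mu); last first.
  rewrite (_ : (lam == mu) = false); last by apply: contraNF ne => /eqP ->.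
  rewrite big_seq big1 // => si; rewrite mem_ptn => /eqP sn; rewrite big_seq big1 // => rho.
  rewrite mem_ptn => /eqP rn; case: eqP => [h|]; last by rewrite mul0r mulr0.
  by case/eqP: ne; rewrite -rn h sn.
rewrite -(@chi_at_orth (sumn lam)) ?mem_ptn ?e // exchange_big; apply: eq_big_seq => rho rn /=.
rewrite (bigD1_seq rho) ?ptn_uniq //= eqxx mul1r [X in _ + X]big1 ?addr0; last first.
  by move=> si /negPf; rewrite eq_sym => ->; rewrite mul0r mulr0.
rewrite [idem_at _ lam _]idem_at_zof //; have := zof_gt0 rho; move: (zof _) => z z0.
by field; apply: lt0r_neq0.
Qed.

Lemma schur_coef_lsum mu th : schur_coef (Lsum (-1) mu) th =
  (-1) ^+ (sumn th + sumn mu) * schur_coef (Lsum 1 (transpose mu)) (transpose th).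
Proof.
rewrite /schur_coef sumn_transpose mulr_sumr; apply: eq_big_seq => si sn.
rewrite chi_at_transpose // /Lsum !mseries_sumE sumn_transpose !mulr_suml mulr_sumr.
apply: eq_big_seq => rho rn; rewrite !mseriesZE lynprod_twist.
have -> : idem_at (sumn mu) (transpose mu) rho =
    (-1) ^+ (sumn mu + size rho) * idem_at (sumn mu) mu rho.
  by rewrite !idem_at_zof // chi_at_transpose // mulrA.
have -> : mdeg (mono si) = size si.
  by rewrite /mono mdeg_prod; under eq_bigr do rewrite mdegU; rewrite sum1_size.
set A := idem_at _ _ _; set B := lynprod _ _ _; set C := chi_at _ _ _.
have -> : (-1) ^+ size rho * (-1) ^+ size si = (-1) ^+ (sumn th + sumn mu) *
    ((-1) ^+ (sumn mu + size rho) * (-1) ^+ (sumn th + size si)) :> rat.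
  by rewrite -!exprD; apply: sign_odd_eq; rewrite !oddD; do 4!case: (odd _).
by move: A B C ((-1) ^+ (sumn th + sumn mu)) ((-1) ^+ (sumn mu + size rho))
  ((-1) ^+ (sumn th + size si)) => *; ring.
Qed.

Definition acoefq lam ka : rat :=
  \sum_(th <- ptnle (sumn lam) | hstrip th ka) schur_coef (Qsum lam) th.

Definition bcoefq mu ka : rat :=
  \sum_(th <- ptnle (sumn ka) | vstrip ka th)
    (-1) ^+ (sumn ka + sumn mu) * schur_coef (Lsum 1 (transpose mu)) (transpose th).

Lemma schur_coef_Qsum0 lam th : (sumn lam < sumn th)%N -> schur_coef (Qsum lam) th = 0.
Proof.
move=> lt; rewrite /schur_coef big_seq big1 // => rho; rewrite mem_ptn => /eqP rn.
rewrite /Qsum mseries_sumE big_seq big1 ?mul0r // => si; rewrite mem_ptn => /eqP sn.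
by rewrite mseriesZE Qs_support ?mulr0 ?intpart_allgt0 // wdeg_mono rn sn.
Qed.

Lemma acoefqE N lam ka : (sumn lam <= N)%N ->
  acoefq lam ka = \sum_(th <- ptnle N | hstrip th ka) schur_coef (Qsum lam) th.
Proof.
move=> lN; rewrite /acoefq.
transitivity (\sum_(th <- ptnle N | (sumn th <= sumn lam)%N && hstrip th ka) schur_coef (Qsum lam) th).
  rewrite -big_filter_cond /=; apply: perm_big; apply: uniq_perm.
  - exact: ptnle_uniq.
  - exact/filter_uniq/ptnle_uniq.
  by move=> th; rewrite mem_filter !mem_ptnle; case: leqP => // h; rewrite (leq_trans h).
rewrite big_mkcond [RHS]big_mkcond; apply: eq_bigr => th _.
by case: leqP => //= h; rewrite schur_coef_Qsum0 ?if_same.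
Qed.

Lemma acoef_bcoef N lam mu : (sumn lam <= N)%N ->
  \sum_(ka <- ptnle N) acoefq lam ka * bcoefq mu ka = (lam == mu)%:R.
Proof.
move=> lN; rewrite -(pairing_LQ mu lN) -pairing_schur.
transitivity (\sum_(ka <- ptnle N) \sum_(th <- ptnle N) \sum_(th' <- ptnle N)
   if hstrip th ka && vstrip ka th' then
    schur_coef (Qsum lam) th * schur_coef (Lsum (-1) mu) th' * (-1) ^+ (sumn ka + sumn th') else 0).
  apply: eq_big_seq => ka; rewrite mem_ptnle => kN.
  rewrite (acoefqE _ lN) big_mkcond mulr_suml; apply: eq_bigr => th _.
  case: (hstrip th ka); last by rewrite mul0r big1.
  rewrite /bcoefq.
  transitivity (schur_coef (Qsum lam) th * \sum_(th' <- ptnle N | vstrip ka th')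
    (-1) ^+ (sumn ka + sumn mu) * schur_coef (Lsum 1 (transpose mu)) (transpose th')).
    congr (_ * _); transitivity (\sum_(th' <- ptnle N | (sumn th' <= sumn ka)%N && vstrip ka th')
      (-1) ^+ (sumn ka + sumn mu) * schur_coef (Lsum 1 (transpose mu)) (transpose th')).
      rewrite -big_filter_cond /=; apply: perm_big; apply: uniq_perm.
      - exact: ptnle_uniq.
      - exact/filter_uniq/ptnle_uniq.
      by move=> t; rewrite mem_filter !mem_ptnle; case: leqP => // h; rewrite (leq_trans h).
    apply: eq_bigl => t; case: (boolP (vstrip ka t)); rewrite ?andbF // => /vstrip_sumn ->.
    by [].
  rewrite big_mkcond mulr_sumr; apply: eq_bigr => th' _ /=.
  case: (vstrip ka th'); last by rewrite mulr0.
  rewrite schur_coef_lsum mulrA; move: (schur_coef _ _) (schur_coef _ _) => A B.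
  rewrite mulrAC mulrA mulrAC -!mulrA; congr (_ * _); rewrite [RHS]mulrCA -exprD [RHS]mulrC.
  by congr (_ * _); apply: sign_odd_eq; rewrite !oddD; do 3!case: (odd _).
rewrite exchange_big; apply: eq_big_seq => th; rewrite mem_ptnle => tN /=.
rewrite exchange_big /=.
rewrite (eq_bigr (fun th' => if th' == th then schur_coef (Qsum lam) th * schur_coef (Lsum (-1) mu) th' else 0)); last first.
  move=> th' _; rewrite -big_mkcond -mulr_sumr sum_between // eq_sym.
  by case: eqP; rewrite ?mulr1 ?mulr0.
by rewrite -big_mkcond sum_delta ?ptnle_uniq // mem_ptnle tN mulrC.
Qed.

Lemma bcoef_acoef N nu ka : (sumn nu <= N)%N -> (sumn ka <= N)%N ->
  \sum_(lam <- ptnle N) bcoefq lam nu * acoefq lam ka = (nu == ka)%:R.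
Proof.
move=> nN kN; apply: (@seq_matrix_inv _ _ (ptnle N) acoefq (fun ka lam => bcoefq lam ka)).
- exact: ptnle_uniq.
- by move=> a b; rewrite !mem_ptnle => aN _; apply: acoef_bcoef.
- by rewrite mem_ptnle.
by rewrite mem_ptnle.
Qed.

Lemma lynprod_support e (v : seq nat) m : all (fun j => 0 < j)%N v ->
  (wdeg m < sumn v)%N -> lynprod e v m = 0.
Proof.
elim: v m => [|j v IH] m //= /andP[j0 vg] lt; rewrite /lynprod big_cons mseriesME.
rewrite big_seq big1 // => a am; have := congr1 wdeg (divcmK am); rewrite wdegM => e1.
have [ja|aj] := leqP j (wdeg a).
  by rewrite -/(lynprod e v) IH ?mulr0 //; lia.
rewrite /lynser big1 ?mul0r // => d _; rewrite logser_large ?mulr0 ?muln_gt0 ?j0 //.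
by apply: leq_trans aj _; exact: leq_pmulr.
Qed.

Lemma bcoefq0 lam nu : ~~ (sumn lam <= sumn nu)%N -> bcoefq lam nu = 0.
Proof.
rewrite -ltnNge => lt; rewrite /bcoefq big1_seq // => th /andP[vs _].
rewrite /schur_coef big_seq big1 ?mulr0 // => rho; rewrite mem_ptn sumn_transpose => /eqP rn.
rewrite /Lsum mseries_sumE big_seq big1 ?mul0r // => si; rewrite mem_ptn => /eqP sn.
rewrite mseriesZE lynprod_support ?mulr0 ?intpart_allgt0 // wdeg_mono sn rn sumn_transpose.
exact: leq_ltn_trans (vstrip_sumn vs) lt.
Qed.

Lemma acoefq0 lam ka : (sumn lam < sumn ka)%N -> acoefq lam ka = 0.
Proof.
move=> lt; rewrite /acoefq big1_seq // => th /andP[/hstrip_sumn h].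
by rewrite mem_ptnle => h'; move: (leq_trans h h'); rewrite leqNgt lt.
Qed.

Lemma hall_schur_plethysm mu th :
  hall_schur th (plethysm (schur mu) lyndon_series) = schur_coef (Lsum 1 mu) th.
Proof.
rewrite -hall_schur_ev; congr hall_schur; rewrite plethysm_schur /Lsum ev_sum.
apply: eq_bigr => rho _; rewrite evZ /lynprod ev_prod; congr (_ *: _).
rewrite big_seq [RHS]big_seq; apply: eq_bigr => k kr.
by rewrite ev_lynser // (intpart_gt0 kr).
Qed.

End Inversion.

(** * Restriction of Schur functors *)

Section SubmodTrace.
Variables (F : fieldType) (n : nat).
Implicit Types (U L T : 'M[F]_n).

Lemma trace_in_submod U L T c : (U :=: L)%MS -> L *m L = c *: L -> c != 0 ->
  L *m T = T *m L -> \tr (in_submod U (val_submod (U := U) 1%:M *m T)) = c^-1 * \tr (L *m T).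
Proof.
move=> UL LL c0 LT; set P := in_submod U 1%:M *m val_submod 1%:M.
have LP : L *m P = L.
  have sLU : (L <= U)%MS by rewrite UL.
  by rewrite /P mulmxA -in_submodE -val_submodE in_submodK.
have PL : P *m L = c *: P.
  have /submxP[D vD] : (val_submod (U := U) 1%:M <= L)%MS by rewrite val_submod1 UL.
  by rewrite /P vD -!mulmxA LL -!scalemxAr.
rewrite in_submodE mxtrace_mulC mulmxA -/P -[P]scale1r -(mulVf c0) -scalerA -PL.
by rewrite -scalemxAl mxtraceZ -mulmxA LT mxtrace_mulC -mulmxA LP -LT.
Qed.
End SubmodTrace.

Section SpechtTrace.
Variables (C : numClosedFieldType) (n : nat) (lam : intpart).
Hypothesis lamn : sumn lam = n.
Local Notation G := [set: 'S_n]%G.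
Local Notation y := (young lam : galg 'S_n).

Lemma young_symmetrizerE j :
  young_symmetrizer C n lam 0 j = ratr (y (enum_val j)).
Proof.
rewrite /young_symmetrizer summxE.
under eq_bigr do rewrite summxE.
rewrite /young galgME rmorph_sum /= [RHS](bigID (mem (col_group n lam))) /= [X in _ = _ + X]big1 ?addr0.
  rewrite exchange_big; apply: eq_bigr => q qc /=.
  under eq_bigr do rewrite !mxE eqxx /=.
  rewrite /colsgn qc mul1r /rowsum rmorphM rmorph_sign /= ratr_nat.
  rewrite -mulr_sumr; congr (_ * _).
  have E p : (j == gring_index G (q * p)%g) = (p == q^-1 * enum_val j)%g.
    rewrite -(inj_eq enum_val_inj) gring_indexK ?inE // eq_sym.
    by apply/eqP/eqP => [<-|->]; rewrite ?mulKg ?mulKVg.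
  under eq_bigr do rewrite E.
  rewrite big_mkcond (bigD1 (q^-1 * enum_val j)%g) //= eqxx big1 ?addr0.
    by case: (_ \in row_group _ _).
  by move=> p /negPf ->; rewrite if_same.
by move=> q /negPf qc; rewrite /colsgn qc !mul0r rmorph0.
Qed.

Definition left_young_mx : 'M[C]_(gcard G) :=
  \matrix_(i, j) ratr (y (enum_val j * (enum_val i)^-1)%g).

Lemma left_young_mxJ x : left_young_mx *m regular_repr C G x = regular_repr C G x *m left_young_mx.
Proof.
apply/matrixP => i j; rewrite !mxE.
rewrite (bigD1 (gring_index G (enum_val j * x^-1)%g)) //= !mxE gring_indexK ?inE // mulgKV.
rewrite gring_valK !eqxx mulr1 big1 ?addr0 => [|k ne]; last first.
  rewrite !mxE eqxx /=; case: eqP => [e|]; last by rewrite mulr0.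
  case/eqP: ne; rewrite -[k](gring_valK (G := G)); congr gring_index.
  by rewrite e gring_indexK ?inE // mulgK.
rewrite (bigD1 (gring_index G (enum_val i * x)%g)) //= !mxE gring_indexK ?inE // !eqxx mul1r.
rewrite big1 ?addr0 => [|k ne]; last by rewrite !mxE eqxx /= (negPf ne) mul0r.
by rewrite invMg mulgA.
Qed.

Lemma sum_enum_val (V : nmodType) (f : 'S_n -> V) : \sum_(i < gcard G) f (enum_val i) = \sum_g f g.
Proof. by rewrite -(big_enum_val f) /=; apply: eq_bigl => g; rewrite inE. Qed.

Lemma left_young_mx_sq : left_young_mx *m left_young_mx = ratr (young_coef n lam) *: left_young_mx.
Proof.
apply/matrixP => i k; rewrite !mxE -rmorphM /=; under eq_bigr do rewrite !mxE -rmorphM /=.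
rewrite -rmorph_sum /=; congr ratr; rewrite -galgZE -young_sq // [in RHS]/young -/y galgME.
set gi := enum_val i; set gk := enum_val k.
rewrite (sum_enum_val (fun g => y (g * gi^-1)%g * y (gk * g^-1)%g)).
rewrite (reindex_inj (inj_comp (mulIg gk) (inj_comp invg_inj (mulIg 1%g)))) /=.
apply: eq_bigr => g _; rewrite mulg1 invMg invgK mulrC mulKVg mulgA.
by congr (_ * _); rewrite mulgA.
Qed.

Lemma specht_cyclic : (cyclic_mx (regular_repr C G) (young_symmetrizer C n lam) :=: left_young_mx)%MS.
Proof.
have rowE i : row i left_young_mx = young_symmetrizer C n lam *m regular_repr C G (enum_val i).
  apply/rowP => j; rewrite !mxE (bigD1 (gring_index G (enum_val j * (enum_val i)^-1)%g)) //=.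
  rewrite young_symmetrizerE !mxE gring_indexK ?inE // mulgKV gring_valK !eqxx mulr1 big1 ?addr0 //.
  move=> k ne; rewrite !mxE eqxx /=; case: eqP => [e|]; last by rewrite mulr0.
  case/eqP: ne; rewrite -[k](gring_valK (G := G)); congr gring_index.
  by rewrite e gring_indexK ?inE // mulgK.
apply/eqmxP/andP; split.
  apply: cyclic_mx_sub.
    apply/mxmoduleP => x _; rewrite left_young_mxJ; exact: submxMl.
  have := rowE (gring_index G 1%g); rewrite gring_indexK ?inE // repr_mx1 mulmx1 => <-.
  exact: row_sub.
apply/row_subP => i; rewrite rowE.
apply: submx_trans (submxMr _ (cyclic_mx_id _ _)) _.
by apply: (mxmoduleP (cyclic_mx_module _ _)); rewrite inE.
Qed.

Lemma specht_trace g : \tr (specht C n lam g) = ratr (chi lam g).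
Proof.
rewrite /= /submod_mx (trace_in_submod specht_cyclic left_young_mx_sq) ?left_young_mxJ //; last first.
  by rewrite fmorph_eq0 young_coef_neq0.
rewrite -fmorphV /mxtrace.
transitivity (ratr (young_coef n lam)^-1 * \sum_(i < gcard G) ratr (y (enum_val i * g^-1 * (enum_val i)^-1)%g) : C).
  congr (_ * _); apply: eq_bigr => i _; rewrite !mxE.
  rewrite (bigD1 (gring_index G (enum_val i * g)%g)) //= !mxE gring_indexK ?inE // !eqxx mul1r big1 ?addr0.
    by rewrite invMg mulgA.
  by move=> k ne; rewrite !mxE eqxx /= (negPf ne) mul0r.
rewrite (sum_enum_val (fun h => ratr (y (h * g^-1 * h^-1)%g) : C)) -rmorph_sum -rmorphM; congr ratr.
rewrite /chi mulr_sumr [RHS](reindex_inj invg_inj) /=; apply: eq_bigr => h _.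
by rewrite /specht_idem galgZE invgK.
Qed.

End SpechtTrace.

Section SchurTrace.
Variables (C : numClosedFieldType) (lam : intpart) (t : nat).
Local Notation n := (sumn lam).
Local Notation y := (young lam : galg 'S_n).

Lemma place_mxM (w w' : 'S_n) : place_mx C t w *m place_mx C t w' = place_mx C t (w' * w)%g.
Proof.
apply/matrixP => i j; rewrite !mxE.
rewrite (bigD1 (enum_rank ([ffun k => tindex i (w k)] : tbasis n t))) //=.
rewrite !mxE /tindex enum_rankK eqxx mul1r big1 ?addr0.
  by congr (_ == _)%:R; apply/ffunP => k; rewrite !ffunE permM.
move=> u /eqP ui; rewrite mxE; case: eqP; rewrite ?mul0r // => e.
by case: ui; rewrite -e enum_valK.
Qed.

Lemma young_mxE : young_mx C t lam = \sum_g ratr (y g) *: place_mx C t g.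
Proof.
rewrite /young_mx mulmx_suml.
transitivity (\sum_(p in row_group n lam) \sum_g ratr ((colsgn lam : galg 'S_n) (g * p^-1)%g) *: place_mx C t g : 'M[C]_#|{: tbasis n t}|).
  apply: eq_bigr => p _; rewrite mulmx_sumr [RHS](reindex_inj (mulIg p)) big_mkcond /=.
  apply: eq_bigr => q _; rewrite mulgK /colsgn; case: ifP => _; last by rewrite mul0r rmorph0 scale0r.
  by rewrite -scalemxAr place_mxM mul1r rmorph_sign.
rewrite exchange_big; apply: eq_bigr => g _ /=; rewrite -scaler_suml -rmorph_sum /=.
congr (ratr _ *: _); rewrite /young galgME [RHS](reindex_inj (inj_comp (mulgI g) invg_inj)) /=.
rewrite big_mkcond; apply: eq_bigr => p _; rewrite invMg invgK mulgKV /rowsum.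
by case: ifP; rewrite ?mulr1 ?mulr0.
Qed.

Lemma young_mx_sq : young_mx C t lam *m young_mx C t lam = ratr (young_coef n lam) *: young_mx C t lam.
Proof.
rewrite young_mxE mulmx_suml; under eq_bigr do rewrite mulmx_sumr.
transitivity (\sum_g \sum_h ratr (y g * y (h * g^-1)%g) *: place_mx C t h : 'M[C]_#|{: tbasis n t}|).
  apply: eq_bigr => g _; rewrite [RHS](reindex_inj (mulIg g)) /=; apply: eq_bigr => h _.
  by rewrite mulgK rmorphM -scalemxAl -scalemxAr scalerA place_mxM.
rewrite exchange_big scaler_sumr; apply: eq_bigr => h _ /=; rewrite scalerA -rmorphM /=.
rewrite -scaler_suml -rmorph_sum; congr (ratr _ *: _).
rewrite -galgZE -young_sq // galgME [RHS](reindex_inj (inj_comp (mulgI h) invg_inj)) /=.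
by apply: eq_bigr => g _; rewrite invMg invgK mulgKV mulrC.
Qed.

Lemma iter_fixed T (g : {perm T}) (a : T) j : (iter j g a == a) = (#|porbit g a| %| j)%N.
Proof.
set k := #|porbit g a|; have k0 : (0 < k)%N.
  by rewrite /k -(card1 a) subset_leq_card //; apply/fintype.subsetP => x; rewrite inE => /eqP ->; exact: porbit_id.
have itk q : iter (q * k) g a = a by elim: q => // q IH; rewrite mulSn iterD IH iter_porbit.
rewrite {1}(divn_eq j k) addnC iterD itk /dvdn.
have rk : (j %% k < k)%N by rewrite ltn_mod.
have nthE i : (i < k)%N -> nth a (traject g a k) i = iter i g a by move=> ik; rewrite nth_traject.
rewrite -(nthE _ rk) -[X in _ == X]/(iter 0 g a) -(nthE _ k0).
by rewrite nth_uniq ?size_traject ?uniq_traject_porbit.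
Qed.

Lemma card_fixed (g : 'S_t) j : (0 < j)%N ->
  (\sum_a (iter j g a == a))%N = weight j (mono (cyc g)).
Proof.
move=> j0; under eq_bigr do rewrite iter_fixed.
rewrite (partition_big (porbit g) (mem (porbits g))) /=; last by move=> a _; exact: imset_f.
transitivity (\sum_(O in porbits g) (#|O| %| j) * #|O|)%N.
  apply: eq_bigr => O OP; rewrite (eq_bigr (fun=> (#|O| %| j)%N : nat)); last by move=> a /eqP ->.
  rewrite sum_nat_const mulnC; congr (_ * _)%N; apply: eq_card => a.
  rewrite -[LHS]/(porbit g a == O).
  apply/eqP/idP => [<-|aO]; first exact: porbit_id.
  by rewrite (porbit_eq OP aO).
rewrite /weight; under [RHS]eq_bigr do rewrite monoE.
have -> : (\sum_(O in porbits g) (#|O| %| j) * #|O| = \sum_(k <- parts (cyc g)) (k %| j) * k)%N.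
  by rewrite parts_cyc (perm_big (orbit_sizes g)) ?perm_sort //= big_map big_enum.
transitivity (\sum_(d <- divisors j) \sum_(k <- cyc g | k == d) d)%N; last first.
  by apply: eq_bigr => d _; rewrite -sum1_count big_distrr /=; apply: eq_bigr => k _; rewrite muln1.
under [RHS]eq_bigr do rewrite big_mkcond.
rewrite exchange_big; apply: eq_bigr => k _ /=.
rewrite -big_mkcond (eq_bigl (fun d => d == k)) => [|d]; last by rewrite eq_sym.
rewrite -big_filter; case: (boolP (k %| j)%N) => kj; last first.
  rewrite big_filter big_seq_cond big1 // => d /andP[]; rewrite -dvdn_divisors // => dj /eqP e.
  by rewrite -e dj in kj.
rewrite filter_pred1_uniq ?divisors_uniq ?big_seq1 ?mul1n // -dvdn_divisors //.
Qed.

Lemma trace_place_tensor (u : 'S_n) (g : 'S_t) :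
  \tr (place_mx C t u *m tensor_mx n (perm_mx g)) =
  (\prod_(j <- cyc u) weight j (mono (cyc g)))%:R.
Proof.
have e (f : tbasis n t) : \sum_j (place_mx C t u) (enum_rank f) j *
     (tensor_mx n (perm_mx g)) j (enum_rank f) = \prod_k (g (f (u k)) == f k)%:R.
  rewrite (bigD1 (enum_rank ([ffun k => f (u k)] : tbasis n t))) //=.
  rewrite !mxE /tindex !enum_rankK eqxx mul1r [X in _ + X]big1 ?addr0; last first.
    move=> v /eqP ui; rewrite !mxE /tindex enum_rankK; case: eqP; rewrite ?mul0r // => e.
    by case: ui; rewrite -e enum_valK.
  by apply: eq_bigr => k _; rewrite !mxE !ffunE.
rewrite /mxtrace (reindex (@enum_rank (tbasis n t))) /=; last first.
  by exists enum_val => x _; rewrite ?enum_rankK ?enum_valK.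
rewrite (eq_bigr (fun f : tbasis n t => \prod_k (g (f (u k)) == f k)%:R)); last first.
  by move=> f _; rewrite mxE e.
pose M (a b : 'I_t) : C := (g b == a)%:R.
rewrite (sum_prod_cyc M u) natr_prod big_seq [RHS]big_seq; apply: eq_bigr => j ju.
rewrite -card_fixed ?(intpart_gt0 ju) // natr_sum; apply: eq_bigr => a _.
have wE k b : walk M k a b = (iter k g b == a)%:R.
  elim: k b => [|k IH] b; first by rewrite /= eq_sym.
  rewrite walkSr (bigD1 (g b)) //= /M IH eqxx mulr1 -iterSr big1 ?addr0 //.
  by move=> c; rewrite eq_sym => /negPf ->; rewrite mulr0.
by rewrite wE.
Qed.

Definition schur_res_char (rho : intpart) : rat :=
  \sum_(si <- ptn n) idem_at n lam si * (\prod_(j <- si) weight j (mono rho))%:R.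

Lemma schur_functor_trace (g : 'S_t) :
  \tr (schur_functor_Res C t lam g) = ratr (schur_res_char (cyc g)).
Proof.
rewrite /= /schur_functor_mx (trace_in_submod (eqmx_refl _) young_mx_sq) ?young_tensorC //; last first.
  by rewrite fmorph_eq0 young_coef_neq0.
rewrite -young_tensorC young_mxE mulmx_suml linear_sum mulr_sumr /=.
rewrite /schur_res_char -(@sum_idem_cyc (sumn lam) lam (fun si => (\prod_(j <- si) weight j (mono (cyc g)))%:R)).
rewrite [RHS]rmorph_sum; apply: eq_bigr => u _ /=.
rewrite -scalemxAl mxtraceZ trace_place_tensor rmorphM /= ratr_nat mulrA; congr (_ * _).
by rewrite /specht_idem galgZE rmorphM fmorphV.
Qed.

End SchurTrace.

Section SameTrace.
Variables (C : numClosedFieldType) (gT : finGroupType) (G : {group gT}).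
Implicit Types (sG : irrType C G).

Lemma pchar'G : pgroup.pgroup [pchar C]^' G.
Proof. by apply/pgroup.pgroupP => p _ _; rewrite inE /= pchar_num. Qed.

Lemma perm_map_exists (T T' : eqType) (f : T -> T') (s : seq T) (s' : seq T') :
  perm_eq (map f s) s' -> exists2 e, perm_eq s e & map f e = s'.
Proof.
elim: s' s => [|y s' IH] s.
  by case: s => [|x s]; [exists [::] | move/perm_size].
move=> p; have : y \in map f s by rewrite (perm_mem p) inE eqxx.
case/mapP => x xs yE; have px := perm_to_rem xs.
have : perm_eq (map f (rem x s)) s'.
  by rewrite -(perm_cons y) {1}yE -map_cons -(permPl (perm_map f px)).
case/IH => e pe <-; exists (x :: e); last by rewrite /= -yE.
by rewrite (permPl px) perm_cons.
Qed.

Lemma rsim_irr_sum n (rG : mx_representation C G n) sG :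
  exists s : seq sG, forall s', perm_eq s s' ->
    mx_rsim rG (\big[dadd_grepr/grepr0]_(x <- s') (Representation (irr_repr x) : representation C G)).
Proof.
apply/asboolP.
apply: (mx_reducible_semisimple (mxmodule1 rG) (mx_Maschke_pchar rG pchar'G)).
case=> I U W simU defW dxW; apply/asboolP.
pose modU i := mxsimple_module (simU i).
pose c i := irr_comp sG (submod_repr (modU i)).
exists (map c (enum I)) => s' /perm_map_exists[e pe <-].
rewrite big_map; case: e pe => [|i0 e0] pe.
  have I0 (i : I) : False by have := mem_enum I i; rewrite (perm_mem pe).
  rewrite big_nil; have n0 : n = 0%N.
    by rewrite -(mxrank1 C n) -defW /W big1 ?mxrank0 // => i; case: (I0 i).
  exists (0 : 'M_(n, 0)); first by rewrite n0.
    by rewrite /row_free n0 -leqn0 rank_leq_row.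
  by move=> x _; rewrite mulmx0 mul0mx.
set e := i0 :: e0 in pe *.
rewrite (big_nth i0) big_mkord.
pose U' (k : 'I_(size e)) := U (nth i0 e k).
have bigE (R : Type) (idx : R) (op : Monoid.com_law idx) (f : I -> R) :
    \big[op/idx]_(k < size e) f (nth i0 e k) = \big[op/idx]_i f i.
  by rewrite -[RHS]big_enum (perm_big _ pe) (big_nth i0) big_mkord.
have defS : (\sum_k U' k :=: 1%:M)%MS by rewrite /U' bigE.
have dxS : mxdirect (\sum_k U' k).
  apply/mxdirectP; rewrite /= /U' bigE (bigE _ _ _ (fun i => \rank (U i))).
  exact: (mxdirectP dxW).
apply: mx_rsim_trans (mx_rsim_sym (rsim_submod1 (mxmodule1 rG) _)) _ => //.
have := @mx_rsim_dsum _ _ _ _ rG 'I_(size e) xpredT U'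
  (fun k => Representation (irr_repr (c (nth i0 e k)))) 1%:M
  (fun k => modU (nth i0 e k)) (mxmodule1 rG) defS dxS.
apply=> k /=.
apply: (rsim_irr_comp_pchar _ pchar'G); apply/submod_mx_irr; exact: simU.
Qed.

Lemma trace_dadd_big (I : Type) (s : seq I) (R : I -> representation C G) g :
  \tr ((\big[dadd_grepr/grepr0]_(x <- s) R x) g) = \sum_(x <- s) \tr (R x g).
Proof.
elim: s => [|x s IH]; first by rewrite !big_nil /= mxtrace1.
by rewrite !big_cons /= mxtrace_block IH.
Qed.

Lemma count_irr_trace sG (s s' : seq sG) :
  {in G, forall g, \sum_(x <- s) \tr (irr_repr x g) = \sum_(x <- s') \tr (irr_repr x g)} ->
  perm_eq s s'.
Proof.
move=> h; apply/allP => k _ /=; apply/eqP.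
have [a aE] : exists a, Wedderburn_id k = \sum_(x in G) a x *: regular_repr C G x.
  by apply/envelop_mxP; rewrite -(Wedderburn_sum_pchar sG pchar'G) (sumsmx_sup k) ?Wedderburn_id_mem.
have trE (x : sG) : \sum_(g in G) a g * \tr (irr_repr x g) = (x == k)%:R * (irr_degree k)%:R.
  transitivity (\tr (gring_op (irr_repr x) (Wedderburn_id k))).
    rewrite aE linear_sum linear_sum; apply: eq_bigr => g gG /=.
    by rewrite linearZ /= mxtraceZ gring_opG.
  have [->|ne] := eqVneq x k; first by rewrite (op_Wedderburn_id_pchar pchar'G) mxtrace1 mul1r.
  by rewrite (irr_repr'_op0_pchar pchar'G _ (Wedderburn_id_mem k)) ?linear0 ?mul0r // eq_sym.
have cE (r : seq sG) : (count_mem k r * irr_degree k)%:R =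
    \sum_(g in G) a g * \sum_(x <- r) \tr (irr_repr x g).
  under eq_bigr do rewrite mulr_sumr.
  rewrite exchange_big natrM -sum1_count natr_sum mulr_suml big_mkcond.
  by apply: eq_bigr => x _; rewrite /= trE; case: eqP; rewrite ?mul1r ?mul0r.
have : (count_mem k s * irr_degree k)%:R = (count_mem k s' * irr_degree k)%:R :> C.
  by rewrite !cE; apply: eq_bigr => g gG; rewrite h.
by move/eqP; rewrite eqr_nat eqn_pmul2r ?irr_degree_gt0 // => /eqP.
Qed.

Lemma rsim_of_trace n1 n2 (rG1 : mx_representation C G n1) (rG2 : mx_representation C G n2) :
  {in G, forall g, \tr (rG1 g) = \tr (rG2 g)} -> mx_rsim rG1 rG2.
Proof.
move=> h; pose sG : irrType C G := DecSocleType (regular_repr C G).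
have [s1 h1] := rsim_irr_sum rG1 sG; have [s2 h2] := rsim_irr_sum rG2 sG.
have ps : perm_eq s1 s2.
  apply: count_irr_trace => g gG.
  have trE (s : seq sG) := trace_dadd_big s (fun x => Representation (irr_repr x)) g.
  rewrite -!trE.
  by rewrite -(mxtrace_rsim (h1 _ (perm_refl _))) // -(mxtrace_rsim (h2 _ (perm_refl _))) // h.
exact: mx_rsim_trans (h1 _ ps) (mx_rsim_sym (h2 _ (perm_refl _))).
Qed.

End SameTrace.

Section Multiplicities.
Variable C : numClosedFieldType.
Implicit Types (lam nu ka th rho : intpart).

Lemma ev_Qsum lam : ev (Qsum lam) =
  \sum_(th <- ptnle (sumn lam)) schur_coef (Qsum lam) th *: schur th.
Proof.
apply: funext => al; rewrite ev_schur mseries_sumE.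
transitivity (\sum_(th <- ptnle (maxn (sumn lam) (mdeg al)) | sumn th == mdeg al)
   schur_coef (Qsum lam) th * schur th al); first by rewrite sum_ptnle ?leq_maxr.
transitivity (\sum_(th <- ptnle (maxn (sumn lam) (mdeg al)) | (sumn th <= sumn lam)%N)
   schur_coef (Qsum lam) th * schur th al).
  rewrite big_mkcond [RHS]big_mkcond; apply: eq_bigr => th _.
  case: eqP => [_|/eqP ne]; last by rewrite schur_homog0 1?eq_sym // mulr0 if_same.
  by case: leqP => // h; rewrite schur_coef_Qsum0 // mul0r.
rewrite -big_filter; apply: perm_big; apply: uniq_perm.
- exact/filter_uniq/ptnle_uniq.
- exact: ptnle_uniq.
by move=> th; rewrite mem_filter !mem_ptnle; case: leqP => //= h; rewrite (leq_trans h) ?leq_maxl.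
Qed.

Lemma schur_coef_HsQ lam : schur_coef (Hs * Qsum lam) = fun ka =>
  \sum_(th <- ptnle (sumn lam) | hstrip ka th) schur_coef (Qsum lam) th.
Proof.
apply: schur_sum_eq => al; rewrite -ev_schur evM ev_Hs ev_Qsum mulr_sumr mseries_sumE.
under [RHS]eq_bigr do rewrite mulr_suml big_mkcond.
rewrite exchange_big; apply: eq_bigr => th _ /=.
rewrite -scalerAr mseriesZE pieri mulr_sumr big_mkcond; apply: eq_bigr => ka _.
by [].
Qed.

Lemma schur_res_char_coef lam t ka : sumn ka = t ->
  \sum_(g : 'S_t) specht_idem ka g * schur_res_char lam (cyc g) = schur_coef (Hs * Qsum lam) ka.
Proof.
move=> kt; rewrite sum_idem_cyc /schur_coef kt; apply: eq_big_seq => rho rn.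
have -> : (Hs * Qsum lam) (mono rho) = schur_res_char lam rho / zof (mono rho).
  rewrite /Qsum mulr_sumr mseries_sumE /schur_res_char mulr_suml; apply: eq_bigr => si _.
  by rewrite -scalerAr mseriesZE Hs_Qs ?intpart_allgt0 // mulrA.
by rewrite idem_at_zof // mulrC mulrA mulrAC.
Qed.

Lemma schur_coef_HsQ_nat lam t ka : sumn ka = t ->
  exists m : nat, schur_coef (Hs * Qsum lam) ka = m%:R.
Proof.
move=> kt; pose S := schur_functor_Res C t lam.
pose E := \sum_g ratr ((specht_idem ka : galg 'S_t) g) *: S g.
have EE : E *m E = 1 *: E.
  rewrite scale1r /E mulmx_suml; under eq_bigr do rewrite mulmx_sumr.
  transitivity (\sum_g \sum_h ratr (specht_idem ka g * specht_idem ka (g^-1 * h)%g) *: S h).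
    apply: eq_bigr => g _; rewrite [RHS](reindex_inj (mulgI g)); apply: eq_bigr => h _.
    by rewrite mulKg -scalemxAl -scalemxAr scalerA -repr_mxM ?inE // [in RHS]rmorphM.
  rewrite exchange_big; apply: eq_bigr => h _ /=.
  by rewrite -scaler_suml -rmorph_sum /= -galgME specht_idemM.
exists (\rank E); apply: (fmorph_inj (ratr : rat -> C)); rewrite /= ratr_nat -[RHS]mul1r.
rewrite -(mxtrace_quasi_idem EE) /E linear_sum /= -(schur_res_char_coef lam kt) rmorph_sum.
apply: eq_bigr => g _; rewrite mxtraceZ rmorphM /=; congr (_ * _).
exact/esym/schur_functor_trace.
Qed.

Definition pad t nu := to_intpart (padded t nu).

Lemma mem_padded_shapes t nu : (nu \in padded_shapes t) = (head 0 nu + sumn nu <= t)%N.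
Proof.
rewrite in_fset_set; first by apply/idP/idP => [/set_mem|h] //; apply/mem_set.
apply: sub_finite_set (finite_intpart t) => ka /=; apply: leq_trans; exact: leq_addl.
Qed.

Lemma parts_pad t nu : (0 < t)%N -> nu \in padded_shapes t -> parts (pad t nu) = padded t nu.
Proof.
rewrite mem_padded_shapes => t0 h; rewrite /pad to_intpartE.
  apply/all_filterP; rewrite /padded /= subn_gt0; apply/andP; split; last exact: intpart_allgt0.
  case: nu h => -[|x s] /= i; first by rewrite addn0.
  by have := intpart_gt0 (k := x) (lam := IntPart i); rewrite inE eqxx => /(_ isT); lia.
have := intpart_sorted nu; rewrite /padded; case: (parts nu) h => //= x s h ->.
by rewrite andbT; lia.
Qed.

Lemma pad_inj t nu ka : (0 < t)%N -> nu \in padded_shapes t -> ka \in padded_shapes t ->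
  pad t nu = pad t ka -> nu = ka.
Proof.
move=> t0 ns ks e; have := congr1 parts e; rewrite !parts_pad // /padded => -[_ e'].
exact: val_inj.
Qed.

Lemma sumn_pad t nu : (0 < t)%N -> nu \in padded_shapes t -> sumn (pad t nu) = t.
Proof.
move=> t0 ns; rewrite parts_pad // /padded /= subnK //.
by move: ns; rewrite mem_padded_shapes; apply: leq_trans; exact: leq_addl.
Qed.

Lemma ptn_pad t : (0 < t)%N -> perm_eq (ptn t) [seq pad t nu | nu <- padded_shapes t].
Proof.
move=> t0; apply: uniq_perm; first exact: ptn_uniq.
  rewrite map_inj_in_uniq ?fset_uniq // => nu ka ns ks; exact: pad_inj.
move=> K; rewrite mem_ptn; apply/eqP/mapP => [Kt|[nu ns ->]]; last exact: sumn_pad.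
have b : is_intpart (behead K).
  case: K {Kt} => -[|x s] //= /andP[p]; rewrite inE negb_or => /andP[_ s0].
  by rewrite /is_intpart s0 (path_sorted p).
pose nu := IntPart b.
have ns : nu \in padded_shapes t.
  rewrite mem_padded_shapes -Kt /nu /=; have := intpart_sorted K.
  case: (parts K) => //= x [|x' s] //= /andP[/= h _]; by rewrite leq_add2r.
exists nu => //; apply: val_inj; rewrite [RHS]parts_pad // /padded /nu /= -Kt.
have : (0 < sumn K)%N by rewrite Kt.
by case: (parts K) => //= x s _; rewrite addnK.
Qed.

Lemma trace_multiplicity t (m : intpart -> nat) g : (0 < t)%N ->
  \tr ((\big[dadd_grepr/grepr0]_(nu <- padded_shapes t)
     muln_grepr (specht C t (padded t nu)) (m nu)) g) =
  ratr (\sum_(nu <- padded_shapes t) (m nu)%:R * chi (n := t) (pad t nu) g).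
Proof.
move=> t0; rewrite trace_dadd_big rmorph_sum; apply: eq_big_seq => nu ns /=.
rewrite /muln_grepr trace_dadd_big sumr_const card_ord -parts_pad //.
by rewrite specht_trace ?sumn_pad // rmorphM /= ratr_nat mulr_natl.
Qed.

Lemma is_multiplicityP t lam (m : intpart -> nat) : (0 < t)%N ->
  is_multiplicity C t lam m <->
  {in padded_shapes t, forall nu, (m nu)%:R = schur_coef (Hs * Qsum lam) (pad t nu)}.
Proof.
move=> t0; split=> [sim ka ks|h].
  have trE g : schur_res_char lam (cyc g) =
      \sum_(nu <- padded_shapes t) (m nu)%:R * chi (n := t) (pad t nu) g.
    apply: (fmorph_inj (ratr : rat -> C)); rewrite /= -schur_functor_trace -trace_multiplicity //.
    by apply: mxtrace_rsim sim _ _; rewrite inE.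
  rewrite -(schur_res_char_coef lam (sumn_pad t0 ks)); under eq_bigr do rewrite trE mulr_sumr.
  rewrite exchange_big /= (eq_big_seq (fun nu => if nu == ka then (m ka)%:R else 0)).
    by rewrite -big_mkcond sum_delta ?fset_uniq // ks.
  move=> nu ns /=; under eq_bigr do rewrite mulrCA.
  rewrite -mulr_sumr chi_orth ?mem_ptn ?sumn_pad //.
  have [->|ne] := eqVneq nu ka; first by rewrite eqxx mulr1.
  rewrite (_ : (pad t ka == pad t nu) = false) ?mulr0 //.
  by apply: contraNF ne => /eqP/(pad_inj t0 ks ns) ->.
apply: rsim_of_trace => g _; rewrite schur_functor_trace trace_multiplicity //; congr ratr.
have ratrE (x : rat) : ratr x = x by rewrite /ratr divq_num_den.
rewrite (@class_fun_expand t rat (fun g => schur_res_char lam (cyc g))); last by move=> a b ->.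
rewrite (perm_big _ (ptn_pad t0)) big_map; apply: eq_big_seq => nu ns.
rewrite h // ratrE -(schur_res_char_coef lam (sumn_pad t0 ns)); congr (_ * _).
by apply: eq_bigr => w _; rewrite ratrE.
Qed.

Lemma acoef_atE t lam ka : (0 < t)%N -> ka \in padded_shapes t ->
  (acoef_at C t lam ka)%:R = schur_coef (Hs * Qsum lam) (pad t ka).
Proof.
move=> t0 ks; rewrite /acoef_at; case: xgetP => [m _ /(is_multiplicityP lam _ t0)|no]; first exact.
have ex nu : exists m : nat, nu \in padded_shapes t -> schur_coef (Hs * Qsum lam) (pad t nu) = m%:R.
  case: (boolP (nu \in padded_shapes t)) => ns; last by exists 0%N.
  by have [m mE] := schur_coef_HsQ_nat lam (sumn_pad t0 ns); exists m.
have [m mP] := choice ex.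
by case: (no m); apply/is_multiplicityP => // nu ns; rewrite mP.
Qed.

Lemma hstrip_pad t ka th : (0 < t)%N -> ka \in padded_shapes t -> (sumn th + sumn ka <= t)%N ->
  hstrip (pad t ka) th = hstrip th ka.
Proof.
move=> t0 ks tt; have nE i : nth 0%N (pad t ka) i = if i is j.+1 then nth 0%N ka j else (t - sumn ka)%N.
  by rewrite parts_pad //; case: i.
apply/hstripP/hstripP => h i.
  have [h1 h2] := h i; have [h3 h4] := h i.+1; rewrite !nE in h1 h2 h3 h4; split => //.
rewrite !nE; case: i => [|i].
  split; first by have := nth_le_sumn th 0; move: tt; lia.
  by case: (h 0%N).
by have [h1 h2] := h i; have [h3 h4] := h i.+1; split.
Qed.

Lemma acoefE lam ka : (acoef C lam ka)%:R = acoefq lam ka.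
Proof.
pose t0 := (sumn lam + (head 0 ka + sumn ka)).+1%N.
have large t : (t0 <= t)%N -> (acoef_at C t lam ka)%:R = acoefq lam ka.
  move=> tt; have tpos : (0 < t)%N by apply: leq_ltn_trans tt.
  have ks : ka \in padded_shapes t by rewrite mem_padded_shapes; move: tt; rewrite /t0; lia.
  rewrite acoef_atE // schur_coef_HsQ /acoefq big_mkcond [RHS]big_mkcond; apply: eq_big_seq => th.
  by rewrite mem_ptnle => tl; rewrite hstrip_pad //; move: tt; rewrite /t0; lia.
rewrite /acoef; case: xgetP => [a _ [t1 h]|/(_ (acoef_at C t0 lam ka))[]].
  by rewrite -(h (maxn t0 t1)) ?leq_maxr // large ?leq_maxl.
exists t0 => t tt; apply/eqP; rewrite -(eqr_nat rat); apply/eqP.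
by rewrite !large.
Qed.

End Multiplicities.

(** * Cyclic idempotents on words *)

Lemma sum_multiples (V : nmodType) k d (F : nat -> V) : (0 < k)%N ->
  \sum_(0 <= c < k * d | (k %| c)%N) F c = \sum_(i < d) F (k * i)%N.
Proof.
move=> k0; elim: d => [|d IH]; first by rewrite muln0 big_geq // big_ord0.
rewrite (@big_cat_nat _ _ _ (k * d)) ?leq_pmul2l //= IH big_ord_recr /=; congr (_ + _).
rewrite big_ltn_cond ?ltn_pmul2l // dvdn_mulr // big_nat_cond big1 ?addr0 //.
move=> c /andP[/andP[h1 h2] /dvdnP[q e]]; move: h1 h2.
by rewrite e [(q * k)%N]mulnC !ltn_pmul2l // ltnS => /leq_trans h /h; rewrite ltnn.
Qed.

Section Ramanujan.
Local Open Scope nat_scope.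
Variables (F : fieldType) (m : nat) (z : F).
Hypotheses (m0 : 0 < m) (zm : m.-primitive_root z).

Lemma sum_root_powers e : 0 < e -> e %| m ->
  (\sum_(i < e) (z ^+ (m %/ e)) ^+ i = (e == 1)%:R)%R.
Proof.
move=> e0 em; set y := (z ^+ _)%R.
have ye : e.-primitive_root y by exact: dvdn_prim_root.
have [->|e1] := eqVneq e 1; first by rewrite big_ord1.
have y1 : (y - 1 != 0)%R.
  by rewrite subr_eq0 -[y]expr1 -(prim_order_dvd ye) dvdn1.
by apply: (mulfI y1); rewrite -subrX1 prim_expr_order // subrr mulr0.
Qed.

Lemma divn_gcd_dvd c e : 0 < e -> e %| m ->
  (m %/ gcdn m c %| e) = (m %/ e %| c).
Proof.
move=> e0 em; have g0 : 0 < gcdn m c by rewrite gcdn_gt0 m0.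
rewrite dvdn_divLR ?dvdn_gcdl // dvdn_divLR // muln_gcdr dvdn_gcd dvdn_mull //=.
by rewrite [e * c]mulnC.
Qed.

Lemma ramanujan d : d %| m ->
  (\sum_(c < m | (m %/ gcdn m c == d)%N) z ^+ c = (mobius d)%:~R)%R.
Proof.
have [k] := ubnP d; elim: k d => // k IH d /ltnSE dk dm.
have d0 : 0 < d by apply: dvdn_gt0 dm.
have H : (\sum_(e <- divisors d) \sum_(c < m | (m %/ gcdn m c == e)%N) z ^+ c = (d == 1)%:R)%R.
  rewrite -sum_root_powers //.
  transitivity (\sum_(c < m | (m %/ d %| c)%N) z ^+ c)%R.
    under eq_bigr do rewrite big_mkcond.
    rewrite exchange_big [RHS]big_mkcond /=; apply: eq_bigr => c _.
    rewrite -big_mkcond /= -divn_gcd_dvd //.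
    set q := m %/ gcdn m c; under eq_bigl do rewrite eq_sym.
    by rewrite (sum_delta _ (fun=> (z ^+ c)%R)) ?divisors_uniq // -dvdn_divisors.
  rewrite -(big_mkord (fun c => m %/ d %| c) (fun c => z ^+ c)%R) -[in index_iota _ _](divnK dm).
  have k0 : 0 < m %/ d by rewrite divn_gt0 // dvdn_leq.
  move: (m %/ d) k0 => q q0.
  rewrite (@sum_multiples _ q d (fun c => z ^+ c)%R q0).
  by apply: eq_bigr => i _; rewrite exprM.
have := sum_mobius d0; rewrite (bigD1_seq d) ?divisors_uniq //=; last by rewrite -dvdn_divisors.
move/(congr1 (fun x : int => x%:~R : F)%R); rewrite rmorphD rmorph_sum rmorph_nat -H /=.
rewrite (bigD1_seq d) ?divisors_uniq //=; last by rewrite -dvdn_divisors.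
rewrite [X in (_ + X = _ + _)%R -> _](_ : _ = (\sum_(i <- divisors d | i != d) \sum_(c < m | (m %/ gcdn m c == i)%N) z ^+ c)%R).
  by move/addIr.
rewrite big_seq_cond [RHS]big_seq_cond; apply: eq_bigr => e /andP[].
rewrite -dvdn_divisors // => ed en; rewrite IH //; last exact: dvdn_trans dm.
by apply: leq_trans dk; rewrite ltn_neqAle en dvdn_leq.
Qed.
End Ramanujan.

Section TensorKernel.
Variables (R : comPzRingType) (I X : finType).
Implicit Types (N : X -> X -> R) (s : {perm I}) (w : {ffun I -> X}).

Definition tker N s w w' : R := \prod_i N (w i) (w' (s i)).
Definition kcomp N N' a b : R := \sum_c N a c * N' c b.

Lemma tker_comp N N' s s' w w' :
  \sum_r tker N s w r * tker N' s' r w' = tker (kcomp N N') (s * s') w w'.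
Proof.
transitivity (\sum_(r : {ffun I -> X}) \prod_i (N (w ((s^-1)%g i)) (r i) * N' (r i) (w' (s' i)))).
  apply: eq_bigr => r _; rewrite big_split /=; congr (_ * _).
  rewrite /tker [RHS](reindex_inj (@perm_inj _ s)) /=.
  by apply: eq_bigr => i _; rewrite permK.
rewrite -(bigA_distr_bigA (fun i c => N (w ((s^-1)%g i)) c * N' c (w' (s' i)))) /=.
rewrite (reindex_inj (@perm_inj _ s)) /=; apply: eq_bigr => i _.
by rewrite permK permM.
Qed.

End TensorKernel.

Lemma tker_trace (R : comPzRingType) n (X : finType) (N : X -> X -> R) (s : 'S_n) :
  \sum_w tker N s w w = \prod_(k <- parts (cyc s)) \sum_a walk N k a a.
Proof. exact: sum_prod_cyc. Qed.

Lemma walkD (R : comPzRingType) (X : finType) (N : X -> X -> R) i j a b :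
  walk N (i + j) a b = kcomp (walk N i) (walk N j) a b.
Proof.
elim: i a => [|i IH] a.
  rewrite /kcomp (bigD1 a) //= eqxx mul1r big1 ?addr0 // => c.
  by rewrite eq_sym => /negPf ->; rewrite mul0r.
rewrite addSn /= /kcomp.
transitivity (\sum_c \sum_d N a c * (walk N i c d * walk N j d b)).
  by apply: eq_bigr => c _; rewrite IH mulr_sumr.
rewrite exchange_big; apply: eq_bigr => d _; rewrite mulr_suml.
by apply: eq_bigr => c _; rewrite mulrA.
Qed.

Lemma walkM (R : comPzRingType) (X : finType) (N : X -> X -> R) i j a b :
  walk (walk N i) j a b = walk N (i * j) a b.
Proof.
elim: j a => [|j IH] a; first by rewrite muln0.
by rewrite mulnS walkD /=; apply: eq_bigr => c _; rewrite IH.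
Qed.

Section Rotation.
Variable m : nat.

Definition rot_perm : 'S_m := perm (@ordS_inj m).

Lemma rot_permX c (a : 'I_m) : (rot_perm ^+ c)%g a = ((a + c) %% m)%N :> nat.
Proof.
elim: c => [|c IH]; first by rewrite expg0 perm1 addn0 modn_small.
rewrite expgSr permM permE /= IH addnS.
by rewrite -addn1 modnDml addn1.
Qed.

Lemma rot_permXm : (rot_perm ^+ m = 1)%g.
Proof. by apply/permP => a; apply: ord_inj; rewrite rot_permX perm1 modnDr modn_small. Qed.

Lemma cyc_rot c : (0 < m)%N -> parts (cyc (rot_perm ^+ c)%g) = nseq (gcdn m c) (m %/ gcdn m c)%N.
Proof.
move=> m0; have g0 : (0 < gcdn m c)%N by rewrite gcdn_gt0 m0.
have sz k : k \in parts (cyc (rot_perm ^+ c)%g) -> k = (m %/ gcdn m c)%N.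
  rewrite parts_cyc mem_sort => /mapP[O]; rewrite mem_enum => /imsetP[a _ ->] ->.
  have P j : (#|porbit (rot_perm ^+ c)%g a| %| j)%N = (m %/ gcdn m c %| j)%N.
    rewrite -iter_fixed -permX -expgM -(inj_eq val_inj) /= rot_permX.
    rewrite -{2}[nat_of_ord a](modn_small (ltn_ord a)) -{2}[nat_of_ord a]addn0 eqn_modDl mod0n -/(dvdn _ _).
    rewrite dvdn_divLR ?dvdn_gcdl ?gcdn_gt0 ?m0 // muln_gcdr dvdn_gcd [X in _ = X && _]dvdn_mull //=.
    by rewrite [(j * c)%N]mulnC.
  by apply/eqP; rewrite eqn_dvd -P P !dvdnn.
have e : parts (cyc (rot_perm ^+ c)%g) = nseq (size (cyc (rot_perm ^+ c)%g)) (m %/ gcdn m c)%N.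
  by apply/all_pred1P/allP => k /sz ->; rewrite /= eqxx.
have := sumn_cyc (rot_perm ^+ c)%g; rewrite e sumn_nseq => h; congr nseq.
have d0 : (0 < m %/ gcdn m c)%N by rewrite divn_gt0 // dvdn_leq // dvdn_gcdl.
by apply/eqP; rewrite -(eqn_pmul2l d0) h divnK // dvdn_gcdl.
Qed.
End Rotation.

Section WordKernel.
Variables (n : nat) (X : finType) (z : nat -> algC).
Hypothesis zP : forall m, (0 < m)%N -> m.-primitive_root (z m).

Definition word := {m : 'I_n.+1 & {ffun 'I_m -> X}}.

Variables (R : comNzRingType) (io : {rmorphism algC -> R}).
Implicit Types (N : X -> X -> R) (p q r : word).

(* Klyachko's idempotent (1/m) sum_c z^c rot^c on the words of length m, composed
   with N acting on the letters. *)
Definition wker_at m N (w w' : {ffun 'I_m -> X}) : R :=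
  io m%:R^-1 * \sum_(c < m) io (z m ^+ c) * tker N (rot_perm m ^+ c)%g w w'.

Definition wker N p q : R :=
  (tag p == tag q)%:R * wker_at N (tagged p) (tagged_as p q).

Lemma wker_at_comp m N N' (w w' : {ffun 'I_m -> X}) :
  \sum_r wker_at N w r * wker_at N' r w' = wker_at (kcomp N N') w w'.
Proof.
pose f c := io (z m ^+ c) * tker (kcomp N N') (rot_perm m ^+ c)%g w w'.
transitivity (io m%:R^-1 * (io m%:R^-1 * \sum_(c < m) \sum_(c' < m) f (c + c')%N)).
  rewrite /wker_at.
  transitivity (\sum_r \sum_(c < m) \sum_(c' < m) io m%:R^-1 * (io m%:R^-1 *
    (io (z m ^+ (c + c')) * (tker N (rot_perm m ^+ c)%g w r * tker N' (rot_perm m ^+ c')%g r w')))).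
    apply: eq_bigr => r _; rewrite mulrACA -mulrA mulr_suml !mulr_sumr; apply: eq_bigr => c _.
    rewrite !mulr_sumr; apply: eq_bigr => c' _; rewrite exprD rmorphM.
    by do 2!congr (_ * _); rewrite mulrACA.
  rewrite exchange_big !mulr_sumr; apply: eq_bigr => c _.
  rewrite exchange_big !mulr_sumr; apply: eq_bigr => c' _.
  by rewrite -!mulr_sumr tker_comp -expgD.
have [m0|m0] := posnP m.
  have im : io m%:R^-1 = 0 by rewrite m0 invr0 rmorph0.
  by rewrite /wker_at im !mul0r.
rewrite /wker_at; congr (_ * _).
rewrite (eq_bigr (fun=> \sum_(c < m) f c)) => [|c _].
  rewrite sumr_const card_ord -[(\sum_(c < m) f c) *+ m]mulr_natl -(rmorph_nat io) mulrA -rmorphM mulVf ?rmorph1 ?mul1r //.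
  by rewrite pnatr_eq0 -lt0n.
rewrite [RHS](reindex_inj (@perm_inj _ (rot_perm m ^+ c)%g)) /=; apply: eq_bigr => c' _.
rewrite /f addnC rot_permX (prim_expr_mod (zP m0)); congr (_ * tker _ _ _ _).
rewrite [in LHS](divn_eq (c' + c) m) expgD mulnC expgM rot_permXm expg1n mul1g //.
Qed.

Lemma sum_word (V : nmodType) (F : word -> V) :
  \sum_p F p = \sum_(m < n.+1) \sum_(w : {ffun 'I_m -> X}) F (existT _ m w).
Proof.
pose J (m : 'I_n.+1) : finType := {ffun 'I_m -> X}.
rewrite (@sig_big_dep _ _ _ _ J xpredT (fun=> xpredT) (fun m (w : J m) => F (existT _ m w))) /=.
by apply: eq_bigr => -[].
Qed.

Lemma wker_comp N N' p q : \sum_r wker N p r * wker N' r q = wker (kcomp N N') p q.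
Proof.
case: p q => [m w] [m' w'].
rewrite sum_word (bigD1 m) //= [X in _ + X]big1 ?addr0; last first.
  by move=> i im; rewrite big1 // => j _; rewrite /wker /= eq_sym (negPf im) !mul0r.
rewrite /wker /=; have [e|ne] := eqVneq m m'; last first.
  by rewrite mul0r big1 // => r _; rewrite mul0r mulr0.
case: m' / e w' => w'; rewrite !mul1r tagged_asE -wker_at_comp; apply: eq_bigr => r _.
by rewrite eqxx !mul1r !tagged_asE.
Qed.

Lemma eq_wker N N' p q : (forall a b, N a b = N' a b) -> wker N p q = wker N' p q.
Proof.
move=> e; rewrite /wker /wker_at; do 2!congr (_ * _); apply: eq_bigr => c _.
by congr (_ * _); apply: eq_bigr => i _.
Qed.

Lemma walk_wker N j p q : walk (wker N) j.+1 p q = wker (walk N j.+1) p q.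
Proof.
elim: j p => [|j IH] p; last first.
  rewrite [LHS]/= -[RHS]wker_comp; apply: eq_bigr => r _; by rewrite -IH.
have one (Y : finType) (M : Y -> Y -> R) a b : walk M 1 a b = M a b.
  rewrite /= (bigD1 b) //= eqxx mulr1 big1 ?addr0 // => c /negPf ->; exact: mulr0.
by rewrite one; apply: eq_wker => a b; rewrite one.
Qed.

Lemma wker_trace N : \sum_p wker N p p =
  \sum_(m < n.+1) \sum_(d <- divisors m)
    io ((mobius d)%:~R / m%:R) * (\sum_a walk N d a a) ^+ (m %/ d).
Proof.
rewrite sum_word; apply: eq_bigr => m _.
have [m0|m0] := posnP m.
  have im : io m%:R^-1 = 0 by rewrite m0 invr0 rmorph0.
  rewrite [RHS]big1 => [|d _]; last by rewrite rmorphM im mulr0 mul0r.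
  rewrite big1 // => w _.
  by rewrite /wker /= eqxx tagged_asE /wker_at im mul0r mulr0.
rewrite (eq_bigr (fun w : {ffun 'I_m -> X} => wker_at N w w)); last first.
  by move=> w _; rewrite /wker /= eqxx tagged_asE mul1r.
rewrite -mulr_sumr exchange_big /=.
pose phi d := \sum_a walk N d a a.
rewrite (eq_bigr (fun c : 'I_m => \sum_(d <- divisors m) if (m %/ gcdn m c == d)%N
   then io (z m ^+ c) * phi d ^+ (m %/ d) else 0)); last first.
  move=> c _; rewrite -mulr_sumr tker_trace cyc_rot // big_nseq -Monoid.iteropE -/(phi _) -/(phi _ ^+ _).
  have g0 : (0 < gcdn m c)%N by rewrite gcdn_gt0 m0.
  rewrite -big_mkcond /=; under eq_bigl do rewrite eq_sym.
  rewrite (sum_delta _ (fun d => io (z m ^+ c) * phi d ^+ (m %/ d))) ?divisors_uniq //.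
  rewrite -dvdn_divisors // dvdn_div ?dvdn_gcdl //; congr (_ * _ ^+ _).
  by rewrite divnA ?dvdn_gcdl // mulKn.
rewrite exchange_big mulr_sumr big_seq [RHS]big_seq; apply: eq_bigr => d.
rewrite -dvdn_divisors // => dm; rewrite -big_mkcond -mulr_suml /= mulrA; congr (_ * _).
by rewrite -rmorph_sum -rmorphM (ramanujan m0 (zP m0) dm) mulrC.
Qed.

End WordKernel.

Lemma mono_nseq r c : mono (nseq r c) = expcmn (ucm c) r.
Proof.
by apply: cm_eq => i; rewrite monoE count_nseq expcmnE ucmE /= mulnC; case: eqP.
Qed.

Definition lynpol n j : mseries := \sum_(m < n.+1) \sum_(d <- divisors m)
  ((mobius d)%:~R / m%:R) *: mX (mono (nseq (m %/ d) (j * d))).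

Lemma lynpolE n j m : (0 < j)%N -> (wdeg m <= n)%N -> lynpol n j m = lynser 1 j m.
Proof.
move=> j0 mn; rewrite (lynserE _ j0 mn) /lynpol mseries_sumE big_ord_recl.
rewrite [X in X + _]mseries_sumE [X in X + _]big1 ?add0r; last first.
  by move=> d _; rewrite mseriesZE invr0 mulr0 mul0r.
transitivity (\sum_(i < n) \sum_(d < n) if (d.+1 %| i.+1)%N then
    (mobius d.+1)%:~R / i.+1%:R * mX (mono (nseq (i.+1 %/ d.+1) (j * d.+1))) m else 0).
  apply: eq_bigr => i _; rewrite mseries_sumE /=.
  rewrite (sum_divisors (n := n)) ?ltn_ord // big_mkcond; apply: eq_bigr => d _.
  by [].
rewrite exchange_big; apply: eq_bigr => d _ /=; rewrite /logser.
set c := (j * d.+1)%N; have c0 : (0 < c)%N by rewrite muln_gt0 j0.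
case: ifP => [/andP[r0 pm]|np]; last first.
  rewrite mulr0 big1 // => i _; case: ifP => // di; rewrite /mX.
  case: eqP => [e|]; rewrite ?mulr0 //; move: np.
  rewrite /pure e mono_nseq expcmnE ucmE eqxx muln1 divn_gt0 // dvdn_leq //=.
  by rewrite eqxx.
have w := wdeg_pure pm; set r := m c in r0 w *.
have rn : (d.+1 * r <= n)%N.
  by apply: leq_trans mn; rewrite w /c -mulnA leq_pmull.
have lt : ((d.+1 * r).-1 < n)%N by rewrite prednK // muln_gt0.
rewrite (bigD1 (Ordinal lt)) //= big1 ?addr0; last first.
  move=> i ni; case: ifP => // di; rewrite /mX; case: eqP => [e|]; rewrite ?mulr0 //.
  case/eqP: ni; apply: ord_inj; rewrite /= /r e mono_nseq expcmnE ucmE eqxx muln1.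
  by rewrite mulnC divnK.
rewrite prednK ?muln_gt0 // dvdn_mulr // mulKn // /mX mono_nseq -(eqP pm) eqxx mulr1.
by rewrite expr1n natrM invfM mul1r mulrA.
Qed.

Lemma eq_mseriesM n (F F' G G' : mseries) :
  (forall m, (wdeg m <= n)%N -> F m = F' m) -> (forall m, (wdeg m <= n)%N -> G m = G' m) ->
  forall m, (wdeg m <= n)%N -> (F * G) m = (F' * G') m.
Proof.
move=> FF GG m mn; rewrite !mseriesME; apply: eq_big_seq => a am.
have := divcmK am => e; move: mn; rewrite -{1}e wdegM => mn.
by rewrite FF ?GG //; apply: leq_trans mn; rewrite ?leq_addl ?leq_addr.
Qed.

Lemma lynprod_lynpol n v m : all (fun j => 0 < j)%N v -> (wdeg m <= n)%N ->
  lynprod 1 v m = (\prod_(j <- v) lynpol n j) m.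
Proof.
rewrite /lynprod; elim: v m => [|j v IH] m; first by rewrite !big_nil.
move=> /andP[j0 v0] mn; rewrite !big_cons; apply: (eq_mseriesM (n := n)) => // a an.
  by rewrite lynpolE.
exact: IH.
Qed.

Section ListExpansion.
Variables (P : comAlgType algC) (phi : nat -> P).

(* F and w are the values of one polynomial at the p_r and at the phi r. *)
Definition same_poly (F : mseries) (w : P) := exists l : seq (rat * seq nat),
  [/\ all (fun x => all (fun r => 0 < r)%N x.2) l,
      F = \sum_(x <- l) x.1 *: mX (mono x.2) &
      w = \sum_(x <- l) ratr x.1 *: \prod_(r <- x.2) phi r].

Lemma same_polyM F w F' w' : same_poly F w -> same_poly F' w' -> same_poly (F * F') (w * w').
Proof.
move=> [l [lp -> ->]] [l' [lp' -> ->]].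
exists [seq (x.1 * y.1, x.2 ++ y.2) | x <- l, y <- l']; split.
- apply/allP => _ /allpairsP[[x y] /= [xl yl ->]] /=; rewrite all_cat.
  by rewrite (allP lp) // (allP lp').
- rewrite big_allpairs_dep /= mulr_suml; apply: eq_bigr => x _.
  rewrite mulr_sumr; apply: eq_bigr => y _.
  by rewrite -scalerAl -scalerAr scalerA mono_cat mXM.
rewrite big_allpairs_dep /= mulr_suml; apply: eq_bigr => x _.
rewrite mulr_sumr; apply: eq_bigr => y _.
by rewrite -scalerAl -scalerAr scalerA rmorphM big_cat.
Qed.

Lemma same_polyD F w F' w' : same_poly F w -> same_poly F' w' -> same_poly (F + F') (w + w').
Proof.
move=> [l [lp -> ->]] [l' [lp' -> ->]]; exists (l ++ l'); split.
- by rewrite all_cat lp.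
- by rewrite big_cat.
by rewrite big_cat.
Qed.

Lemma same_poly0 : same_poly 0 0.
Proof. by exists [::]; rewrite !big_nil. Qed.

Lemma same_poly1 : same_poly 1 1.
Proof. by exists [:: (1, [::])]; rewrite !big_seq1 rmorph1 !scale1r big_nil /mono big_nil. Qed.

Lemma same_polyU (c : rat) s : all (fun r => 0 < r)%N s ->
  same_poly (c *: mX (mono s)) (ratr c *: \prod_(r <- s) phi r).
Proof. by move=> s0; exists [:: (c, s)]; rewrite !big_seq1 /= s0. Qed.

Lemma same_poly_sum I (r : seq I) (F : I -> mseries) (w : I -> P) (Q : pred I) :
  (forall i, Q i -> same_poly (F i) (w i)) ->
  same_poly (\sum_(i <- r | Q i) F i) (\sum_(i <- r | Q i) w i).
Proof. by move=> h; apply: big_ind2 => //; [exact: same_poly0 | move=> *; exact: same_polyD]. Qed.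

Lemma same_poly_prod (I : eqType) (r : seq I) (F : I -> mseries) (w : I -> P) :
  (forall i, i \in r -> same_poly (F i) (w i)) ->
  same_poly (\prod_(i <- r) F i) (\prod_(i <- r) w i).
Proof.
elim: r => [|i r IH] h; first by rewrite !big_nil; exact: same_poly1.
rewrite !big_cons; apply: same_polyM; first by apply: h; rewrite mem_head.
by apply: IH => j jr; apply: h; rewrite inE jr orbT.
Qed.

Lemma same_poly_lynpol n j : (0 < j)%N -> same_poly (lynpol n j)
  (\sum_(m < n.+1) \sum_(d <- divisors m) ((mobius d)%:~R / m%:R) *: phi (j * d)%N ^+ (m %/ d)).
Proof.
move=> j0; apply: same_poly_sum => m _; rewrite big_seq [X in same_poly _ X]big_seq.
have [m0|m0] := posnP m.
  rewrite !big1 => [|d _|d _]; first exact: same_poly0.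
    by rewrite m0 invr0 mulr0 scale0r.
  by rewrite m0 invr0 mulr0 scale0r.
apply: same_poly_sum => d; rewrite -dvdn_divisors // => dm.
have d0 := dvdn_gt0 m0 dm.
have := @same_polyU ((mobius d)%:~R / m%:R) (nseq (m %/ d) (j * d)).
rewrite all_nseq muln_gt0 j0 d0 orbT => /(_ isT).
rewrite fmorph_div rmorph_int rmorph_nat big_nseq -Monoid.iteropE -/(phi _ ^+ _).
exact.
Qed.
End ListExpansion.

Lemma conj_count n (h g : 'S_n) :
  \sum_(u : 'S_n) ((h ^ u)%g == g)%:R = (cyc h == cyc g)%:R * zof (mono (cyc g)).
Proof.
have [e|ne] := eqVneq (cyc h) (cyc g); last first.
  rewrite mul0r big1 // => u _; case: eqP => // e.
  by case/eqP: ne; rewrite -e cycJ.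
pose N g' : rat := \sum_(u : 'S_n) ((h ^ u)%g == g')%:R.
have NJ g' : cyc g' == cyc h -> N g' = N h.
  move=> /eqP/esym/cyc_conj[u ->]; rewrite /N (reindex_inj (mulIg u)) /=.
  by apply: eq_bigr => x _; rewrite conjgM (inj_eq (@conjg_inj _ u)).
have gn : cyc g \in ptn n by rewrite mem_ptn sumn_cyc.
have c0 : (cyc_count n (cyc g))%:R != 0 :> rat by rewrite pnatr_eq0 -lt0n cyc_count_gt0.
have f0 : n`!%:R != 0 :> rat by rewrite pnatr_eq0 -lt0n fact_gt0.
rewrite mul1r -/(N g) NJ ?e ?eqxx //; apply: (mulfI c0).
rewrite -[zof _]invrK -(cyc_count_zof gn) invf_div mulrCA divff // mulr1.
transitivity (\sum_(g' | cyc g' == cyc g) N g').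
  rewrite (eq_bigr (fun=> N h)) => [|g' /eqP ge]; last by rewrite NJ // ge e.
  rewrite sumr_const mulr_natl /cyc_count; congr (_ *+ _).
  by apply: eq_card => x; rewrite !inE.
transitivity (\sum_(u : 'S_n) (1 : rat)); last first.
  by rewrite sumr_const -[RHS]mulr_natl mulr1 (eq_card (B := [set: 'S_n])) ?cardsT ?card_Sn // => u; rewrite !inE.
rewrite /N exchange_big; apply: eq_bigr => u _ /=.
rewrite (bigD1 (h ^ u)%g) ?cycJ ?e ?eqxx //= big1 ?addr0 // => g' /andP[_].
by rewrite eq_sym => /negPf ->.
Qed.

Local Notation wpoly := {malg algC[{cmonom nat}]}.

Definition fullmono n : {cmonom nat} := \big[mmul/mone]_(i < n) ucm (i : nat).

Lemma malgUM (c d : algC) (m m' : {cmonom nat}) : << c *g m >> * << d *g m' >> = << c * d *g mmul m m' >> :> wpoly.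
Proof. by rewrite malgM_def fgmulUU. Qed.

Lemma malg_prodU (I : finType) (c : I -> algC) (m : I -> {cmonom nat}) :
  \prod_i << c i *g m i >> = << \prod_i c i *g \big[mmul/mone]_i m i >> :> wpoly.
Proof.
apply: (big_rec3 (fun x y z => z = << y *g x >>)) => [|i x y w _ ->] //.
by rewrite malgUM.
Qed.

Lemma malgUZ (a c : algC) (m : {cmonom nat}) : a *: << c *g m >> = << a * c *g m >> :> wpoly.
Proof. by rewrite -mul_malgC malgUM mul1m. Qed.

Definition permker (R : pzRingType) n (g : 'S_n) (a b : 'I_n) : R := (a == g b)%:R.
(* The weights of the letters single out, as the coefficient at fullmono, the
   tuples of words in which every letter occurs exactly once. *)
Definition wpermker n (g : 'S_n) (a b : 'I_n) : wpoly := << permker algC g a b *g ucm (a : nat) >>.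
Definition letter_psum n (g : 'S_n) r : wpoly := \sum_a walk (wpermker g) r a a.

Lemma tker_wpermker n k (g : 'S_n) (s : 'S_k) (w w' : {ffun 'I_k -> 'I_n}) :
  tker (wpermker g) s w w' =
  << tker (permker algC g) s w w' *g \big[mmul/mone]_i ucm (w i : nat) >>.
Proof. exact: malg_prodU. Qed.

Lemma mdeg_fullmono n : mdeg (fullmono n) = n.
Proof.
rewrite /fullmono; elim: n => [|n IH]; first by rewrite big_ord0 mdeg1.
by rewrite big_ord_recr /= mdegM mdegU IH addn1.
Qed.

Lemma mdeg_prod_ucm k n (f : 'I_k -> 'I_n) : mdeg (\big[mmul/mone]_i ucm (f i : nat)) = k.
Proof.
elim: k f => [|k IH] f; first by rewrite big_ord0 mdeg1.
by rewrite big_ord_recr /= mdegM mdegU (IH (fun i => f (widen_ord (leqnSn k) i))) addn1.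
Qed.

Lemma prod_ucm_fullP n (f : 'I_n -> 'I_n) :
  reflect (injective f) (\big[mmul/mone]_i ucm (f i : nat) == fullmono n).
Proof.
apply: (iffP eqP) => [e|f_inj]; last first.
  by rewrite [fullmono n](reindex_inj f_inj).
have fsurj b : exists a, f a == b.
  have := congr1 (fun m : {cmonom nat} => m b) e; rewrite !cm_prodE.
  rewrite [RHS](bigD1 b) //= ucmE eqxx add1n => h.
  apply/existsP; apply: contra_eqT h => /existsPn h; rewrite big1 // => a _.
  by rewrite ucmE; case: eqP => // /ord_inj fa; case/eqP: (h a).
have fK : cancel (fun b => xchoose (fsurj b)) f by move=> b; apply/eqP; exact: (xchooseP (fsurj b)).
exact: can_inj (canF_sym fK).
Qed.

Lemma permker_conj n (g h u : 'S_n) :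
  tker (permker algC g) h (finfun u) (finfun u) = ((h ^ u)%g == g^-1%g)%:R.
Proof.
rewrite /tker /permker; under eq_bigr do rewrite !ffunE.
have [e|ne] := eqVneq (h ^ u)%g g^-1%g.
  rewrite big1 // => i _; have := congr1 (fun p : 'S_n => g (p (u i))) e.
  by rewrite permJ permKV => ->; rewrite eqxx.
case: (pickP (fun i => u i != g (u (h i)))) => [i ni|all_eq].
  by rewrite (bigD1 i) //= (negPf ni) mul0r.
case/eqP: ne; apply/permP => x; rewrite -(permKV u x) permJ; apply: (@perm_inj _ g).
by rewrite permKV; move: (all_eq ((u^-1)%g x)) => /negbFE/eqP <-.
Qed.

Lemma phi_coef n (g : 'S_n) s : all (fun r => 0 < r)%N s ->
  (\prod_(r <- s) letter_psum g r)@_(fullmono n) =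
  ratr ((mono s == mono (cyc g))%:R * zof (mono (cyc g))).
Proof.
move=> s0.
have [rho mr] : exists rho : intpart, mono rho = mono s.
  by apply: mono_surj; rewrite monoE; apply/count_memPn; apply/negP => /(allP s0).
have rs : perm_eq s rho by apply/allP => x _ /=; rewrite -!monoE mr.
rewrite (perm_big _ rs) -mr /=.
have rn : rho \in ptn (sumn rho) by rewrite mem_ptn.
have [h hr] := cyc_surj rn; rewrite -{1}hr -sum_prod_cyc raddf_sum /=.
under eq_bigr do rewrite -/(tker _ _ _ _) tker_wpermker mcoeffU.
move: (sumn rho) h hr {rn rs} => k h hr.
have [kn|kn] := eqVneq k n; last first.
  rewrite big1 => [|f _]; last first.
    case: eqP => // /(congr1 (@mdeg nat)); rewrite mdeg_prod_ucm mdeg_fullmono => e.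
    by case/eqP: kn.
  case: eqP => [/mono_part_inj e|_]; last by rewrite mul0r rmorph0.
  by case/eqP: kn; rewrite -(sumn_cyc h) hr e sumn_cyc.
case: n / kn g => g.
rewrite (inj_eq mono_part_inj) -hr -(cycV g) -conj_count rmorph_sum /=.
rewrite (bigID (fun f : {ffun 'I_k -> 'I_k} => injectiveb f)) /= [X in _ + X]big1 ?addr0; last first.
  by move=> f nf; case: prod_ucm_fullP => // /injectiveP fi; rewrite fi in nf.
rewrite (reindex (fun u : 'S_k => val u)) /=; last first.
  by exists (insubd (1%g : 'S_k)) => f; rewrite inE => fi; [exact: valKd | exact: insubdK].
apply: eq_big => [u|u _]; first exact: (valP u).
have -> : val u = finfun u by apply/ffunP => x; rewrite ffunE -pvalE.
rewrite permker_conj rmorph_nat.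
rewrite (introT (prod_ucm_fullP _)) // => i j; rewrite !ffunE; exact: perm_inj.
Qed.

Section WordTrace.
Variable z : nat -> algC.
Hypothesis zP : forall m, (0 < m)%N -> m.-primitive_root (z m).

Definition wt n (p : word n 'I_n) : {cmonom nat} :=
  \big[mmul/mone]_(i < tag p) ucm (tagged p i : nat).

Lemma wker_wpermker n (g : 'S_n) (p q : word n 'I_n) :
  wker z malgC (wpermker g) p q = << wker z idfun (permker algC g) p q *g wt p >>.
Proof.
case: p q => [m w] [m' w']; rewrite /wker /=; have [e|_] := eqVneq m m'; last first.
  by rewrite !mul0r monalgU0.
case: m' / e w' => w'; rewrite tagged_asE !mul1r /wker_at mul_malgC -malgUZ; congr (_ *: _).
rewrite (raddf_sum (mkmalgU _)) /=; apply: eq_bigr => c _.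
by rewrite mul_malgC tker_wpermker malgUZ.
Qed.

Lemma word_trace n k (g : 'S_n) (v : 'S_k) :
  \sum_(Y : {ffun 'I_k -> word n 'I_n})
    (\big[mmul/mone]_i wt (Y i) == fullmono n)%:R *
       tker (wker z idfun (permker algC g)) v Y Y =
  ratr (zof (mono (cyc g)) * lynprod 1 (cyc v) (mono (cyc g))).
Proof.
transitivity ((\sum_(Y : {ffun 'I_k -> word n 'I_n})
    tker (wker z malgC (wpermker g)) v Y Y)@_(fullmono n)).
  rewrite raddf_sum /=; apply: eq_bigr => Y _.
  rewrite /tker; under [in RHS]eq_bigr do rewrite wker_wpermker.
  by rewrite malg_prodU mcoeffU mulr_natl.
rewrite tker_trace.
have vpos : all (fun j => 0 < j)%N (cyc v) by exact: intpart_allgt0.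
have [l [lp FE ->]] : same_poly (letter_psum g) (\prod_(j <- cyc v) lynpol n j)
    (\prod_(j <- cyc v) \sum_(a : word n 'I_n) walk (wker z malgC (wpermker g)) j a a).
  apply: same_poly_prod => j /(allP vpos) j0.
  have := same_poly_lynpol (letter_psum g) n j0; congr same_poly.
  case: j j0 => // j _; under [RHS]eq_bigr do rewrite (walk_wker zP).
  rewrite (wker_trace n zP); apply: eq_bigr => m _; apply: eq_bigr => d _.
  have -> : \sum_a walk (walk (wpermker g) j.+1) d a a = letter_psum g (j.+1 * d)%N.
    by apply: eq_bigr => a _; rewrite walkM.
  by rewrite mul_malgC.
rewrite (lynprod_lynpol (n := n)) // ?wdeg_mono ?sumn_cyc // FE mseries_sumE mulr_sumr rmorph_sum.
rewrite raddf_sum /= big_seq [RHS]big_seq; apply: eq_bigr => x /(allP lp) x0.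
rewrite mcoeffZ phi_coef // mseriesZE /mX -rmorphM [mono (cyc g) == _]eq_sym; congr ratr; ring.
Qed.

End WordTrace.

Section LieMultiplicity.
Variable z : nat -> algC.
Hypothesis zP : forall m, (0 < m)%N -> m.-primitive_root (z m).
Variables (k n : nat).
Local Notation Y := {ffun 'I_k -> word n 'I_n}.

Definition ywt (y : Y) : {cmonom nat} := \big[mmul/mone]_i wt (y i).

Lemma eq_fullmono (y : Y) : (ywt y == fullmono n) = [forall b : 'I_n, ywt y b == 1%N].
Proof.
have f1 (b : 'I_n) : fullmono n b = 1%N.
  rewrite /fullmono [LHS]cm_prodE (bigD1 b) //= ucmE eqxx big1 ?addn0 // => i ib.
  by rewrite ucmE; case: eqP => // /ord_inj e; case/eqP: ib.
apply/eqP/forallP => [-> b|h]; first by rewrite f1.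
apply: cm_eq => i; case: (ltnP i n) => [lt|ge].
  by have /eqP := h (Ordinal lt); rewrite -(f1 (Ordinal lt)).
rewrite /ywt /fullmono [LHS]cm_prodE [RHS]cm_prodE !big1 // => j _.
  by rewrite ucmE; case: eqP => // e; move: ge; rewrite -e leqNgt ltn_ord.
rewrite cm_prodE big1 // => a _; rewrite ucmE; case: eqP => // e.
by move: ge; rewrite -e leqNgt ltn_ord.
Qed.

Lemma tker_neq0 (X I : finType) (N : X -> X -> algC) (s : {perm I}) w w' :
  tker N s w w' != 0 -> forall i, N (w i) (w' (s i)) != 0.
Proof. by move=> h i; apply: contraNneq h => e; rewrite /tker (bigD1 i) //= e mul0r. Qed.

Lemma wt_wker (g : 'S_n) (p q : word n 'I_n) (b : 'I_n) :
  wker z idfun (permker algC g) p q != 0 -> wt p (g b) = wt q b.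
Proof.
case: p q => [m w] [m' w']; rewrite /wker /=.
have [e|_] := eqVneq m m'; last by rewrite mul0r eqxx.
case: m' / e w' => w'; rewrite mul1r tagged_asE /wker_at /= => h.
have [c hc] : exists c : 'I_m, tker (permker algC g) (rot_perm m ^+ c)%g w w' != 0.
  apply/existsP; apply: contraNT h => /existsPn h; rewrite big1 ?mulr0 // => c _.
  by move: (h c); rewrite negbK => /eqP ->; rewrite mulr0.
rewrite /wt [LHS]cm_prodE [RHS]cm_prodE /= [RHS](reindex_inj (@perm_inj _ (rot_perm m ^+ c)%g)) /=.
apply: eq_bigr => i _; have := tker_neq0 hc i; rewrite /permker pnatr_eq0 eqb0 negbK => /eqP ->.
by rewrite !ucmE !(inj_eq (@ord_inj _)) (inj_eq perm_inj).
Qed.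

Definition lker (v : 'S_k) (g : 'S_n) (y y' : Y) : algC :=
  (ywt y == fullmono n)%:R * tker (wker z idfun (permker algC g)) v y y'.

Lemma full_tker (v : 'S_k) (g : 'S_n) y y' :
  tker (wker z idfun (permker algC g)) v y y' != 0 ->
  (ywt y == fullmono n) = (ywt y' == fullmono n).
Proof.
move=> h; have e b : ywt y (g b) = ywt y' b.
  rewrite /ywt [LHS]cm_prodE [RHS]cm_prodE [RHS](reindex_inj (@perm_inj _ v)) /=.
  by apply: eq_bigr => i _; apply: wt_wker (tker_neq0 h i).
rewrite !eq_fullmono; apply/forallP/forallP => H b; first by rewrite -e.
by rewrite -(permKV g b) e.
Qed.

Lemma lker_comp v g v' g' y y'' :
  \sum_y' lker v g y y' * lker v' g' y' y'' = lker (v * v')%g (g' * g)%g y y''.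
Proof.
rewrite /lker.
transitivity ((ywt y == fullmono n)%:R * \sum_(y' : Y)
   tker (wker z idfun (permker algC g)) v y y' * tker (wker z idfun (permker algC g')) v' y' y'').
  rewrite mulr_sumr; apply: eq_bigr => y' _; 
  have [->|h] := eqVneq (tker (wker z idfun (permker algC g)) v y y') 0; first by rewrite !(mulr0, mul0r).
  by rewrite -(full_tker h); case: (_ == _); rewrite ?mul0r ?mul1r.
rewrite tker_comp; congr (_ * _); apply: eq_bigr => i _.
rewrite /kcomp (wker_comp zP); apply: eq_wker => a b.
rewrite /kcomp /permker (bigD1 (g' b)) //= eqxx mulr1 big1 ?addr0 ?permM // => c /negPf ->.
by rewrite mulr0.
Qed.

Definition lmx v g : 'M[algC]_#|{: Y}| :=
  \matrix_(i, j) lker v g (enum_val i) (enum_val j).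

Lemma lmxM v g v' g' : lmx v g *m lmx v' g' = lmx (v * v')%g (g' * g)%g.
Proof.
apply/matrixP => i j; rewrite !mxE -lker_comp.
rewrite (reindex (enum_val (A := {: Y}))) /=; last by apply: onW_bij; exact: enum_val_bij.
by apply: eq_bigr => y _; rewrite !mxE.
Qed.

Lemma lmx_trace v g :
  \tr (lmx v g) = ratr (zof (mono (cyc g)) * lynprod 1 (cyc v) (mono (cyc g))).
Proof.
rewrite -(word_trace zP) /mxtrace.
rewrite [RHS](reindex (enum_val (A := {: Y}))) /=; last by apply: onW_bij; exact: enum_val_bij.
by apply: eq_bigr => y _; rewrite mxE.
Qed.

End LieMultiplicity.

Section ScaledSums.
Variables (gT : finGroupType) (N : nat).
Implicit Types (e : galg gT) (F H : gT -> 'M[algC]_N).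

Lemma galg_conv e e' H :
  \sum_x \sum_y ratr (e x * e' y) *: H (x * y)%g = \sum_x ratr ((e * e') x) *: H x.
Proof.
transitivity (\sum_x \sum_y ratr (e x * e' (x^-1 * y)%g) *: H y).
  by apply: eq_bigr => x _; rewrite [RHS](reindex_inj (mulgI x)) /=; apply: eq_bigr => y _; rewrite mulKg.
rewrite exchange_big; apply: eq_bigr => y _.
by rewrite galgME rmorph_sum scaler_suml.
Qed.

Lemma galg_mulmx e e' F F' H : (forall x y, F x *m F' y = H (x * y)%g) ->
  (\sum_x ratr (e x) *: F x) *m (\sum_y ratr (e' y) *: F' y) = \sum_x ratr ((e * e') x) *: H x.
Proof.
move=> FH; rewrite -galg_conv mulmx_suml; apply: eq_bigr => x _.
rewrite mulmx_sumr; apply: eq_bigr => y _.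
by rewrite -scalemxAl -scalemxAr scalerA FH rmorphM.
Qed.

Lemma galg_mulmx_op e e' F F' H : (forall x y, F x *m F' y = H (y * x)%g) ->
  (\sum_x ratr (e x) *: F x) *m (\sum_y ratr (e' y) *: F' y) = \sum_x ratr ((e' * e) x) *: H x.
Proof.
move=> FH; rewrite -galg_conv mulmx_suml exchange_big; apply: eq_bigr => x _.
rewrite mulmx_sumr; apply: eq_bigr => y _.
by rewrite -scalemxAl -scalemxAr scalerA FH rmorphM mulrC.
Qed.

End ScaledSums.

Lemma schur_coef_Lsum_nat mu ka : exists m : nat, schur_coef (Lsum 1 mu) ka = m%:R.
Proof.
have /choice[z zP] : forall m, exists z : algC, (0 < m)%N -> m.-primitive_root z.
  move=> m; have [->|m0] := posnP m; first by exists 0.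
  by have [z zm] := C_prim_root_exists m0; exists z.
set k := sumn mu; set n := sumn ka.
pose Eg (v : 'S_k) := \sum_g ratr (specht_idem ka g) *: lmx z v (g : 'S_n).
pose E := \sum_v ratr (specht_idem mu v) *: Eg (v : 'S_k).
have EgM v v' : Eg v *m Eg v' = Eg (v * v')%g.
  by rewrite /Eg (galg_mulmx_op _ _ (H := lmx z (v * v')%g)) ?specht_idemM // => x y; rewrite lmxM.
have EE : E *m E = 1 *: E.
  rewrite [RHS](_ : _ = E); last by apply/matrixP => i j; rewrite mxE mul1r.
  by rewrite /E (galg_mulmx _ _ EgM) specht_idemM.
exists (\rank E); apply: (@fmorph_inj _ _ (ratr : rat -> algC)) => /=.
rewrite ratr_nat -[RHS]mul1r -(mxtrace_quasi_idem EE) /E linear_sum /=.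
have -> : schur_coef (Lsum 1 mu) ka = \sum_(v : 'S_k) specht_idem mu v *
    \sum_(g : 'S_n) specht_idem ka g * (zof (mono (cyc g)) * lynprod 1 (cyc v) (mono (cyc g))).
  rewrite (@sum_idem_cyc k mu (fun rho => \sum_(g : 'S_n) specht_idem ka g * (zof (mono (cyc g)) * lynprod 1 rho (mono (cyc g))))).
  rewrite /schur_coef /Lsum; under eq_bigr do rewrite mseries_sumE mulr_suml.
  rewrite exchange_big; apply: eq_bigr => rho _.
  rewrite (@sum_idem_cyc n ka (fun si => zof (mono si) * lynprod 1 rho (mono si))) mulr_sumr.
  apply: eq_big_seq => si sn; rewrite mseriesZE (idem_at_zof ka sn).
  have := gt_eqF (zof_gt0 si).
  move: (zof _) (idem_at _ _ _) (chi_at _ _ _) (lynprod _ _ _) => a b c d /negbT a0.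
  by rewrite [c / a * _]mulrA divfK // -mulrA [d * c]mulrC.
rewrite rmorph_sum; apply: eq_bigr => v _; rewrite linearZ /= rmorphM; congr (_ * _).
rewrite linear_sum rmorph_sum; apply: eq_bigr => g _.
by rewrite linearZ /= rmorphM lmx_trace.
Qed.

(** * Integrality and uniqueness *)

Lemma signz_subn (K : unitRingType) m n : (-1 : K) ^ (m%:Z - n%:Z) = (-1) ^+ (m + n).
Proof.
by rewrite exprzDr ?unitrN1 // -exprz_inv invrN1 exprD.
Qed.

Lemma bcoefq_sign mu ka : exists m : nat, bcoefq mu ka = (-1) ^+ (sumn ka + sumn mu) * m%:R.
Proof.
rewrite /bcoefq -mulr_sumr.
have /choice[f fE] : forall th : intpart, exists m : nat,
  schur_coef (Lsum 1 (transpose mu)) (transpose th) = m%:R by move=> th; exact: schur_coef_Lsum_nat.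
exists (\sum_(th <- ptnle (sumn ka) | vstrip ka th) f th)%N.
by rewrite natr_sum; congr (_ * _); apply: eq_bigr => th _.
Qed.

Section InverseMatrix.
Variable C : numClosedFieldType.

Lemma inverse_acoef_unique b mu nu :
  is_inverse_acoef C b -> (b mu nu)%:~R = bcoefq mu nu.
Proof.
move=> [b0 bP]; have [mn|mn] := boolP (sumn mu <= sumn nu)%N; last first.
  by rewrite b0 // bcoefq0.
have bq ka : \sum_(lam <- ptnle (sumn nu)) (b lam nu)%:~R * acoefq lam ka = (nu == ka)%:R.
  have := congr1 (fun x : int => x%:~R : rat) (bP nu ka).
  rewrite -pmulrn => <-; rewrite (fsbigE (ptnle (sumn nu))) ?ptnle_uniq //; last first.
    by move=> lam _; rewrite mem_ptnle => ln; rewrite b0 ?mul0r.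
  rewrite rmorph_sum [RHS]big_mkcond; apply: eq_bigr => lam _.
  by rewrite in_setT rmorphM /= -pmulrn acoefE.
transitivity (\sum_(lam <- ptnle (sumn nu)) (b lam nu)%:~R * (lam == mu)%:R : rat).
  under eq_bigr do rewrite mulr_natr mulrb.
  by rewrite -big_mkcond /= sum_delta ?ptnle_uniq // mem_ptnle mn.
transitivity (\sum_(ka <- ptnle (sumn nu)) (nu == ka)%:R * bcoefq mu ka); last first.
  under eq_bigr do rewrite mulr_natl mulrb eq_sym.
  by rewrite -big_mkcond /= sum_delta ?ptnle_uniq // mem_ptnle leqnn.
under [RHS]eq_bigr do rewrite -bq mulr_suml.
rewrite exchange_big; apply: eq_big_seq => lam; rewrite mem_ptnle => ln.
rewrite -(acoef_bcoef mu ln) mulr_sumr; apply: eq_bigr => ka _.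
by rewrite mulrA.
Qed.

Lemma inverse_acoef_exists : exists b, is_inverse_acoef C b.
Proof.
have /choice[s sE] : forall x : intpart * intpart, exists m : nat,
  bcoefq x.1 x.2 = (-1) ^+ (sumn x.2 + sumn x.1) * m%:R by move=> x; exact: bcoefq_sign.
pose b (lam nu : intpart) : int := (-1) ^+ (sumn nu + sumn lam) * (s (lam, nu))%:Z.
have bE lam nu : (b lam nu)%:~R = bcoefq lam nu.
  by rewrite (sE (lam, nu)) /b rmorphM rmorph_sign /= -pmulrn.
exists b; split=> [lam nu ln|nu ka].
  by apply: (@intr_inj rat); rewrite bE bcoefq0.
apply: (@intr_inj rat); rewrite (fsbigE (ptnle (sumn nu))) ?ptnle_uniq //; last first.
  by move=> lam _; rewrite mem_ptnle => ln; rewrite (_ : b lam nu = 0) ?mul0r //; apply: (@intr_inj rat); rewrite bE bcoefq0.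
rewrite -[RHS]/((nu == ka)%:R : rat).
transitivity (\sum_(lam <- ptnle (sumn nu)) bcoefq lam nu * acoefq lam ka).
  rewrite rmorph_sum [LHS]big_mkcond; apply: eq_bigr => lam _.
  by rewrite in_setT rmorphM /= bE -pmulrn acoefE.
have [kn|nk] := leqP (sumn ka) (sumn nu); first exact: bcoef_acoef.
rewrite big1_seq => [|lam /andP[_]]; last first.
  by rewrite mem_ptnle => ln; rewrite acoefq0 ?mulr0 //; exact: leq_ltn_trans nk.
by case: eqP nk => // ->; rewrite ltnn.
Qed.

Lemma bcoefE lam nu : (bcoef C lam nu)%:~R = bcoefq lam nu.
Proof. by apply: inverse_acoef_unique; exact: (xgetPex (fun _ _ => 0) inverse_acoef_exists). Qed.

End InverseMatrix.

Local Open Scope classical_set_scope.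
Local Open Scope ring_scope.

Theorem theorem2 (R : realType) (lam nu : intpart) :
  ((bcoef R[i] lam nu)%:~R : rat) =
    \sum_(mu \in [set mu : intpart | vertical_strip nu mu])
       (-1) ^ ((sumn nu)%:Z - (sumn lam)%:Z) *
       hall_schur (transpose mu) (plethysm (schur (transpose lam)) lyndon_series)
  /\ 0 <= (-1) ^ ((sumn nu)%:Z - (sumn lam)%:Z) * bcoef R[i] lam nu.
Proof.
split.
  rewrite bcoefE /bcoefq (fsbigE [seq mu : intpart <- ptnle (sumn nu) | vstrip nu mu]).
  - rewrite big_filter_cond [RHS]big_mkcond [LHS]big_mkcond; apply: eq_bigr => mu _.
    rewrite hall_schur_plethysm signz_subn; case: vstripP => vs //=.
    by rewrite mem_set.
  - by rewrite filter_uniq ?ptnle_uniq.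
  - by move=> mu /=; rewrite mem_filter => /andP[/vstripP].
  move=> mu /vstripP vs; rewrite mem_filter vs mem_ptnle => /negP[].
  exact: vstrip_sumn.
have [m e] := bcoefq_sign lam nu; rewrite -(bcoefE R[i]) in e.
have -> : bcoef R[i] lam nu = (-1) ^+ (sumn nu + sumn lam) * m%:Z.
  by apply: (@intr_inj rat); rewrite e rmorphM rmorph_sign /= -pmulrn.
by rewrite signz_subn mulrA -expr2 sqrr_sign mul1r.
Qed.
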